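(* Let $k\in\{\mathbb{R},\mathbb{C}\}$ be fixed. Each of the following categories of vector spaces over $k$, furnished with the linear and continuous maps as morphisms, is quasi-abelian but neither left integral nor right integral: (i) $\mathsf{BAN}$ of Banach spaces; (ii) $\mathsf{NOR}$ of normed spaces; (iii) $\mathsf{FRE}$ of Fréchet spaces; (iv) $\mathsf{HD\text{-}LCS}$ of Hausdorff locally convex spaces; (v) $\mathsf{HD\text{-}TVS}$ of Hausdorff topological vector spaces; (vi) $\mathsf{NUC}$ of nuclear spaces; (vii) $\mathsf{FN}$ of nuclear Fréchet spaces; (viii) $\mathsf{FS}$ of Fréchet-Schwartz spaces; (ix) $\mathsf{FH}$ of Fréchet-Hilbert spaces.
   Context: All spaces here are Hausdorff topological vector spaces over $k$. A Fréchet space is a complete metrizable locally convex space. A nuclear space is a Hausdorff locally convex space $E$ such that for every continuous semi-norm $p$ there is a continuous semi-norm $q\geqslant p$ for which the canonical map $E_q\to E_p$ between the local Banach spaces (the completions of $E/q^{-1}(0)$ and $E/p^{-1}(0)$ under the induced norms) is a nuclear operator. A Fréchet-Schwartz space is a Fréchet space in which for every $0$-neighbourhood $U$ there is a $0$-neighbourhood $V$ such that for every $\varepsilon>0$ there are finitely many $x_1,\dots,x_n$ with $V\subseteq\bigcup_{i}(x_i+\varepsilon U)$. A Fréchet-Hilbert space is a Fréchet space whose topology is generated by semi-norms of the form $p(x)=\langle x,x\rangle^{1/2}$ with $\langle\cdot,\cdot\rangle$ a positive semi-definite Hermitian (symmetric if $k=\mathbb{R}$) form. An additive category is pre-abelian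 if every morphism has a kernel and a cokernel. A morphism is called ''a kernel'' (resp. ''a cokernel'') if it is the kernel (resp. cokernel) of some morphism. A class $\mathcal{X}$ of morphisms is stable under pullback if in any pullback square with $a\colon A\to B$, $b\colon A\to C$, $c\colon B\to D$, $d\colon C\to D$ and $c\circ a=d\circ b$, one has $a\in\mathcal{X}$ whenever $d\in\mathcal{X}$; stability under pushout is defined dually. A pre-abelian category is left quasi-abelian if cokernels are stable under pullback, right quasi-abelian if kernels are stable under pushout, and quasi-abelian if it is both. A pre-abelian category is left integral if epimorphisms are stable under pullback, and right integral if monomorphisms are stable under pushout. *)

(* Defs.v *)
From HB Require Import structures.
From mathcomp Require Import all_boot all_order all_algebra.
From mathcomp Require Import all_classical all_reals all_analysis.
From mathcomp Require Import complex.

Set Implicit Arguments.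
Unset Strict Implicit.
Unset Printing Implicit Defensive.

Import Order.TTheory GRing.Theory Num.Theory.
Import numFieldTopology.Exports numFieldNormedType.Exports.

Local Open Scope classical_set_scope.
Local Open Scope ring_scope.

Record preadditive := Preadditive {
  obj :> Type ;
  hom : obj -> obj -> zmodType ;
  idm : forall A, hom A A ;
  comp : forall A B C, hom B C -> hom A B -> hom A C ;
  compA : forall A B C D (h : hom C D) (g : hom B C) (f : hom A B),
    comp h (comp g f) = comp (comp h g) f ;
  comp1m : forall A B (f : hom A B), comp (idm B) f = f ;
  compm1 : forall A B (f : hom A B), comp f (idm A) = f ;
  compDl : forall A B C (g g' : hom B C) (f : hom A B),
    comp (g + g') f = comp g f + comp g' f ;
  compDr : forall A B C (g : hom B C) (f f' : hom A B),
    comp g (f + f') = comp g f + comp g f' ;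
}.

Arguments idm {p} A.
Arguments comp {p A B C}.

Notation "g '\co' f" := (comp g f) (at level 40, left associativity).

Section Categories.
Variable C : preadditive.

Definition zero_object (Z : C) : Prop :=
  (forall (A : C) (f : hom A Z), f = 0) /\ (forall (A : C) (f : hom Z A), f = 0).

Definition biproduct (A1 A2 P : C) (i1 : hom A1 P) (i2 : hom A2 P)
    (p1 : hom P A1) (p2 : hom P A2) : Prop :=
  [/\ p1 \co i1 = idm A1, p2 \co i2 = idm A2,
      p1 \co i2 = 0, p2 \co i1 = 0
    & i1 \co p1 + i2 \co p2 = idm P].

Definition additive : Prop :=
  (exists Z : C, zero_object Z) /\
  (forall A1 A2 : C, exists (P : C) (i1 : hom A1 P) (i2 : hom A2 P)
     (p1 : hom P A1) (p2 : hom P A2), biproduct i1 i2 p1 p2).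

Definition is_kernel (A B K : C) (f : hom A B) (k : hom K A) : Prop :=
  f \co k = 0 /\
  forall (X : C) (g : hom X A), f \co g = 0 -> exists! u : hom X K, k \co u = g.

Definition is_cokernel (A B Q : C) (f : hom A B) (q : hom B Q) : Prop :=
  q \co f = 0 /\
  forall (X : C) (g : hom B X), g \co f = 0 -> exists! u : hom Q X, u \co q = g.

Definition pre_abelian : Prop :=
  [/\ additive,
      forall (A B : C) (f : hom A B), exists (K : C) (k : hom K A), is_kernel f k
    & forall (A B : C) (f : hom A B), exists (Q : C) (q : hom B Q),
        is_cokernel f q].

Definition morphism_class := forall A B : C, hom A B -> Prop.

Definition kernels : morphism_class :=
  fun K A k => exists (B : C) (f : hom A B), is_kernel f k.

Definition cokernels : morphism_class :=
  fun B Q q => exists (A : C) (f : hom A B), is_cokernel f q.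

Definition epis : morphism_class :=
  fun A B f => forall (X : C) (g h : hom B X), g \co f = h \co f -> g = h.

Definition monos : morphism_class :=
  fun A B f => forall (X : C) (g h : hom X A), f \co g = f \co h -> g = h.

Definition pullback_square (A B B' D : C)
    (a : hom A B) (b : hom A B') (c : hom B D) (d : hom B' D) : Prop :=
  c \co a = d \co b /\
  forall (X : C) (s : hom X B) (t : hom X B'), c \co s = d \co t ->
    exists! u : hom X A, a \co u = s /\ b \co u = t.

Definition pushout_square (A B B' D : C)
    (a : hom A B) (b : hom A B') (c : hom B D) (d : hom B' D) : Prop :=
  c \co a = d \co b /\
  forall (X : C) (s : hom B X) (t : hom B' X), s \co a = t \co b ->
    exists! u : hom D X, u \co c = s /\ u \co d = t.

Definition stable_under_pullback (P : morphism_class) : Prop :=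
  forall (A B B' D : C) (a : hom A B) (b : hom A B') (c : hom B D) (d : hom B' D),
    pullback_square a b c d -> P _ _ d -> P _ _ a.

Definition stable_under_pushout (P : morphism_class) : Prop :=
  forall (A B B' D : C) (a : hom A B) (b : hom A B') (c : hom B D) (d : hom B' D),
    pushout_square a b c d -> P _ _ a -> P _ _ d.

Definition left_quasi_abelian : Prop :=
  pre_abelian /\ stable_under_pullback cokernels.

Definition right_quasi_abelian : Prop :=
  pre_abelian /\ stable_under_pushout kernels.

Definition quasi_abelian : Prop := left_quasi_abelian /\ right_quasi_abelian.

Definition left_integral : Prop :=
  pre_abelian /\ stable_under_pullback epis.

Definition right_integral : Prop :=
  pre_abelian /\ stable_under_pushout monos.

Definition quasi_abelian_not_integral : Prop :=
  [/\ quasi_abelian, ~ left_integral & ~ right_integral].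

End Categories.

Section ContinuousLinear.
Variables (k : numFieldType) (E F : topologicalLmodType k).

Definition clin_pred : {pred E -> F} :=
  fun f => `[< linear f /\ continuous f >].

Record clin := Clin { clin_fun :> E -> F ; clinP : clin_fun \in clin_pred }.

HB.instance Definition _ := [isSub for clin_fun].
HB.instance Definition _ := [Choice of clin by <:].

Lemma clin_predP (f : E -> F) :
  f \in clin_pred <-> linear f /\ continuous f.
Proof. by rewrite unfold_in; split => /asboolP. Qed.

Lemma clin_zmod_closed : zmod_closed clin_pred.
Proof.
split.
  apply/clin_predP; split; first by move=> a x y /=; rewrite scaler0 addr0.
  by move=> x; exact: cst_continuous.
move=> f g /clin_predP[fl fc] /clin_predP[gl gc]; apply/clin_predP; split.
  move=> a x y; rewrite !fctE fl gl scalerBr opprD !addrA.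
  by congr (_ + _); rewrite -!addrA; congr (_ + _); rewrite addrC.
move=> x; apply: (@continuous_comp _ _ _ (fun x => (f x, g x))
  (fun z : F * F => z.1 - z.2)); last exact: sub_continuous.
by apply: cvg_pair; [exact: fc|exact: gc].
Qed.

HB.instance Definition _ :=
  GRing.isZmodClosed.Build (E -> F) clin_pred clin_zmod_closed.
HB.instance Definition _ := [SubChoice_isSubZmodule of clin by <:].

End ContinuousLinear.

Section ClinCategory.
Variable k : numFieldType.
Implicit Types E F G H : topologicalLmodType k.

Lemma clin_id_subproof E : (id : E -> E) \in @clin_pred k E E.
Proof. by apply/clin_predP; split => // x; exact: cvg_id. Qed.

Definition clin_id E : clin E E := Clin (clin_id_subproof E).

Lemma clin_comp_subproof E F G (g : clin F G) (f : clin E F) :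
  (fun x => g (f x)) \in @clin_pred k E G.
Proof.
have [fl fc] := (clin_predP _).1 (clinP f).
have [gl gc] := (clin_predP _).1 (clinP g).
apply/clin_predP; split; first by move=> a x y; rewrite fl gl.
by move=> x; apply: continuous_comp; [exact: fc|exact: gc].
Qed.

Definition clin_comp E F G (g : clin F G) (f : clin E F) : clin E G :=
  Clin (clin_comp_subproof g f).

Lemma clin_eq E F (f g : clin E F) : (forall x, f x = g x) -> f = g.
Proof. by move=> fg; apply/val_inj/funext. Qed.

Lemma clin_compA E F G H (h : clin G H) (g : clin F G) (f : clin E F) :
  clin_comp h (clin_comp g f) = clin_comp (clin_comp h g) f.
Proof. exact: clin_eq. Qed.

Lemma clin_comp1m E F (f : clin E F) : clin_comp (clin_id F) f = f.
Proof. exact: clin_eq. Qed.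

Lemma clin_compm1 E F (f : clin E F) : clin_comp f (clin_id E) = f.
Proof. exact: clin_eq. Qed.

Lemma clin_compDl E F G (g g' : clin F G) (f : clin E F) :
  clin_comp (g + g') f = clin_comp g f + clin_comp g' f.
Proof. exact: clin_eq. Qed.

Lemma clin_compDr E F G (g : clin F G) (f f' : clin E F) :
  clin_comp g (f + f') = clin_comp g f + clin_comp g f'.
Proof.
have [gl _] := (clin_predP _).1 (clinP g).
by apply: clin_eq => x /=; have := gl 1 (f x) (f' x); rewrite !scale1r.
Qed.

Definition tvs_category (T : Type) (U : T -> topologicalLmodType k) :
    preadditive :=
  @Preadditive T (fun A B => clin (U A) (U B)) (fun A => clin_id (U A))
    (fun A B C => @clin_comp (U A) (U B) (U C))
    (fun A B C D => @clin_compA (U A) (U B) (U C) (U D))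
    (fun A B => @clin_comp1m (U A) (U B))
    (fun A B => @clin_compm1 (U A) (U B))
    (fun A B C => @clin_compDl (U A) (U B) (U C))
    (fun A B C => @clin_compDr (U A) (U B) (U C)).

Definition full_tvs_subcategory (P : topologicalLmodType k -> Prop) :
    preadditive :=
  tvs_category (@proj1_sig (topologicalLmodType k) P).

End ClinCategory.

Inductive scalar_kind := RealScalars | ComplexScalars.

Definition scalar_field (R : realType) (c : scalar_kind) : numFieldType :=
  match c with RealScalars => R | ComplexScalars => R[i] end.

Definition scalar_conj (R : realType) (c : scalar_kind) :
    scalar_field R c -> scalar_field R c :=
  match c with RealScalars => id | ComplexScalars => Num.conj end.

Section Spaces.
Variables (R : realType) (c : scalar_kind).
Let k : numFieldType := scalar_field R c.
Implicit Type E : topologicalLmodType k.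

Definition locally_convex_tvs E : Prop :=
  exists2 B : set_system E, (forall b, b \in B -> convex_set b) & basis B.

Definition hausdorff_lcs E : Prop := hausdorff_space E /\ locally_convex_tvs E.

Definition metrizable E : Prop :=
  exists d : E -> E -> R,
    [/\ forall x y, d x y = 0 <-> x = y,
        forall x y, d x y = d y x,
        forall x y z, d x z <= d x y + d y z
      & forall (x : E) (A : set E),
          nbhs x A <-> exists2 e : R, 0 < e & [set y | d x y < e] `<=` A].

Definition cauchy_filter E (F : set_system E) : Prop :=
  (fun z : E * E => z.1 - z.2) @ (F, F) --> (0 : E).

Definition complete_tvs E : Prop :=
  forall F : set_system E, ProperFilter F -> cauchy_filter F ->
    exists x : E, F --> x.

Definition frechet E : Prop :=
  [/\ complete_tvs E, metrizable E & locally_convex_tvs E].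

(** As for the norm of a [normedModType], semi-norms take their values in the
    scalar field itself: for complex scalars, [0 <= z] entails that [z] is
    real. *)
Definition seminorm E (p : E -> k) : Prop :=
  [/\ forall x, 0 <= p x,
      forall x y, p (x + y) <= p x + p y
    & forall (a : k) x, p (a *: x) = `|a| * p x].

Definition continuous_seminorm E (p : E -> k) : Prop :=
  seminorm p /\ continuous p.

(** [B] is a local Banach space [E_p], with [j] the canonical map
    [E -> E / p^-1(0) -> E_p]. By [`|j x| = p x], the kernel of [j] is
    [p^-1(0)] and the image of [j] is [E / p^-1(0)] with the induced norm;
    [B] is complete and this image is dense in it, so [B] is its completion,
    which is determined up to a unique isometric isomorphism. *)
Definition local_banach E (p : E -> k) (B : completeNormedModType k)
    (j : {linear E -> B}) : Prop :=
  (forall x, `|j x| = p x) /\ dense (range j).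

(** [T = \sum_n l_n f_n(-) y_n] with [l] in l^1, the [f_n] in the unit ball of
    the dual of [X] and the [y_n] in the unit ball of [Y]. *)
Definition nuclear_operator (X Y : completeNormedModType k) (T : X -> Y) : Prop :=
  exists (l : nat -> k) (f : nat -> {linear X -> k^o}) (y : nat -> Y),
    [/\ cvgn (series (fun n => `|l n|)),
        forall n x, `|f n x| <= `|x|,
        forall n, `|y n| <= 1
      & forall x, series (fun n => l n *: (f n x *: y n)) @ \oo --> T x].

(** The map [T] is the canonical map [E_q -> E_p]: by density it is determined
    by [T \o jq = jp]. *)
Definition nuclear E : Prop :=
  hausdorff_lcs E /\
  forall p : E -> k, continuous_seminorm p ->
  exists q : E -> k,
    [/\ continuous_seminorm q, forall x, p x <= q x
      & exists (Bq Bp : completeNormedModType k)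
          (jq : {linear E -> Bq}) (jp : {linear E -> Bp}) (T : {linear Bq -> Bp}),
          [/\ local_banach q jq, local_banach p jp, continuous T,
              forall x, T (jq x) = jp x & nuclear_operator T]].

Definition nuclear_frechet E : Prop := frechet E /\ nuclear E.

Definition frechet_schwartz E : Prop :=
  frechet E /\
  forall U : set E, nbhs (0 : E) U ->
  exists2 V : set E, nbhs (0 : E) V &
  forall e : k, 0 < e -> exists s : seq E,
    forall v, V v -> exists2 x, x \in s & exists2 u, U u & v = x + e *: u.

Definition hilbert_seminorm E (p : E -> k) : Prop :=
  exists f : {hermitian_sym E for @scalar_conj R c},
    (forall x, 0 <= f x x) /\ (forall x, 0 <= p x /\ p x ^+ 2 = f x x).

Definition topology_generated_by E (P : set (E -> k)) : Prop :=
  forall U : set E, nbhs (0 : E) U <->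
    exists (Q : set (E -> k)) (e : k),
      [/\ Q `<=` P, finite_set Q, 0 < e
        & [set x | forall p, Q p -> p x < e] `<=` U].

Definition frechet_hilbert E : Prop :=
  frechet E /\
  exists2 P : set (E -> k), (forall p, P p -> hilbert_seminorm p)
    & topology_generated_by P.

Definition BAN : preadditive :=
  tvs_category (fun E : completeNormedModType k => E : topologicalLmodType k).
Definition NOR : preadditive :=
  tvs_category (fun E : normedModType k => E : topologicalLmodType k).
Definition FRE : preadditive := full_tvs_subcategory frechet.
Definition HD_LCS : preadditive := full_tvs_subcategory hausdorff_lcs.
Definition HD_TVS : preadditive :=
  full_tvs_subcategory (fun E : topologicalLmodType k => hausdorff_space E).
Definition NUC : preadditive := full_tvs_subcategory nuclear.
Definition FN : preadditive := full_tvs_subcategory nuclear_frechet.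
Definition FS : preadditive := full_tvs_subcategory frechet_schwartz.
Definition FH : preadditive := full_tvs_subcategory frechet_hilbert.

End Spaces.

(* Main.v *)
(* In a class of Hausdorff spaces closed under finite products, closed subspaces
   and quotients by closed subspaces, the kernels are the closed embeddings and
   the cokernels the open surjections; both are stable under the required
   pushouts and pullbacks, whence quasi-abelianness. For nuclear spaces closure
   under quotients is seen on an equivalent condition: every continuous seminorm
   is dominated in l^2-sense by functionals of square-summable norms. The
   functionals are corrected on a quotient by approximate orthogonal projections
   in l^2, and quotients of Hilbertian seminorms are treated in the same way.

   Integrality fails in all categories through one operator on a space of
   weighted square-summable sequences, (A x)_n = w_n (x_n - x_(n+1)) with w
   rapidly decreasing. It is injective with dense range, misses the sequence w,
   and maps (1, .., 1, 0, ..) to a null sequence as the number of ones grows.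
   The space is l^2 for Banach and normed spaces, and the space of rapidly
   decreasing sequences, which is nuclear and Frechet-Hilbert, otherwise. *)

Require Import Defs.
From HB Require Import structures.
From mathcomp Require Import all_boot all_order all_algebra.
From mathcomp Require Import all_classical all_reals all_analysis.
From mathcomp Require Import complex ring lra.

Set Implicit Arguments.
Unset Strict Implicit.
Unset Printing Implicit Defensive.

Import Order.TTheory GRing.Theory Num.Theory.
Import numFieldTopology.Exports numFieldNormedType.Exports.
Import Defs.

Local Open Scope classical_set_scope.
Local Open Scope ring_scope.

(** * Topological vector spaces *)

Section TopologicalVectorSpaces.
Variable k : numFieldType.
Implicit Types E F G : topologicalLmodType k.

(** Why one operator refutes both kinds of integrality: it is compared with a rank-one operator
    [x |-> X x *: v], where [v] is outside the range of [A] and [X] is the first coordinate. On the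
    pullback of the two, [X] must vanish because no nonzero multiple of [v] is reached by [A]; in
    the pushout, [v] is killed because [A] makes vectors with [X x = 1] arbitrarily small. So [A] is
    monic and epic while its companion in the square is not epic, respectively not monic. No single
    space can serve all nine categories, since an infinite-dimensional normed space is never
    nuclear. Both spaces are instances of one weighted construction, and the weight [w] of the
    operator decays against every norm of the family. For nuclearity the square-summable domination
    is always applied twice in a row. The first application supplies the functionals; the second
    maps the space into l^2 with a norm above the intermediate seminorm, and this is where the
    functionals can be extended, projected and expanded along unit vectors. All projections are
    limits of approximate ones with error of order [1 / (n + 1)]. *)

Lemma nbhs_translate E (x : E) (A : set E) :
  nbhs x A <-> nbhs (0 : E) [set y | A (x + y)].
Proof.
have tr (z w : E) (B : set E) : nbhs (z + w) B -> nbhs w [set y | B (z + y)].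
  move=> zwB; have := @add_continuous E (z, w) B zwB.
  case=> -[P Q] /= [Pz Qw] PQ; apply: filterS Qw => y Qy.
  by apply: (PQ (z, y)); split => //; exact: nbhs_singleton.
split=> [xA|A0]; first by apply: tr; rewrite addr0.
have := tr (- x) x [set y | A (x + y)]; rewrite addNr => /(_ A0).
by apply: filterS => y /=; rewrite addrA subrr add0r.
Qed.

Lemma nbhs0_sub E (A : set E) : nbhs (0 : E) A ->
  exists2 B, nbhs (0 : E) B & forall x y, B x -> B y -> A (x - y).
Proof.
move=> A0; have := @sub_continuous E (0, 0) A; rewrite /= subr0 => /(_ A0).
case=> -[P Q] /= [P0 Q0] PQ; exists (P `&` Q); first exact: filterI.
by move=> x y [Px _] [_ Qy]; exact: (PQ (x, y)).
Qed.

Lemma nbhs0_opp E (A : set E) : nbhs (0 : E) A ->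
  nbhs (0 : E) [set x | A (- x)].
Proof.
move=> /nbhs0_sub[B B0 BA]; apply: filterS (B0) => x Bx.
by rewrite /= -[- x]add0r; apply: BA => //; exact: nbhs_singleton B0.
Qed.

Lemma nbhs0_add E (A : set E) : nbhs (0 : E) A ->
  exists2 B, nbhs (0 : E) B & forall x y, B x -> B y -> A (x + y).
Proof.
move=> /nbhs0_sub[B B0 BA]; exists (B `&` [set x | B (- x)]).
  by apply: filterI => //; exact: nbhs0_opp.
by move=> x y [Bx _] [_ By]; rewrite -[y]opprK; exact: BA.
Qed.

Lemma nbhs0_scale E (A : set E) : nbhs (0 : E) A ->
  exists2 B, nbhs (0 : E) B &
    exists2 e : k, 0 < e & forall a x, `|a| < e -> B x -> A (a *: x).
Proof.
move=> A0; have := @scale_continuous k E (0, 0) A; rewrite /= scaler0.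
move=> /(_ A0)[] -[P Q] /= [P0 Q0] PQ; exists Q => //.
have /nbhs_ballP[e e0 eP] := P0; exists e => // a x ae Qx.
by apply: (PQ (a, x)); split => //; apply: eP; rewrite /ball /= sub0r normrN.
Qed.

Lemma nbhs0_absorb E (A : set E) (x : E) : nbhs (0 : E) A ->
  exists2 e : k, 0 < e & forall a, `|a| < e -> A (a *: x).
Proof.
move=> A0; have := @scale_continuous k E (0, x) A; rewrite /= scale0r.
move=> /(_ A0)[] -[P Q] /= [P0 Q0] PQ.
have /nbhs_ballP[e e0 eP] := P0; exists e => // a ae.
apply: (PQ (a, x)); split => /=; last exact: nbhs_singleton.
by apply: eP; rewrite /ball /= sub0r normrN.
Qed.

Lemma nbhs0_scalel E (A : set E) (a : k) : nbhs (0 : E) A ->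
  nbhs (0 : E) [set x | A (a *: x)].
Proof.
move=> A0; have := @scale_continuous k E (a, 0) A; rewrite /= scaler0.
move=> /(_ A0)[] -[P Q] /= [P0 Q0] PQ; apply: filterS Q0 => x Qx.
by apply: (PQ (a, x)); split => //; exact: (@nbhs_singleton k^o).
Qed.

Lemma linear_continuousP E F (f : E -> F) : linear f ->
  (continuous f <-> forall A, nbhs (0 : F) A -> nbhs (0 : E) (f @^-1` A)).
Proof.
move=> fl; have f0 : f 0 = 0.
  by have := fl (-1) 0 0; rewrite scaler0 addr0 scaleN1r addNr.
have fD x y : f (x + y) = f x + f y by rewrite -[x]scale1r fl !scale1r.
split=> [fc A A0|fc x A /nbhs_translate /fc].
  by apply: fc; rewrite f0.
by move=> h; apply/nbhs_translate; apply: filterS h => y /=; rewrite fD.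
Qed.

Lemma clin_linear E F (f : clin E F) : linear f.
Proof. by have [] := (clin_predP _).1 (clinP f). Qed.

Lemma clin_D E F (f : clin E F) x y : f (x + y) = f x + f y.
Proof. by rewrite -[x]scale1r (clin_linear f) !scale1r. Qed.

Lemma clin_0 E F (f : clin E F) : f 0 = 0.
Proof. by apply: (@addrI _ (f 0)); rewrite -clin_D !addr0. Qed.

Lemma clin_Z E F (f : clin E F) a x : f (a *: x) = a *: f x.
Proof. by rewrite -[a *: x]addr0 (clin_linear f) clin_0 addr0. Qed.

Lemma clin_N E F (f : clin E F) x : f (- x) = - f x.
Proof. by rewrite -scaleN1r clin_Z scaleN1r. Qed.

Lemma clin_B E F (f : clin E F) x y : f (x - y) = f x - f y.
Proof. by rewrite clin_D clin_N. Qed.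

Lemma clin_nbhs0 E F (f : clin E F) A :
  nbhs (0 : F) A -> nbhs (0 : E) (f @^-1` A).
Proof.
by have [fl /(linear_continuousP fl)] := (clin_predP _).1 (clinP f); apply.
Qed.

Lemma clin_intro E F (f : E -> F) : linear f ->
  (forall A, nbhs (0 : F) A -> nbhs (0 : E) (f @^-1` A)) ->
  exists g : clin E F, forall x, g x = f x.
Proof.
move=> fl fc; have fP : f \in @clin_pred k E F.
  by apply/clin_predP; split=> //; apply/linear_continuousP.
by exists (Clin fP).
Qed.

Definition separated E := forall x : E, (forall A, nbhs (0 : E) A -> A x) -> x = 0.

Lemma separatedP E : separated E <-> hausdorff_space E.
Proof.
split=> [sE x y xy|hE x xA].
- apply/eqP; rewrite -subr_eq0; apply/eqP/sE => A /nbhs0_sub[B B0 BA].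
  have xB : nbhs x [set z | B (x - z)].
    by apply/nbhs_translate; apply: filterS (nbhs0_opp B0) => z /=; rewrite opprD addrA subrr add0r.
  have yB : nbhs y [set z | B (y - z)].
    by apply/nbhs_translate; apply: filterS (nbhs0_opp B0) => z /=; rewrite opprD addrA subrr add0r.
  have [z [/= Bxz Byz]] := xy _ _ xB yB.
  by rewrite -(subrKA z) -[z - y]opprB; apply: BA.
- apply/esym/hE => A B A0 /nbhs_translate B0; exists x; split; first exact: xA.
  by have /= := nbhs_singleton B0; rewrite addr0.
Qed.

Definition is_submod (V : lmodType k) (S : set V) :=
  S 0 /\ forall a x y, S x -> S y -> S (a *: x + y).

(** The closure of [S], written with zero-neighbourhoods only, because every topology below is
    described at the origin. *)
Definition adherent E (S : set E) : set E :=
  [set x | forall A, nbhs (0 : E) A -> exists2 s, S s & A (x - s)].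

Definition is_closed E (S : set E) := adherent S `<=` S.

Lemma submodD (V : lmodType k) (S : set V) x y : is_submod S -> S x -> S y -> S (x + y).
Proof. by move=> [_ h] Sx Sy; have := h 1 _ _ Sx Sy; rewrite scale1r. Qed.

Lemma submodZ (V : lmodType k) (S : set V) a x : is_submod S -> S x -> S (a *: x).
Proof. by move=> [S0 h] Sx; have := h a _ _ Sx S0; rewrite addr0. Qed.

Lemma submodN (V : lmodType k) (S : set V) x : is_submod S -> S x -> S (- x).
Proof. by move=> h Sx; rewrite -scaleN1r; apply: submodZ. Qed.

Lemma submodB (V : lmodType k) (S : set V) x y : is_submod S -> S x -> S y -> S (x - y).
Proof. by move=> h Sx Sy; apply: submodD => //; apply: submodN. Qed.

Lemma adherent_submod E (S : set E) : is_submod S -> is_submod (adherent S).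
Proof.
move=> Ssub; have [S0 SL] := Ssub; split.
  by move=> A A0; exists 0 => //; rewrite subrr; exact: nbhs_singleton.
move=> a x y xS yS A /nbhs0_add[B B0 BA].
have [s Ss Bs] := xS _ (nbhs0_scalel a B0).
have [t St Bt] := yS _ B0; exists (a *: s + t); first exact: SL.
by rewrite opprD addrACA -scalerBr; exact: BA.
Qed.

Lemma sub_adherent E (S : set E) : S `<=` adherent S.
Proof. by move=> x Sx A A0; exists x => //; rewrite subrr; exact: nbhs_singleton. Qed.

Lemma adherent_closed E (S : set E) : is_closed (adherent S).
Proof.
move=> x h A /nbhs0_add[B B0 BA]; have [y yS Bxy] := h _ B0.
have [s Ss Bys] := yS _ B0; exists s => //.
by rewrite -(subrKA y); exact: BA.
Qed.

Lemma clin_adherent0 E F (f : clin E F) (S : set E) : separated F ->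
  (forall x, S x -> f x = 0) -> forall x, adherent S x -> f x = 0.
Proof.
move=> sF fS x Sx; apply: sF => A /(clin_nbhs0 f) /Sx[s Ss /=].
by rewrite clin_B (fS _ Ss) subr0.
Qed.

Lemma ker_submod E F (f : clin E F) : is_submod [set x | f x = 0].
Proof.
split=> [|a y z /= fy fz]; first exact: clin_0.
by rewrite (clin_linear f) fy fz scaler0 addr0.
Qed.

Lemma ker_closed E F (f : clin E F) : separated F -> is_closed [set x | f x = 0].
Proof. by move=> sF x; apply: (clin_adherent0 sF). Qed.

Lemma range_submod E F (f : clin E F) : is_submod (range f).
Proof.
split=> [|a _ _ [x _ <-] [y _ <-]]; first by exists 0; rewrite ?clin_0.
by exists (a *: x + y); rewrite ?(clin_linear f).
Qed.

Definition embedding E F (f : clin E F) := injective f /\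
  forall A, nbhs (0 : E) A -> exists2 B, nbhs (0 : F) B & forall x, B (f x) -> A x.

Definition open_surjection E F (f : clin E F) := (forall y, exists x, f x = y) /\
  forall A, nbhs (0 : E) A -> nbhs (0 : F) (f @` A).

Lemma embedding_lift E F G (i : clin F E) (g : clin G E) : embedding i ->
  (forall x, exists y, i y = g x) -> exists u : clin G F, forall x, i (u x) = g x.
Proof.
move=> [inj iemb] gi; have [u uE] := choice gi.
have ul : linear u by move=> a x y; apply: inj; rewrite (clin_linear i) !uE (clin_linear g).
have uc A : nbhs (0 : F) A -> nbhs (0 : G) (u @^-1` A).
  move=> /iemb[B B0 BA]; apply: filterS (clin_nbhs0 g B0) => x /=.
  by rewrite -uE => /BA.
by have [v vE] := clin_intro ul uc; exists v => x; rewrite vE.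
Qed.

(** Any set-theoretic section of [p] will do: the kernel condition makes [g \o s] independent of it,
    and openness of [p] turns neighbourhoods for [g] into neighbourhoods for the factor. *)
Lemma surjection_factor E F G (p : clin E F) (g : clin E G) : open_surjection p ->
  (forall x, p x = 0 -> g x = 0) -> exists u : clin F G, forall x, u (p x) = g x.
Proof.
move=> [surj popen] gp; have [s sE] := choice surj.
have uE x : g (s (p x)) = g x.
  by apply/eqP; rewrite -subr_eq0 -clin_B; apply/eqP/gp; rewrite clin_B sE subrr.
have ul : linear (g \o s).
  by move=> a x y /=; rewrite -clin_Z -clin_D -[RHS]uE clin_D clin_Z !sE.
have uc A : nbhs (0 : G) A -> nbhs (0 : F) ((g \o s) @^-1` A).
  move=> A0; have pA := popen _ (clin_nbhs0 g A0).
  by apply: filterS pA => _ [z Az <-] /=; rewrite uE.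
by have [v vE] := clin_intro ul uc; exists v => x; rewrite vE /=.
Qed.

End TopologicalVectorSpaces.

(** * Kernels, cokernels and failure of integrality *)

Section StableClasses.
Variables (k : numFieldType) (T : Type) (U : T -> topologicalLmodType k).

(** The product described by elements and neighbourhoods. Joint injectivity of the projections
    follows from the second clause once [P] is Hausdorff ([product_inj]). *)
Definition is_product (E F P : topologicalLmodType k) (p1 : clin P E) (p2 : clin P F) :=
  (forall x y, exists z, p1 z = x /\ p2 z = y) /\
  forall A, nbhs (0 : P) A -> exists B1 B2,
    [/\ nbhs (0 : E) B1, nbhs (0 : F) B2 & forall z, B1 (p1 z) -> B2 (p2 z) -> A z].

(** An indexed family [U] instead of a predicate on spaces covers Banach and normed spaces, whose
    objects carry a chosen norm, together with the full subcategories. *)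
Record stable_class : Prop := StableClass {
  sc_inhabited : inhabited T;
  sc_separated : forall t, separated (U t);
  sc_product : forall s t, exists (p : T) (p1 : clin (U p) (U s)) (p2 : clin (U p) (U t)),
    is_product p1 p2;
  sc_sub : forall t (S : set (U t)), is_submod S -> is_closed S ->
    exists (s : T) (i : clin (U s) (U t)), embedding i /\ range i = S;
  sc_quotient : forall t (S : set (U t)), is_submod S -> is_closed S ->
    exists (q : T) (p : clin (U t) (U q)),
      open_surjection p /\ forall x, p x = 0 <-> S x }.

Lemma product_inj (E F P : topologicalLmodType k) (p1 : clin P E) (p2 : clin P F) z w :
  separated P -> is_product p1 p2 -> p1 z = p1 w -> p2 z = p2 w -> z = w.
Proof.
move=> sP [_ p12] e1 e2; apply/eqP; rewrite -subr_eq0; apply/eqP/sP => A.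
move=> /p12[B1 [B2 [B10 B20 h]]]; apply: h; rewrite clin_B ?e1 ?e2 subrr;
  exact: nbhs_singleton.
Qed.

Lemma product_pairing (E F P G : topologicalLmodType k) (p1 : clin P E) (p2 : clin P F)
    (f : clin G E) (g : clin G F) : separated P -> is_product p1 p2 ->
  exists h : clin G P, (forall x, p1 (h x) = f x) /\ (forall x, p2 (h x) = g x).
Proof.
move=> sP p12; have [h0 nb] := p12.
have [h hE] := choice (fun x => h0 (f x) (g x)).
have hl : linear h.
  move=> a x y; have [x1 x2] := hE x; have [y1 y2] := hE y.
  have [z1 z2] := hE (a *: x + y).
  by apply: (product_inj sP p12); rewrite clin_D clin_Z ?x1 ?y1 ?z1 ?x2 ?y2 ?z2 clin_linear.
have hc A : nbhs (0 : P) A -> nbhs (0 : G) (h @^-1` A).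
  move=> /nb[B1 [B2 [B10 B20 hB]]].
  apply: filterS (filterI (clin_nbhs0 f B10) (clin_nbhs0 g B20)) => x [/= fx gx]; by apply: hB; [rewrite (proj1 (hE x))|rewrite (proj2 (hE x))].
have [u uE] := clin_intro hl hc; exists u.
by split=> x; rewrite uE; have [] := hE x.
Qed.

Hypothesis stableU : stable_class.
Let C := tvs_category U.
Let sU := sc_separated stableU.

Lemma hom_ext (A B : C) (f g : @hom C A B) :
  (forall x, (f : clin (U A) (U B)) x = (g : clin (U A) (U B)) x) -> f = g.
Proof. exact: clin_eq. Qed.

Lemma hom_app (A B : C) (f g : @hom C A B) : f = g ->
  forall x, (f : clin (U A) (U B)) x = (g : clin (U A) (U B)) x.
Proof. by move=> ->. Qed.

Lemma sc_zero : exists Z : C, zero_object Z.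
Proof.
have [t] := sc_inhabited stableU.
have S1 : is_submod [set (0 : U t)].
  by split=> // a x y /= -> ->; rewrite scaler0 addr0.
have S2 : is_closed [set (0 : U t)].
  by move=> x h; apply: sU => A /h[_ ->]; rewrite subr0.
have [z [i [[inj _] iS]]] := sc_sub stableU S1 S2.
have z0 (x : U z) : x = 0.
  by apply: inj; rewrite clin_0; have : range i (i x) by []; rewrite iS.
exists z; split=> A f; apply: hom_ext => x; first exact: z0.
by rewrite [x]z0 clin_0.
Qed.

Lemma sc_additive : additive C.
Proof.
split; first exact: sc_zero.
move=> s t; have [p [p1 [p2 p12]]] := sc_product stableU s t.
have [i1 [i11 i12]] := product_pairing (clin_id (U s)) (0 : clin (U s) (U t)) (@sU p) p12.
have [i2 [i21 i22]] := product_pairing (0 : clin (U t) (U s)) (clin_id (U t)) (@sU p) p12.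
exists p, i1, i2, p1, p2; split.
- by apply: hom_ext => x; exact: i11.
- by apply: hom_ext => x; exact: i22.
- by apply: hom_ext => x; exact: i21.
- by apply: hom_ext => x; exact: i12.
- apply: hom_ext => x; change (i1 (p1 x) + i2 (p2 x) = x).
  apply: (product_inj (@sU p) p12); rewrite clin_D.
    by rewrite i11 i21 addr0.
  by rewrite i12 i22 add0r.
Qed.

Lemma sc_kernel (A B : C) (f : hom A B) : exists (K : C) (i : hom K A),
  [/\ is_kernel f i, embedding i & range i = [set x | f x = 0]].
Proof.
have [K [i [emb rg]]] := sc_sub stableU (ker_submod f) (ker_closed (@sU B)).
exists K, i; split=> //; split.
  by apply: hom_ext => x; have : range i (i x) by []; rewrite rg.
move=> X g fg; have gi x : exists y, i y = g x.
  have : range i (g x); last by move=> [y _ yE]; exists y.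
  by rewrite rg /=; have := hom_app fg x.
have [u uE] := embedding_lift emb gi; exists u; split; first exact: hom_ext.
move=> v vE; apply: hom_ext => x; apply: (proj1 emb); rewrite uE.
by rewrite -vE.
Qed.

(** Targets are Hausdorff, so a map that vanishes on the range vanishes on its closure; hence the
    quotient is taken by the closure. *)
Lemma sc_cokernel (A B : C) (f : hom A B) : exists (Q : C) (p : hom B Q),
  [/\ is_cokernel f p, open_surjection p & forall x, p x = 0 <-> adherent (range f) x].
Proof.
have [Q [p [op kp]]] := sc_quotient stableU (adherent_submod (range_submod f))
  (@adherent_closed _ _ (range f)).
exists Q, p; split=> //; split.
  by apply: hom_ext => x; apply/kp/sub_adherent; exists x.
move=> X g gf; have gp x : p x = 0 -> g x = 0.
  move/kp; apply: (clin_adherent0 (@sU X)) => _ [y _ <-].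
  by have := hom_app gf y.
have [u uE] := surjection_factor op gp; exists u; split; first exact: hom_ext.
move=> v vE; apply: hom_ext => y; have [x <-] := proj1 op y; rewrite uE.
by rewrite -vE.
Qed.

Lemma sc_pre_abelian : pre_abelian C.
Proof.
split; first exact: sc_additive.
  by move=> A B f; have [K [i []]] := sc_kernel f; exists K, i.
by move=> A B f; have [Q [p []]] := sc_cokernel f; exists Q, p.
Qed.

(** An abstract kernel is isomorphic to the concrete one of [sc_kernel] and inherits its properties.
    Conversely, a closed embedding is the kernel of the quotient by its range. *)
Lemma kernelsP (K A : C) (i : hom K A) :
  kernels i <-> embedding i /\ is_closed (range i).
Proof.
split=> [[B [f [fi univ]]]|[emb cl]].
  have [K' [j [[fj univj] embj rgj]]] := sc_kernel f.
  have [u [uE _]] := univj _ _ fi; have [v [vE _]] := univ _ _ fj.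
  have iE x : i x = j (u x) by have := hom_app uE x.
  have jE x : j x = i (v x) by have := hom_app vE x.
  have vu x : v (u x) = x.
    have [w [_ wuniq]] := univ _ _ fi.
    have e1 : w = v \co u by apply: wuniq; rewrite compA vE uE.
    have e2 : w = idm K by apply: wuniq; rewrite compm1.
    have e : v \co u = idm K by rewrite -e1 e2.
    exact: hom_app e x.
  have rgi : range i = [set x | f x = 0].
    rewrite -rgj; apply/seteqP; split=> _ [x _ <-].
      by exists (u x).
    by exists (v x).
  split; last by rewrite rgi; exact: ker_closed.
  split=> [x y|W W0]; first by rewrite !iE => /(proj1 embj) uxy; rewrite -[x]vu uxy vu.
  have [B' B'0 B'W] := proj2 embj _ (clin_nbhs0 v W0); exists B' => // x.
  by rewrite iE => /B'W /=; rewrite vu.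
have [Q [p [op kp]]] := sc_quotient stableU (range_submod i) cl.
exists Q, p; split; first by apply: hom_ext => x; apply/kp; exists x.
move=> X g pg; have gi x : exists y, i y = g x.
  have : range i (g x); last by move=> [y _ yE]; exists y.
  by apply/kp; have := hom_app pg x.
have [u uE] := embedding_lift emb gi; exists u; split; first exact: hom_ext.
by move=> v vE; apply: hom_ext => x; apply: (proj1 emb); rewrite uE -vE.
Qed.

Lemma cokernelsP (B Q : C) (q : hom B Q) : cokernels q <-> open_surjection q.
Proof.
split=> [[A [f [qf univ]]]|op].
  have [Q' [p [[pf univp] opp _]]] := sc_cokernel f.
  have [u [uE _]] := univ _ _ pf; have [v [vE _]] := univp _ _ qf.
  have pE x : p x = u (q x) by have := hom_app uE x.
  have qE x : q x = v (p x) by have := hom_app vE x.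
  have vu x : v (u x) = x.
    have [w [_ wuniq]] := univ _ _ qf.
    have e1 : w = v \co u by apply: wuniq; rewrite -compA uE vE.
    have e2 : w = idm Q by apply: wuniq; rewrite comp1m.
    have e : v \co u = idm Q by rewrite -e1 e2.
    exact: hom_app e x.
  split=> [y|W W0].
    by have [x xE] := proj1 opp (u y); exists x; rewrite qE xE vu.
  apply: filterS (clin_nbhs0 u (proj2 opp _ W0)) => y [x Ox xE].
  by exists x => //; rewrite qE xE vu.
have [K [i [emb rg]]] := sc_sub stableU (ker_submod q) (ker_closed (@sU Q)).
exists K, i; split.
  by apply: hom_ext => x; have : range i (i x) by []; rewrite rg.
move=> X g gi; have gq x : q x = 0 -> g x = 0.
  move=> qx; have : range i x by rewrite rg.
  by move=> [y _ <-]; have := hom_app gi y.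
have [u uE] := surjection_factor op gq; exists u; split; first exact: hom_ext.
by move=> v vE; apply: hom_ext => y; have [x <-] := proj1 op y; rewrite uE -vE.
Qed.

(** The kernel of the difference on the product. Its elements and neighbourhoods are recorded
    because a square given only by its universal property is studied by mapping this concrete one
    into it. *)
Lemma sc_pullback (B B' D : C) (c : hom B D) (d : hom B' D) :
  exists (A : C) (a : hom A B) (b : hom A B'),
  [/\ pullback_square a b c d,
      forall x y, c x = d y -> exists z, a z = x /\ b z = y
    & forall W, nbhs (0 : U A) W -> exists M1 M2, [/\ nbhs (0 : U B) M1, nbhs (0 : U B') M2
        & forall z, M1 (a z) -> M2 (b z) -> W z]].
Proof.
have [P [p1 [p2 p12]]] := sc_product stableU B B'.
have [A [i [[ci univ] emb rg]]] := sc_kernel (c \co p1 - d \co p2 : @hom C P D).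
exists A, (@comp C A P B p1 i), (@comp C A P B' p2 i); split.
- split.
    apply: hom_ext => x; apply/eqP; rewrite -subr_eq0; apply/eqP.
    by have := hom_app ci x.
  move=> X s t st; have [h [h1 h2]] := product_pairing s t (@sU P) p12.
  have hk : (c \co p1 - d \co p2 : @hom C P D) \co h = 0.
    apply: hom_ext => x; change (c (p1 (h x)) - d (p2 (h x)) = 0).
    by rewrite h1 h2; apply/eqP; rewrite subr_eq0; apply/eqP; exact: (hom_app st x).
  have [u [uE uuniq]] := univ _ h hk; exists u; split.
    by split; apply: hom_ext => x /=; [rewrite -h1|rewrite -h2]; rewrite -uE.
  move=> v [v1 v2]; apply: uuniq; apply: hom_ext => x.
  apply: (product_inj (@sU P) p12); first by rewrite h1 -v1.
  by rewrite h2 -v2.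
- move=> x y cd; have [z [z1 z2]] := proj1 p12 x y.
  have : range i z.
    rewrite rg; change (c (p1 z) - d (p2 z) = 0).
    by rewrite z1 z2 cd subrr.
  by move=> [w _ wE]; exists w; rewrite -z1 -z2 -wE.
- move=> W /(proj2 emb)[N N0 NO].
  have [M1 [M2 [M10 M20 h]]] := proj2 p12 _ N0; exists M1, M2; split=> // z h1 h2.
  by apply: NO; exact: h.
Qed.

Lemma sc_left_quasi_abelian : left_quasi_abelian C.
Proof.
split; first exact: sc_pre_abelian.
move=> A B B' D a b c d [cadb univ] /cokernelsP[dsurj dopen]; apply/cokernelsP.
have [A' [a' [b' [[sq _] elt nb]]]] := sc_pullback c d.
have [u [[au bu] _]] := univ _ _ _ sq.
have aE z : a (u z) = a' z by have := hom_app au z.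
split=> [y|W W0].
  have [x xE] := dsurj (c y); have [z [z1 z2]] := elt y x (esym xE).
  by exists (u z); rewrite aE.
have [M1 [M2 [M10 M20 h]]] := nb _ (clin_nbhs0 u W0).
apply: filterS (filterI M10 (clin_nbhs0 c (dopen _ M20))) => y [M1y [x M2x xE]].
have [z [z1 z2]] := elt y x (esym xE).
by exists (u z); [apply: h; rewrite ?z1 ?z2|rewrite aE].
Qed.

End StableClasses.

(** * Pushouts: stability of kernels and a criterion against integrality *)

Section Pushouts.
Variables (k : numFieldType) (T : Type) (U : T -> topologicalLmodType k).
Hypothesis stableU : stable_class U.
Let C := tvs_category U.
Let sU := sc_separated stableU.

Lemma product_injections (E F P : topologicalLmodType k) (p1 : clin P E) (p2 : clin P F) :
  separated P -> is_product p1 p2 -> exists (i1 : clin E P) (i2 : clin F P),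
  [/\ forall x, p1 (i1 x) = x, forall x, p2 (i1 x) = 0,
      forall y, p1 (i2 y) = 0, forall y, p2 (i2 y) = y
    & forall z, z = i1 (p1 z) + i2 (p2 z)].
Proof.
move=> sP p12.
have [i1 [i11 i12]] := product_pairing (clin_id E) (0 : clin E F) sP p12.
have [i2 [i21 i22]] := product_pairing (0 : clin F E) (clin_id F) sP p12.
exists i1, i2; split=> // z; apply: (product_inj sP p12); rewrite clin_D.
  by rewrite i11 i21 addr0.
by rewrite i12 i22 add0r.
Qed.

Lemma sc_pushout (A B B' : C) (a : hom A B) (b : hom A B') :
  exists (D : C) (c : hom B D) (d : hom B' D), pushout_square a b c d.
Proof.
have [P [p1 [p2 p12]]] := sc_product stableU B B'.
have [i1 [i2 [i11 i12 i21 i22 zE]]] := product_injections (@sU P) p12.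
pose m : @hom C A P := @comp C A B P i1 a - @comp C A B' P i2 b.
have [D [q [[qm univ] _ _]]] := sc_cokernel stableU m.
exists D, (@comp C B P D q i1), (@comp C B' P D q i2); split.
  apply/eqP; rewrite -subr_eq0; apply/eqP; apply: hom_ext => x.
  have <- := hom_app qm x; change (q (i1 (a x)) - q (i2 (b x)) = q (i1 (a x) - i2 (b x))).
  by rewrite clin_B.
move=> X s t st.
pose h : @hom C P X := @comp C P B X s p1 + @comp C P B' X t p2.
have hE z : h z = s (p1 z) + t (p2 z) by [].
have hm : h \co m = 0.
  apply: hom_ext => x; change (h (i1 (a x) - i2 (b x)) = 0).
  rewrite hE (clin_B p1) (clin_B p2) i11 i21 i12 i22 subr0 sub0r clin_N.
  by apply/eqP; rewrite subr_eq0; apply/eqP; exact: (hom_app st x).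
have [u [uE uuniq]] := univ _ h hm; exists u; split.
  split; apply: hom_ext => x.
    have e := hom_app uE (i1 x); change (u (q (i1 x)) = h (i1 x)) in e.
    by change (u (q (i1 x)) = s x); rewrite e hE i11 i12 (clin_0 t) addr0.
  have e := hom_app uE (i2 x); change (u (q (i2 x)) = h (i2 x)) in e.
  by change (u (q (i2 x)) = t x); rewrite e hE i21 i22 (clin_0 s) add0r.
move=> v [v1 v2]; apply: uuniq; apply: hom_ext => z.
change (v (q z) = h z).
rewrite {1}(zE z) !clin_D hE.
by rewrite -(hom_app v1 (p1 z)) -(hom_app v2 (p2 z)).
Qed.

(** As [a] is a closed embedding, the copy of [A] in the product under [(a, - b)] is already closed,
    so the pushout can be computed as the plain quotient [Q] by it. The comparison map [u] into [Q]
    has the left inverse [v], which carries the properties of [d'] over to the given [d]. *)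
Lemma sc_right_quasi_abelian : right_quasi_abelian C.
Proof.
split; first exact: sc_pre_abelian.
move=> A B B' D a b c d [cadb univ] /(kernelsP stableU)[[ainj aemb] acl].
have [P [p1 [p2 p12]]] := sc_product stableU B B'.
have [i1 [i2 [i11 i12 i21 i22 zE]]] := product_injections (@sU P) p12.
pose m : clin (U A) (U P) := @comp C A B P i1 a - @comp C A B' P i2 b.
have mE x : m x = i1 (a x) - i2 (b x) by [].
have m1 x : p1 (m x) = a x by rewrite mE clin_B i11 i21 subr0.
have m2 x : p2 (m x) = - b x by rewrite mE clin_B i12 i22 sub0r.
(* The first component of an adherent point lies in the closed set [range a]. After subtraction of
   an element of [range m] it is zero, and then the inverse continuity of [a] makes the second
   component arbitrarily small. *)
have rcl : is_closed (range m).
  move=> z zm; have : adherent (range a) (p1 z).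
    move=> V /(clin_nbhs0 p1)/zm[_ [x _ <-]]; rewrite /= clin_B m1 => h.
    by exists (a x) => //; exists x.
  move/acl => [x0 _ x0E]; exists x0 => //.
  set w := z - m x0; have wm : adherent (range m) w.
    apply: submodB (adherent_submod (range_submod m)) zm _.
    by apply: sub_adherent; exists x0.
  have w1 : p1 w = 0 by rewrite clin_B m1 x0E subrr.
  suff w2 : p2 w = 0.
    by apply: (product_inj (@sU P) p12); apply/esym/eqP;
      rewrite -subr_eq0 -clin_B -/w ?w1 ?w2.
  apply: sU => V /nbhs0_add[V' V'0 V'V].
  have [N N0 NV] := aemb _ (clin_nbhs0 b V'0).
  have [_ [x _ <-]] := wm _ (filterI (clin_nbhs0 p1 N0) (clin_nbhs0 p2 V'0)).
  rewrite /= (clin_B p1 w) (clin_B p2 w) w1 m1 m2 sub0r opprK -clin_N => -[/NV /= h1 h2].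
  by rewrite -[p2 w](addrK (b x)) -clin_N; exact: V'V.
have [Q [q [qop qk]]] := sc_quotient stableU (range_submod m) rcl.
pose c' : @hom C B Q := @comp C B P Q q i1.
pose d' : @hom C B' Q := @comp C B' P Q q i2.
have c'E x : c' x = q (i1 x) by []. 
have d'E x : d' x = q (i2 x) by [].
have sq : c' \co a = d' \co b.
  apply: hom_ext => x; apply/eqP; rewrite -subr_eq0; apply/eqP.
  change (q (i1 (a x)) - q (i2 (b x)) = 0); rewrite -clin_B; apply/qk.
  by exists x.
have [u [[uc ud] _]] := univ _ _ _ sq.
have [v vE] : exists v : clin (U Q) (U D), forall z, v (q z) = c (p1 z) + d (p2 z).
  pose h : clin (U P) (U D) := @comp C P B D c p1 + @comp C P B' D d p2.
  have hE z : h z = c (p1 z) + d (p2 z) by [].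
  have [|v vE] := surjection_factor (g := h) qop; last by exists v => z; rewrite vE.
  move=> z /qk[x _ <-]; rewrite hE m1 m2 clin_N; apply/eqP; rewrite subr_eq0; apply/eqP.
  exact: (hom_app cadb x).
have uE x : u (d x) = d' x by have := hom_app ud x.
have vu y : v (u y) = y.
  have [w [_ wuniq]] := univ _ c d cadb.
  have e2 : w = idm D by apply: wuniq; rewrite !comp1m.
  have e1 : w = @comp C D Q D v u.
    apply: wuniq; rewrite -!compA uc ud; split; apply: hom_ext => x.
      by change (v (q (i1 x)) = c x); rewrite vE i11 i12 (clin_0 d) addr0.
    by change (v (q (i2 x)) = d x); rewrite vE i21 i22 (clin_0 c) add0r.
  by have := hom_app (esym e1) y; rewrite e2.
(* If [i2 y] agrees with a small [z] modulo [range m], the correcting [x] satisfies [a x = - p1 z].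
   So [a x] is small, hence so is [b x], and [y = p2 z + b (- x)]. *)
have d'nb V : nbhs (0 : U B') V -> exists2 N, nbhs (0 : U Q) N & forall y, N (d' y) -> V y.
  move=> /nbhs0_add[V' V'0 V'V]; have [N N0 NV] := aemb _ (clin_nbhs0 b V'0).
  exists (q @` (p1 @^-1` N `&` p2 @^-1` V')).
    by apply: (proj2 qop); apply: filterI; apply: clin_nbhs0.
  move=> y [z [/= z1 z2] qz]; have /qk[x _ xE] : q (i2 y - z) = 0.
    by rewrite clin_B qz subrr.
  have := congr1 p1 xE; rewrite m1 clin_B i21 sub0r => ax.
  have := congr1 p2 xE; rewrite m2 clin_B i22 => bx.
  have -> : y = p2 z + b (- x) by rewrite clin_N bx addrC subrK.
  apply: V'V => //; apply: (NV (- x)).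
  by rewrite clin_N ax opprK.
have dnb V : nbhs (0 : U B') V -> exists2 N, nbhs (0 : U D) N & forall y, N (d y) -> V y.
  move=> /d'nb[N N0 NV]; exists (u @^-1` N); first exact: clin_nbhs0.
  by move=> y /=; rewrite uE; exact: NV.
apply/(kernelsP stableU); split.
  split=> // x y dxy; apply/eqP; rewrite -subr_eq0; apply/eqP/sU => V /dnb[N N0 NV].
  by apply: NV; rewrite clin_B dxy subrr; exact: nbhs_singleton.
(* Closedness of [range d]: the map [s] from [Q] onto the quotient of [B] by [range a] kills
   [range d], hence its closure, and an element killed by [s] comes from [B']. *)
have [W [r [rop rk]]] := sc_quotient stableU (range_submod a) acl.
have [s sE] : exists s : clin (U Q) (U W), forall z, s (q z) = r (p1 z).
  have [|s sE] := surjection_factor (g := @comp C P B W r p1) qop.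
    by move=> z /qk[x _ <-]; change (r (p1 (m x)) = 0); rewrite m1; apply/rk; exists x.
  by exists s => z; rewrite sE.
move=> y yd; have : s (u y) = 0.
  apply: (clin_adherent0 (f := @comp C D Q W s u) _ _ yd) => // _ [x _ <-].
  change (s (u (d x)) = 0).
  by rewrite uE d'E sE i21 clin_0.
have [z zq] := proj1 qop (u y); rewrite -zq sE => /rk[x _ xE].
exists (p2 z + b x) => //; rewrite -[y]vu -zq -[LHS]vu uE d'E; congr (v _).
apply/eqP; rewrite -subr_eq0 -clin_B; apply/eqP/qk; exists (- x) => //.
apply: (product_inj (@sU P) p12).
  by rewrite m1 clin_B i21 clin_N xE sub0r.
by rewrite m2 clin_B i22 clin_N opprK addrAC subrr add0r.
Qed.

Lemma sc_quasi_abelian : quasi_abelian C.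
Proof.
by split; [exact: sc_left_quasi_abelian|exact: sc_right_quasi_abelian].
Qed.

Lemma rank_one (E F : topologicalLmodType k) (X : clin E k^o) (v : F) :
  exists f : clin E F, forall x, f x = (X x : k) *: v.
Proof.
apply: clin_intro => [a x y|A A0].
  by rewrite (clin_linear X) scalerDl -scalerA.
have [e e0 eA] := nbhs0_absorb v A0.
have : nbhs (0 : k^o) (ball (0 : k^o) e) by exact: nbhsx_ballx.
by move/(clin_nbhs0 X); apply: filterS => x; rewrite /ball /= sub0r normrN; apply: eA.
Qed.

(* [a] is a monomorphism and an epimorphism, hence witnesses both failures:
   [v] lies outside its range, and [X] is not continuous for the topology
   pulled back along [a]. *)
Lemma sc_not_integral (t : C) (a : clin (U t) (U t)) (X : clin (U t) k^o) (v : U t) :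
  (forall x, a x = 0 -> x = 0) -> (forall x, adherent (range a) x) ->
  (forall x, a x <> v) ->
  (forall A, nbhs (0 : U t) A -> exists2 x, A (a x) & X x = 1) ->
  ~ left_integral C /\ ~ right_integral C.
Proof.
move=> ainj adense av Xa.
have v0 : v <> 0 by move=> v0; apply: (av 0); rewrite clin_0 v0.
have [b bE] := rank_one X v.
have bn0 : b <> 0.
  move=> b0; have [x _ Xx] := Xa setT (filter_nbhsT _).
  by apply: v0; rewrite -[v]scale1r -Xx -bE b0.
split=> -[_ st].
  have [A [a' [b' [sq elt _]]]] := sc_pullback stableU (b : @hom C t t) (a : @hom C t t).
  have epia : epis (a : @hom C t t).
    move=> Y g h gh; apply: hom_ext => x; apply/eqP; rewrite -subr_eq0; apply/eqP.
    apply: (clin_adherent0 (f := (g - h : @hom C t Y)) _ _ (adense x)) => // _ [y _ <-].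
    change (g (a y) - h (a y) = 0); apply/eqP; rewrite subr_eq0; apply/eqP.
    exact: (hom_app gh y).
  (* If [X (a' z)] were nonzero, dividing [b (a' z) = a (b' z)] by it would put [v] in the range of
     [a]. *)
  have e : (b : @hom C t t) \co a' = 0 \co a'.
    apply: hom_ext => z; change (b (a' z) = 0); rewrite bE.
    have e := hom_app (proj1 sq) z; change (b (a' z) = a (b' z)) in e.
    have [->|Xz] := eqVneq (X (a' z) : k) 0; first by rewrite scale0r.
    exfalso; apply: (av ((X (a' z) : k)^-1 *: b' z)).
    by rewrite clin_Z -e bE scalerA mulVf // scale1r.
  exact: bn0 (st _ _ _ _ _ _ _ _ sq epia _ _ _ e).
have [D [c [d sq]]] := sc_pushout (a : @hom C t t) (b : @hom C t t).
have monoa : monos (a : @hom C t t).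
  move=> Y g h gh; apply: hom_ext => x; apply/eqP; rewrite -subr_eq0; apply/eqP/ainj.
  by rewrite clin_B; apply/eqP; rewrite subr_eq0; apply/eqP; exact: (hom_app gh x).
(* For [x] with [X x = 1] one has [d v = d (b x) = c (a x)], and [a x] can be chosen in any
   neighbourhood of zero. *)
have dv : d v = 0.
  apply: sU => A /(clin_nbhs0 c)/Xa[x Ax Xx].
  have e := hom_app (proj1 sq) x; change (c (a x) = d (b x)) in e.
  by move: Ax => /=; rewrite e bE Xx scale1r.
have e : d \co (b : @hom C t t) = d \co 0.
  by apply: hom_ext => x; change (d (b x) = d 0); rewrite bE clin_Z dv scaler0 clin_0.
exact: bn0 (st _ _ _ _ _ _ _ _ sq monoa _ _ _ e).
Qed.

End Pushouts.

(** * Constructions of spaces *)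

Section QuotientModule.
Variables (k : numFieldType) (V : lmodType k) (K : set V) (subK : is_submod K).

(** The choice depends on the coset as a set only, so congruent vectors get the same representative
    and the quotient can be the subtype of chosen representatives. *)
Definition coset_repr (x : V) : V := xget 0 [set y | K (x - y)].

Lemma coset_reprP x : K (x - coset_repr x).
Proof.
apply: (@xgetPex _ 0 [set y | K (x - y)]).
by exists x => /=; rewrite subrr; exact: (proj1 subK).
Qed.

Lemma coset_repr_eq x y : K (x - y) -> coset_repr x = coset_repr y.
Proof.
move=> xy; rewrite /coset_repr; congr xget; apply/seteqP; split=> z /= h.
  rewrite -(subrKA x); apply: (submodD subK) h.
  by rewrite -opprB; exact: (submodN subK xy).
by rewrite -(subrKA y); exact: (submodD subK xy h).
Qed.

Lemma coset_reprK x : coset_repr (coset_repr x) = coset_repr x.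
Proof. by apply: coset_repr_eq; rewrite -opprB; exact: (submodN subK (coset_reprP x)). Qed.

(** The proof is a parameter of the type because the algebraic structures declared on it depend on
    it; [submodule] and [generated_tvs] have this form for the same reason. *)
Definition quotient_module of is_submod K := {x : V | coset_repr x == x}.
Let Q := quotient_module subK.
HB.instance Definition _ := Choice.on Q.

Definition coset (x : V) : Q := exist _ (coset_repr x) (introT eqP (coset_reprK x)).

Lemma coset_val (u : Q) : coset (val u) = u.
Proof. by apply: val_inj => /=; apply/eqP; exact: (valP u). Qed.

Lemma coset_eq x y : K (x - y) -> coset x = coset y.
Proof. by move=> h; apply: val_inj; exact: coset_repr_eq. Qed.

Lemma val_coset x : K (val (coset x) - x).
Proof. by rewrite -opprB; exact: (submodN subK (coset_reprP x)). Qed.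

Definition coset_add (u v : Q) : Q := coset (val u + val v).
Definition coset_opp (u : Q) : Q := coset (- val u).
Definition coset_scale (a : k) (u : Q) : Q := coset (a *: val u).

Lemma coset_addE x y : coset_add (coset x) (coset y) = coset (x + y).
Proof. by apply: coset_eq; rewrite opprD addrACA; apply: (submodD subK); exact: val_coset. Qed.

Lemma coset_scaleE a x : coset_scale a (coset x) = coset (a *: x).
Proof. by apply: coset_eq; rewrite -scalerBr; apply: (submodZ _ subK); exact: val_coset. Qed.

Lemma coset_addA : associative coset_add.
Proof.
by move=> u v w; rewrite -[u]coset_val -[v]coset_val -[w]coset_val !coset_addE addrA.
Qed.

Lemma coset_addC : commutative coset_add.
Proof. by move=> u v; rewrite /coset_add addrC. Qed.

Lemma coset_add0 : left_id (coset 0) coset_add.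
Proof. by move=> u; rewrite -[u]coset_val coset_addE add0r. Qed.

Lemma coset_addN : left_inverse (coset 0) coset_opp coset_add.
Proof.
by move=> u; rewrite /coset_opp -[X in coset_add _ X]coset_val coset_addE addNr.
Qed.

HB.instance Definition _ :=
  GRing.isZmodule.Build Q coset_addA coset_addC coset_add0 coset_addN.

Lemma coset_scaleA a b (u : Q) : coset_scale a (coset_scale b u) = coset_scale (a * b) u.
Proof. by rewrite -[u]coset_val !coset_scaleE scalerA. Qed.

Lemma coset_scale1 : left_id 1 coset_scale.
Proof. by move=> u; rewrite /coset_scale scale1r coset_val. Qed.

Lemma coset_scaleDr : right_distributive coset_scale +%R.
Proof.
move=> a u v.
change (coset_scale a (coset_add u v) = coset_add (coset_scale a u) (coset_scale a v)).
rewrite -[u]coset_val -[v]coset_val.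
by rewrite coset_addE !coset_scaleE coset_addE scalerDr.
Qed.

Lemma coset_scaleDl (u : Q) : {morph coset_scale^~ u : a b / a + b}.
Proof.
move=> a b /=; change (coset_scale (a + b) u = coset_add (coset_scale a u) (coset_scale b u)).
by rewrite -[u]coset_val !coset_scaleE coset_addE scalerDl.
Qed.

HB.instance Definition _ := GRing.Zmodule_isLmodule.Build k Q
  coset_scaleA coset_scale1 coset_scaleDr coset_scaleDl.

Lemma coset_linear : linear coset.
Proof. by move=> a x y; rewrite -coset_addE -coset_scaleE. Qed.

Lemma coset_eq0 x : coset x = 0 <-> K x.
Proof.
split=> [/(congr1 val) /= e|Kx]; last by apply: coset_eq; rewrite subr0.
rewrite -[x](subrK (coset_repr x)); apply: submodD => //; first exact: coset_reprP.
by rewrite e; have := submodN subK (coset_reprP 0); rewrite sub0r opprK.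
Qed.

End QuotientModule.

Lemma quotient_lmodule (k : numFieldType) (V : lmodType k) (K : set V) : is_submod K ->
  exists (Q : lmodType k) (p : {linear V -> Q}),
    (forall y, exists x, p x = y) /\ forall x, p x = 0 <-> K x.
Proof.
move=> subK; pose m := GRing.isLinear.Build k V (quotient_module subK) *:%R _ (coset_linear subK).
pose p : {linear V -> quotient_module subK} := HB.pack (coset subK) m.
exists (quotient_module subK), p; split=> [y|x]; last exact: coset_eq0.
by exists (val y); exact: coset_val.
Qed.

Section Submodule.
Variables (k : numFieldType) (V : lmodType k) (S : set V) (subS : is_submod S).

Definition submodule_pred of is_submod S : {pred V} := fun x => `[< S x >].
Let P := submodule_pred subS.

Lemma submodule_closed : submod_closed P.
Proof.
split; first by apply/asboolP; exact: (proj1 subS).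
by move=> a x y /asboolP Sx /asboolP Sy; apply/asboolP; exact: (proj2 subS).
Qed.

HB.instance Definition _ := GRing.isSubmodClosed.Build k V P submodule_closed.

Record submodule := Submodule { submodule_val : V; _ : submodule_val \in P }.
HB.instance Definition _ := [isSub for submodule_val].
HB.instance Definition _ := [Choice of submodule by <:].
HB.instance Definition _ := [SubChoice_isSubLmodule of submodule by <:].

End Submodule.

Lemma sub_lmodule (k : numFieldType) (V : lmodType k) (S : set V) : is_submod S ->
  exists (W : lmodType k) (j : {linear W -> V}), injective j /\ range j = S.
Proof.
move=> subS; exists (submodule subS), (val : {linear submodule subS -> V}).
split; first exact: val_inj.
apply/seteqP; split=> [_ [x _ <-]|x Sx]; first by apply/asboolP; exact: (valP x).
have Px : x \in submodule_pred subS by apply/asboolP.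
by exists (Submodule Px).
Qed.

(** * Vector topologies from filters of zero-neighbourhoods *)

Section TopologyFromZero.
Variables (k : numFieldType) (V : lmodType k).

(** The three scaling axioms are continuity of scalar multiplication at [(0, 0)], at [(0, x)] and at
    [(a, 0)]; with additivity they give joint continuity everywhere. *)
Record zero_nbhs_axioms (N : set_system V) : Prop := ZeroNbhsAxioms {
  zn_filter : Filter N;
  zn_zero : forall A, N A -> A 0;
  zn_add : forall A, N A -> exists2 B, N B & forall x y, B x -> B y -> A (x + y);
  zn_scale : forall A, N A -> exists2 B, N B &
    exists2 e : k, 0 < e & forall a x, `|a| < e -> B x -> A (a *: x);
  zn_absorb : forall A x, N A -> exists2 e : k, 0 < e & forall a, `|a| < e -> A (a *: x);
  zn_scalel : forall A a, N A -> N [set x | A (a *: x)] }.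

Variables (N : set_system V) (axN : zero_nbhs_axioms N).

Definition generated_tvs of zero_nbhs_axioms N : Type := V.
Let E := generated_tvs axN.
HB.instance Definition _ := GRing.Lmodule.on E.
Let nb (x : E) : set_system E := [set A | N [set y | A (x + y)]].
HB.instance Definition _ := hasNbhs.Build E nb.

Lemma generated_tvs_filter (x : E) : ProperFilter (nbhs x).
Proof.
have FN := zn_filter axN; have Fx : Filter (nbhs x).
  split; first exact: filterT.
    by move=> A B; exact: filterI.
  by move=> A B AB; apply: filterS => y; exact: AB.
by apply: Build_ProperFilter_ex => A /(zn_zero axN) /= h; exists (x + 0).
Qed.

Lemma generated_tvs_singleton (x : E) (A : set E) : nbhs x A -> A x.
Proof. by move=> /(zn_zero axN) /=; rewrite addr0. Qed.

Lemma generated_tvs_nbhs (x : E) (A : set E) : nbhs x A -> nbhs x (nbhs^~ A).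
Proof.
have FN := zn_filter axN; move=> /(zn_add axN)[B B0 BA].
change (N [set y | N [set z | A (x + y + z)]]).
apply: filterS (B0) => y By; apply: filterS B0 => z Bz; rewrite /= -addrA; exact: BA.
Qed.

HB.instance Definition _ := Nbhs_isNbhsTopological.Build E
  generated_tvs_filter generated_tvs_singleton generated_tvs_nbhs.

Lemma generated_tvs_add : continuous (fun x : E * E => x.1 + x.2).
Proof.
have FN := zn_filter axN; move=> [x y] A /(zn_add axN)[B B0 BA].
exists ([set z | B (z - x)], [set z | B (z - y)]) => /=.
  split; [change (N [set z | B (x + z - x)])|change (N [set z | B (y + z - y)])];
    by apply: filterS B0 => z /=; rewrite addrC addKr.
move=> [z w] /= [Bz Bw]; have := BA _ _ Bz Bw.
by rewrite /= addrACA [x + _]addrC [y + _]addrC !subrK.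
Qed.

Lemma generated_tvs_scale : continuous (fun z : k^o * E => z.1 *: z.2).
Proof.
have FN := zn_filter axN; move=> [a x] A /= /(zn_add axN)[B B0 BA].
have [B' B'0 B'B] := zn_add axN B0.
have [e1 e10 h1] := zn_absorb axN x B'0.
have [D D0 [e2 e20 h2]] := zn_scale axN B'0.
have h3 := zn_scalel axN a B0.
exists ([set b : k^o | `|a - b| < e1 /\ `|a - b| < e2], [set y | D (y - x) /\ B (a *: (y - x))]).
  split; first exact: (filterI (@nbhsx_ballx k k^o a _ e10) (@nbhsx_ballx k k^o a _ e20)).
  change (N [set y | D (x + y - x) /\ B (a *: (x + y - x))]).
  apply: filterS (filterI D0 h3) => y [Dy By] /=.
  by rewrite [x + y]addrC addrK.
move=> [b y] /= [[ab1 ab2] [Dy By]].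
(* Each of the three error terms is controlled by exactly one scaling axiom. *)
have -> : b *: y = a *: x + (a *: (y - x) + ((b - a) *: x + (b - a) *: (y - x))).
  rewrite -scalerDr [x + _]addrC subrK scalerBr scalerBl.
  by rewrite [a *: x + _]addrA [a *: x + _]addrC subrK [RHS]addrC subrK.
apply: BA => //; apply: B'B; first by apply: h1; rewrite distrC.
by apply: h2 => //; rewrite distrC.
Qed.

HB.instance Definition _ := PreTopologicalNmodule_isTopologicalNmodule.Build E
  generated_tvs_add.
HB.instance Definition _ := TopologicalNmodule_isTopologicalLmodule.Build k E
  generated_tvs_scale.

End TopologyFromZero.

Lemma exists_tvs (k : numFieldType) (V : lmodType k) (N : set_system V) :
  zero_nbhs_axioms N -> exists (E : topologicalLmodType k) (j : {linear V -> E}),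
    bijective j /\ forall A, nbhs (0 : E) A <-> N (j @^-1` A).
Proof.
move=> axN; have jl : linear (id : V -> generated_tvs axN) by [].
pose m := GRing.isLinear.Build k V (generated_tvs axN) *:%R _ jl.
pose j : {linear V -> generated_tvs axN} := HB.pack (id : V -> generated_tvs axN) m.
exists (generated_tvs axN), j; split; first by exists id.
move=> A; change (N [set y | A (0 + y)] <-> N A).
by rewrite (_ : [set y | _] = A) //; apply/seteqP; split=> y /=; rewrite add0r.
Qed.

Lemma exists_normed (k : numFieldType) (V : lmodType k) (n : V -> k) :
  (forall x y, n (x + y) <= n x + n y) ->
  (forall a x, n (a *: x) = `|a| * n x) -> (forall x, n x = 0 -> x = 0) ->
  exists (E : normedModType k) (j : {linear V -> E}),
    bijective j /\ forall x, `|j x| = n x.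
Proof.
move=> n1 n2 n3; pose m := Lmodule_isNormed.Build k V n1 n2 n3.
pose E : normedModType k := HB.pack V m.
have jl : linear (id : V -> E) by [].
pose mj := GRing.isLinear.Build k V E *:%R _ jl.
pose j : {linear V -> E} := HB.pack (id : V -> E) mj.
by exists E, j; split; first by exists id.
Qed.

Lemma exists_complete_normed (R : realType) (c : scalar_kind)
    (E : normedModType (scalar_field R c)) : complete_tvs E ->
  exists (F : completeNormedModType (scalar_field R c)) (j : {linear E -> F}),
    bijective j /\ forall x, `|j x| = `|x|.
Proof.
set k := scalar_field R c; move=> cE.
have cE' (F : set_system E) : ProperFilter F -> cauchy F -> cvg F.
  move=> PF cF; have [|x Fx] := cE F PF; last by apply/cvg_ex; exists x.
  move=> A /nbhs_ballP[e e0 eA]; apply: (cF [set z | A (z.1 - z.2)]).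
  rewrite -entourage_ballE; exists e => // -[x y] /= xy; apply: eA.
  by rewrite -ball_normE /= sub0r normrN; move: xy; rewrite -ball_normE.
pose m := Uniform_isComplete.Build E cE'.
pose F : completeNormedModType k := HB.pack E m.
have jl : linear (id : E -> F) by [].
pose mj := GRing.isLinear.Build k E F *:%R _ jl.
pose j : {linear E -> F} := HB.pack (id : E -> F) mj.
by exists F, j; split; first by exists id.
Qed.

(** * Scalars and seminorms *)

Section SeminormConvergence.
Variables (R : realType) (V : zmodType) (p : V -> R).

(** Sequential notions for a bare function [p], usable for seminorms with a kernel and before [V]
    carries any topology. *)
Definition scauchy (u : nat -> V) := forall e : R, 0 < e ->
  exists N, forall m n, (N <= m)%N -> (N <= n)%N -> p (u m - u n) < e.

Definition slim (u : nat -> V) (l : V) := forall e : R, 0 < e ->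
  exists N, forall n, (N <= n)%N -> p (u n - l) < e.

End SeminormConvergence.

Lemma real_complete (R : realType) (u : nat -> R) :
  scauchy Num.norm u -> exists l, slim Num.norm u l.
Proof.
move=> cu; have cvu : cvgn u.
  apply/cauchy_cvgP/cauchy_exP => e e0; have [N uN] := cu e e0.
  exists (u N); exists N => // n /= Nn.
  by rewrite -ball_normE /=; exact: uN.
exists (limn u) => e e0.
have /cvgrPdist_lt/(_ e e0)[N _ uN] := cvu.
by exists N => n Nn; rewrite distrC; exact: uN.
Qed.

Lemma complex_norm_bounds (R : realType) (z : R[i]) :
  [/\ `|complex.Re z| <= complex.Re `|z|, `|complex.Im z| <= complex.Re `|z|
    & complex.Re `|z| <= `|complex.Re z| + `|complex.Im z|].
Proof.
have nE : complex.Re `|z| = Num.sqrt (complex.Re z ^+ 2 + complex.Im z ^+ 2).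
  by rewrite normc_def.
split.
- by rewrite nE -sqrtr_sqr ler_wsqrtr // lerDl sqr_ge0.
- by rewrite nE -sqrtr_sqr ler_wsqrtr // lerDr sqr_ge0.
- rewrite nE -[leRHS]ger0_norm ?addr_ge0 // -sqrtr_sqr ler_wsqrtr //.
  by rewrite sqrrD !real_normK ?num_real // -addrA lerD2l lerDr mulrn_wge0 // mulr_ge0.
Qed.

Lemma complex_ReB (R : realType) (z w : R[i]) :
  complex.Re (z - w) = complex.Re z - complex.Re w.
Proof. by case: z; case: w. Qed.

Lemma complex_ImB (R : realType) (z w : R[i]) :
  complex.Im (z - w) = complex.Im z - complex.Im w.
Proof. by case: z; case: w. Qed.

Section Scalars.
Variables (R : realType) (c : scalar_kind).
Local Notation k := (scalar_field R c).

(** All estimates are made in [R]: [emb] includes it in the scalar field and [mag] is the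
    real-valued modulus, so the real and complex cases share every later proof. *)
Definition emb : R -> k :=
  match c return R -> scalar_field R c with
  | RealScalars => id | ComplexScalars => fun x => x%:C%C end.

Definition mag (z : k) : R :=
  match c return scalar_field R c -> R with
  | RealScalars => fun z => `|z| | ComplexScalars => fun z => complex.Re `|z| end z.

Local Notation conj := (@scalar_conj R c).

Lemma embD x y : emb (x + y) = emb x + emb y.
Proof. by rewrite /emb; case: c => //=; rewrite rmorphD. Qed.

Lemma embM x y : emb (x * y) = emb x * emb y.
Proof. by rewrite /emb; case: c => //=; rewrite rmorphM. Qed.

Lemma emb0 : emb 0 = 0.
Proof. by rewrite /emb; case: c => //=; rewrite rmorph0. Qed.

Lemma emb1 : emb 1 = 1.
Proof. by rewrite /emb; case: c => //=; rewrite rmorph1. Qed.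

Lemma embN x : emb (- x) = - emb x.
Proof. by rewrite /emb; case: c => //=; rewrite rmorphN. Qed.

Lemma embB x y : emb (x - y) = emb x - emb y.
Proof. by rewrite embD embN. Qed.

Lemma embV x : emb x^-1 = (emb x)^-1.
Proof. by rewrite /emb; case: c => //=; rewrite fmorphV. Qed.

Lemma embX x n : emb (x ^+ n) = emb x ^+ n.
Proof. by elim: n => [|n IH]; rewrite ?expr0 ?emb1 // !exprS embM IH. Qed.

Lemma emb_sum (I : Type) (r : seq I) (P : pred I) (F : I -> R) :
  emb (\sum_(i <- r | P i) F i) = \sum_(i <- r | P i) emb (F i).
Proof. exact: (big_morph _ embD emb0). Qed.

Lemma ler_emb x y : (emb x <= emb y) = (x <= y).
Proof. by rewrite /emb; case: c => //=; rewrite lecR. Qed.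

Lemma ltr_emb x y : (emb x < emb y) = (x < y).
Proof. by rewrite /emb; case: c => //=; rewrite ltcR. Qed.

Lemma emb_inj : injective emb.
Proof. by move=> x y e; apply/eqP; rewrite eq_le -!ler_emb e lexx. Qed.

Lemma normE (z : k) : `|z| = emb (mag z).
Proof. by rewrite /emb /mag; case: c z => //= z; rewrite {1}normc_def normc_def. Qed.

Lemma emb_mag (z : k) : 0 <= z -> emb (mag z) = z.
Proof. by move=> z0; rewrite -normE ger0_norm. Qed.

Lemma mag_ge0 (z : k) : 0 <= mag z.
Proof. by rewrite -ler_emb emb0 -normE. Qed.

Lemma magD (z w : k) : mag (z + w) <= mag z + mag w.
Proof. by rewrite -ler_emb embD -!normE; exact: ler_normD. Qed.

Lemma magM (z w : k) : mag (z * w) = mag z * mag w.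
Proof. by apply: emb_inj; rewrite embM -!normE normrM. Qed.

Lemma mag_emb x : mag (emb x) = `|x|.
Proof.
apply: emb_inj; rewrite -normE; have [x0|x0] := leP 0 x.
  by rewrite !ger0_norm // -emb0 ler_emb.
by rewrite !ltr0_norm ?embN // -emb0 ltr_emb.
Qed.

Lemma mag0 : mag 0 = 0.
Proof. by rewrite -emb0 mag_emb normr0. Qed.

Lemma mag1 : mag 1 = 1.
Proof. by rewrite -emb1 mag_emb normr1. Qed.

Lemma mag_eq0 (z : k) : mag z = 0 -> z = 0.
Proof. by move=> z0; apply/eqP; rewrite -normr_eq0 normE z0 emb0. Qed.

Lemma magN (z : k) : mag (- z) = mag z.
Proof. by apply: emb_inj; rewrite -!normE normrN. Qed.

Lemma magV (z : k) : mag z^-1 = (mag z)^-1.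
Proof. by apply: emb_inj; rewrite embV -!normE normfV. Qed.

Lemma emb_gt0 (e : k) : 0 < e -> 0 < mag e /\ emb (mag e) = e.
Proof.
by move=> e0; have ee := emb_mag (ltW e0); split=> //; rewrite -ltr_emb emb0 ee.
Qed.

Lemma conjD (z w : k) : conj (z + w) = conj z + conj w.
Proof. by rewrite /scalar_conj; case: c z w => //= z w; rewrite rmorphD. Qed.

Lemma conjM (z w : k) : conj (z * w) = conj z * conj w.
Proof. by rewrite /scalar_conj; case: c z w => //= z w; rewrite rmorphM. Qed.

Lemma conj_involutive (z : k) : conj (conj z) = z.
Proof. by rewrite /scalar_conj; case: c z => //= z; rewrite conjCK. Qed.

Lemma mul_conj (z : k) : z * conj z = emb (mag z ^+ 2).
Proof.
rewrite embX -normE /scalar_conj; case: c z => //= z; last by rewrite normCK.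
by rewrite real_normK ?num_real // expr2.
Qed.

Lemma conj_emb x : conj (emb x) = emb x.
Proof.
rewrite /scalar_conj /emb; case: c => //=.
by apply: conj_Creal; rewrite complex_real.
Qed.

Lemma conj0 : conj 0 = 0.
Proof. by rewrite -emb0 conj_emb. Qed.

Lemma conjN (z : k) : conj (- z) = - conj z.
Proof. by apply: (@addrI _ (conj z)); rewrite -conjD !subrr conj0. Qed.

Lemma conjB (z w : k) : conj (z - w) = conj z - conj w.
Proof. by rewrite conjD conjN. Qed.

Lemma mag_conj (z : k) : mag (conj z) = mag z.
Proof.
apply/eqP; rewrite -(@eqrXn2 _ 2) ?mag_ge0 //; apply/eqP/emb_inj.
by rewrite -!mul_conj conj_involutive mulrC.
Qed.

Lemma scalar_complete (u : nat -> k) : scauchy mag u -> exists l, slim mag u l.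
Proof.
rewrite /mag; case: c u => /= u; first exact: real_complete.
move=> cu; have [|a ua] := @real_complete R (fun n => complex.Re (u n)).
  move=> e e0; have [N uN] := cu e e0; exists N => m n Nm Nn.
  by rewrite -complex_ReB; apply: le_lt_trans _ (uN _ _ Nm Nn); have [] := complex_norm_bounds (u m - u n).
have [|b ub] := @real_complete R (fun n => complex.Im (u n)).
  move=> e e0; have [N uN] := cu e e0; exists N => m n Nm Nn.
  by rewrite -complex_ImB; apply: le_lt_trans _ (uN _ _ Nm Nn); have [] := complex_norm_bounds (u m - u n).
exists (a +i* b)%C => e e0; have e2 : 0 < e / 2 by rewrite divr_gt0.
have [N1 h1] := ua _ e2; have [N2 h2] := ub _ e2.
exists (maxn N1 N2) => n; rewrite geq_max => /andP[n1 n2].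
have [_ _ /le_lt_trans] := complex_norm_bounds (u n - (a +i* b)%C); apply.
rewrite [e]splitr complex_ReB complex_ImB.
by apply: ltrD; [exact: h1|exact: h2].
Qed.

(** Total boundedness of a disc as a finite colouring with cells of diameter at most [e]: the index
    in a subdivision of [[-M, M]], or a pair of such indices at mesh [e / 2] for complex scalars. In
    this form finite powers of the disc are coloured by finite functions. *)
Lemma scalar_totally_bounded (M e : R) : 0 < e ->
  exists (I : finType) (cell : k -> I), forall z w, mag z <= M -> mag w <= M ->
    cell z = cell w -> mag (z - w) <= e.
Proof.
have realcase (e' : R) : 0 < e' -> exists (I : finType) (cell : R -> I), forall z w,
    `|z| <= M -> `|w| <= M -> cell z = cell w -> `|z - w| <= e'.
  move=> e'0; pose f (z : R) := Num.truncn ((z + M) / e').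
  exists 'I_(Num.truncn ((M + M) / e')).+1, (fun z => inord (f z)) => z w zM wM.
  have fP x : `|x| <= M -> (f x)%:R <= (x + M) / e' < (f x).+1%:R /\ (f x < (Num.truncn ((M + M) / e')).+1)%N.
    move=> xM; have x0 : 0 <= (x + M) / e'.
      by rewrite divr_ge0 ?(ltW e'0) // addrC -lerBlDr sub0r; have /ler_normlP[] := xM; lra.
    split; first exact: truncn_itv.
    rewrite ltnS; apply: le_truncn; rewrite ler_pM2r ?invr_gt0 // lerD2r.
    by apply: le_trans xM; exact: ler_norm.
  have [/andP[z1 z2] zi] := fP _ zM; have [/andP[w1 w2] wi] := fP _ wM.
  move=> /(congr1 val); rewrite /= !inordK // => fzw; rewrite fzw in z1 z2.
  rewrite ler_pdivlMr // in z1; rewrite ler_pdivlMr // in w1.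
  rewrite ltr_pdivrMr // in z2; rewrite ltr_pdivrMr // in w2.
  rewrite -natr1 mulrDl mul1r in z2 w2; rewrite ler_norml; lra.
move=> e0; rewrite /mag; case: c => /=; first exact: realcase.
have [|I [cell cellP]] := realcase (e / 2); first by rewrite divr_gt0.
exists (I * I)%type, (fun z => (cell (complex.Re z), cell (complex.Im z))) => z w zM wM [h1 h2].
have [z1 z2 _] := complex_norm_bounds z; have [w1 w2 _] := complex_norm_bounds w.
have [_ _ /le_trans] := complex_norm_bounds (z - w); apply.
rewrite [e]splitr complex_ReB complex_ImB.
by apply: lerD; apply: cellP => //; [exact: le_trans zM|exact: le_trans wM
  |exact: le_trans zM|exact: le_trans wM].
Qed.

End Scalars.

(** * Real-valued seminorms, quotient seminorms and continuity *)

Section Seminorms.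
Variables (R : realType) (c : scalar_kind).
Local Notation k := (scalar_field R c).
Implicit Types (V W : lmodType k) (E F : topologicalLmodType k).

Definition real_seminorm V (p : V -> R) :=
  [/\ forall x, 0 <= p x, forall x y, p (x + y) <= p x + p y
    & forall a x, p (a *: x) = mag a * p x].

Lemma rsn_ge0 V (p : V -> R) x : real_seminorm p -> 0 <= p x.
Proof. by case. Qed.

Lemma rsn_D V (p : V -> R) x y : real_seminorm p -> p (x + y) <= p x + p y.
Proof. by case. Qed.

Lemma rsn_Z V (p : V -> R) a x : real_seminorm p -> p (a *: x) = mag a * p x.
Proof. by case. Qed.

Lemma rsn_0 V (p : V -> R) : real_seminorm p -> p 0 = 0.
Proof. by move=> ps; rewrite -(scale0r (0 : V)) (rsn_Z _ _ ps) mag0 mul0r. Qed.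

Lemma rsn_N V (p : V -> R) x : real_seminorm p -> p (- x) = p x.
Proof. by move=> ps; rewrite -scaleN1r (rsn_Z _ _ ps) magN mag1 mul1r. Qed.

Lemma rsn_B V (p : V -> R) x y : real_seminorm p -> p (x - y) <= p x + p y.
Proof. by move=> ps; rewrite -(rsn_N y ps); exact: rsn_D. Qed.

Lemma rsn_subC V (p : V -> R) x y : real_seminorm p -> p (x - y) = p (y - x).
Proof. by move=> ps; rewrite -(rsn_N _ ps) opprB. Qed.

Lemma rsn_tri V (p : V -> R) z x y : real_seminorm p -> p (x - y) <= p (x - z) + p (z - y).
Proof. by move=> ps; rewrite -(subrKA z); exact: rsn_D. Qed.

Lemma rsn_dist V (p : V -> R) x y : real_seminorm p -> p x <= p y + p (x - y).
Proof. by move=> ps; rewrite -{1}(subrK y x) addrC; exact: rsn_D. Qed.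

(** The homogeneity inequality for the inverse scalar gives the opposite inequality. *)
Lemma rsn_intro V (p : V -> R) : (forall x, 0 <= p x) ->
  (forall x y, p (x + y) <= p x + p y) -> p 0 = 0 ->
  (forall a x, a != 0 -> p (a *: x) <= mag a * p x) -> real_seminorm p.
Proof.
move=> p0 pD p00 pZ; split=> // a x.
have [->|a0] := eqVneq a 0; first by rewrite scale0r mag0 mul0r.
have ma : 0 < mag a.
  by rewrite lt_neqAle mag_ge0 andbT eq_sym; apply: contra a0 => /eqP/mag_eq0 ->.
apply/eqP; rewrite eq_le pZ //=.
have := pZ a^-1 (a *: x); rewrite invr_eq0 scalerA mulVf // scale1r magV => /(_ a0).
by rewrite [_^-1 * _]mulrC ler_pdivlMr // mulrC.
Qed.

Lemma rsn_add V (p q : V -> R) : real_seminorm p -> real_seminorm q ->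
  real_seminorm (fun x => p x + q x).
Proof.
move=> ps qs; split=> [x|x y|a x]; first by rewrite addr_ge0 ?rsn_ge0.
  by rewrite addrACA; apply: lerD; exact: rsn_D.
by rewrite (rsn_Z _ _ ps) (rsn_Z _ _ qs) mulrDr.
Qed.

Lemma rsn_scale V (p : V -> R) t : 0 <= t -> real_seminorm p ->
  real_seminorm (fun x => t * p x).
Proof.
move=> t0 ps; split=> [x|x y|a x]; first by rewrite mulr_ge0 ?rsn_ge0.
  by rewrite -mulrDr ler_wpM2l // rsn_D.
by rewrite (rsn_Z _ _ ps) mulrCA.
Qed.

Lemma rsn_comp V W (p : W -> R) (f : V -> W) : linear f -> real_seminorm p ->
  real_seminorm (fun x => p (f x)).
Proof.
move=> fl ps; have f0 : f 0 = 0.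
  by have := fl (-1) 0 0; rewrite scaler0 addr0 scaleN1r addNr.
split=> [x|x y|a x]; first exact: rsn_ge0.
  by have := fl 1 x y; rewrite !scale1r => ->; exact: rsn_D.
by have := fl a x 0; rewrite !addr0 f0 addr0 => ->; exact: rsn_Z.
Qed.

(** Rescale [x] by [p x + e], which is positive even where [p x] vanishes, and let [e] tend to
    zero. *)
Lemma rsn_le V (p q : V -> R) : real_seminorm p -> real_seminorm q ->
  (forall x, p x < 1 -> q x <= 1) -> forall x, q x <= p x.
Proof.
move=> ps qs pq x; apply/ler_addgt0Pr => e e0.
have t0 : 0 < p x + e by rewrite ltr_wpDl // rsn_ge0.
have := pq (emb c (p x + e)^-1 *: x).
rewrite (rsn_Z _ _ ps) (rsn_Z _ _ qs) mag_emb ger0_norm ?invr_ge0 ?(ltW t0) //.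
rewrite ![_^-1 * _]mulrC ltr_pdivrMr // ler_pdivrMr // mul1r; apply.
by rewrite ltrDl.
Qed.

Definition quotient_seminorm V W (f : V -> W) (p : V -> R) (y : W) : R :=
  inf [set p x | x in [set x | f x = y]].

Section QuotientSeminorm.
Variables (V W : lmodType k) (f : V -> W) (p : V -> R).
Hypotheses (fl : linear f) (fsurj : forall y, exists x, f x = y) (ps : real_seminorm p).

Lemma qsn_le x : quotient_seminorm f p (f x) <= p x.
Proof.
apply: ge_inf; last by exists x.
by exists 0 => _ [z _ <-]; exact: rsn_ge0.
Qed.

Lemma qsn_lt y e : quotient_seminorm f p y < e -> exists2 x, f x = y & p x < e.
Proof.
case/inf_lt; first by have [x fx] := fsurj y; exists (p x), x.
by move=> _ [x fx <-] xe; exists x.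
Qed.

Lemma qsn_ge y t : (forall x, f x = y -> t <= p x) -> t <= quotient_seminorm f p y.
Proof.
move=> h; apply: lb_le_inf; first by have [x fx] := fsurj y; exists (p x), x.
by move=> _ [x fx <-]; exact: h.
Qed.

Lemma qsn_seminorm : real_seminorm (quotient_seminorm f p).
Proof.
have f0 : f 0 = 0.
  by have := fl (-1) 0 0; rewrite scaler0 addr0 scaleN1r addNr.
have q0 y : 0 <= quotient_seminorm f p y by apply: qsn_ge => x _; exact: rsn_ge0.
apply: rsn_intro => // [x y||a y a0].
- apply/ler_addgt0Pr => e e0; have e2 : 0 < e / 2 by rewrite divr_gt0.
  have [|x' x'E hx] := @qsn_lt x (quotient_seminorm f p x + e / 2); first by rewrite ltrDl.
  have [|y' y'E hy] := @qsn_lt y (quotient_seminorm f p y + e / 2); first by rewrite ltrDl.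
  have := qsn_le (1 *: x' + y'); rewrite fl x'E y'E !scale1r => /le_trans; apply.
  by apply: le_trans (rsn_D _ _ ps) _; lra.
- by apply/eqP; rewrite eq_le q0 andbT -(rsn_0 ps) -{1}f0 qsn_le.
- apply/ler_addgt0Pr => e e0.
  have ma : 0 < mag a.
    by rewrite lt_neqAle mag_ge0 andbT eq_sym; apply: contra a0 => /eqP/mag_eq0 ->.
  have [|y' y'E hy] := @qsn_lt y (quotient_seminorm f p y + e / mag a).
    by rewrite ltrDl divr_gt0.
  have := qsn_le (a *: y' + 0); rewrite fl y'E f0 !addr0 => /le_trans; apply.
  rewrite (rsn_Z _ _ ps); apply: le_trans (ler_wpM2l (mag_ge0 a) (ltW hy)) _.
  by rewrite mulrDr [mag a * (e / _)]mulrC divfK // gt_eqF.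
Qed.

End QuotientSeminorm.

Definition cont_seminorm E (p : E -> R) :=
  real_seminorm p /\ nbhs (0 : E) [set x | p x < 1].

Lemma csn_nbhs E (p : E -> R) e : cont_seminorm p -> 0 < e -> nbhs (0 : E) [set x | p x < e].
Proof.
move=> [ps p1] e0; apply: filterS (nbhs0_scalel (emb c e^-1) p1) => x /=.
rewrite (rsn_Z _ _ ps) mag_emb ger0_norm ?invr_ge0 ?(ltW e0) //.
by rewrite mulrC ltr_pdivrMr // mul1r.
Qed.

Lemma csn_le E (p q : E -> R) C : 0 <= C -> cont_seminorm q -> real_seminorm p ->
  (forall x, p x <= C * q x) -> cont_seminorm p.
Proof.
move=> C0 qs ps pq; split=> //.
have C1 : 0 < C + 1 by lra.
apply: filterS (csn_nbhs qs (divr_gt0 ltr01 C1)) => x /=.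
rewrite ltr_pdivlMr // => h; apply: le_lt_trans (pq x) _.
by have := rsn_ge0 x (proj1 qs); lra.
Qed.

Lemma csn_comp E F (p : F -> R) (f : clin E F) : cont_seminorm p ->
  cont_seminorm (fun x => p (f x)).
Proof.
move=> [ps p1]; split; last exact: clin_nbhs0 p1.
by apply: rsn_comp => //; exact: clin_linear.
Qed.

Lemma csn_add E (p q : E -> R) : cont_seminorm p -> cont_seminorm q ->
  cont_seminorm (fun x => p x + q x).
Proof.
move=> ps qs; split; first by apply: rsn_add; [case: ps|case: qs].
have h : 0 < 1 / 2 :> R by lra.
by apply: filterS (filterI (csn_nbhs ps h) (csn_nbhs qs h)) => x [/=]; lra.
Qed.

Lemma csn_scale E (p : E -> R) t : 0 <= t -> cont_seminorm p ->
  cont_seminorm (fun x => t * p x).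
Proof.
by move=> t0 ps; apply: (@csn_le _ _ p t) => //; apply: rsn_scale => //; case: ps.
Qed.

Lemma csn_quotient E F (f : clin E F) (p : E -> R) : open_surjection f ->
  cont_seminorm p -> cont_seminorm (quotient_seminorm f p).
Proof.
move=> [fs fo] [ps p1]; split; first by apply: qsn_seminorm => //; exact: clin_linear.
apply: filterS (fo _ p1) => _ [x /= xp <-].
exact: le_lt_trans (qsn_le f ps x) xp.
Qed.

Lemma csn_seminorm E (p : E -> R) : cont_seminorm p ->
  continuous_seminorm (fun x => emb c (p x)).
Proof.
move=> pc; have [ps _] := pc; split; last first.
  move=> x; apply/cvgrPdist_lt => e /emb_gt0[e0 eE].
  have := csn_nbhs pc e0 => h.
  suff : nbhs x [set y | `|emb c (p x) - emb c (p y)| < e] by [].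
  apply/nbhs_translate; apply: filterS h => y /= ye.
  rewrite -embB normE -eE ltr_emb mag_emb ltr_norml.
  have := rsn_D x y ps; have := rsn_dist x (x + y) ps.
  by rewrite opprD addrA subrr add0r (rsn_N _ ps); lra.
split=> [x|x y|a x].
- by rewrite -emb0 ler_emb rsn_ge0.
- by rewrite -embD ler_emb rsn_D.
- by rewrite (rsn_Z _ _ ps) embM -normE.
Qed.

Lemma continuous_csn E (p : E -> k) : continuous_seminorm p ->
  cont_seminorm (fun x => mag (p x)) /\ forall x, p x = emb c (mag (p x)).
Proof.
move=> [[p0 pD pZ] pc]; have pE x : p x = emb c (mag (p x)) by rewrite emb_mag.
split=> //; split.
  split=> [x|x y|a x]; first exact: mag_ge0.
    by rewrite -(ler_emb c) embD -!pE.
  by apply: (@emb_inj R c); rewrite embM -!pE -normE.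
have p00 : p 0 = 0 by rewrite -(scale0r (0 : E)) pZ normr0 mul0r.
have : nbhs (p 0) [set z | `|z| < 1].
  rewrite p00; have := @nbhsx_ballx k k^o 0 1 ltr01; apply: filterS => z.
  by rewrite -ball_normE /= sub0r normrN.
move=> /pc p1; change (nbhs (0 : E) [set x | `|p x| < 1]) in p1.
apply: filterS p1 => x /=.
by rewrite normE -(emb1 R c) ltr_emb pE mag_emb ger0_norm ?mag_ge0.
Qed.

End Seminorms.

(** * Local convexity, metrizability, completeness *)

Section LocallyConvex.
Variables (R : realType) (c : scalar_kind).
Local Notation k := (scalar_field R c).
Local Notation emb := (emb c).
Implicit Types E F : topologicalLmodType k.

Definition locally_seminormed E := forall U, nbhs (0 : E) U ->
  exists2 p : E -> R, cont_seminorm p & [set x | p x < 1] `<=` U.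

Definition gauge E (W : set E) (x : E) : R := inf [set t : R | 0 < t /\ W (emb t^-1 *: x)].

Lemma gauge_seminorm E (W : set E) : nbhs (0 : E) W ->
  (forall a x, mag a <= 1 -> W x -> W (a *: x)) ->
  (forall t x y, 0 <= t <= 1 -> W x -> W y -> W (emb t *: x + emb (1 - t) *: y)) ->
  cont_seminorm (gauge W) /\ [set x | gauge W x < 1] `<=` W.
Proof.
move=> W0 Wbal Wconv.
pose T x := [set t : R | 0 < t /\ W (emb t^-1 *: x)].
have Tne x : T x !=set0.
  have [e /emb_gt0[e0 eE] eW] := nbhs0_absorb x W0; exists (2 / mag e); split.
    by rewrite divr_gt0.
  apply: eW; rewrite -[ltRHS]eE normE ltr_emb mag_emb invf_div ger0_norm ?divr_ge0 ?mag_ge0 //.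
  by rewrite ltr_pdivrMr //; lra.
have Tlb x : has_lbound (T x) by exists 0 => t [t0 _]; exact: ltW.
have gle x t : 0 < t -> W (emb t^-1 *: x) -> gauge W x <= t.
  by move=> t0 Wt; apply: (ge_inf (Tlb x)).
have glt x e : gauge W x < e -> exists2 t, T x t & t < e by exact: (inf_lt (Tne x)).
have g0 x : 0 <= gauge W x by apply: (lb_le_inf (Tne x)) => t [t0 _]; exact: ltW.
have W00 : W 0 by exact: nbhs_singleton.
have gs : real_seminorm (gauge W).
  apply: rsn_intro => // [x y||a x a0].
  - apply/ler_addgt0Pr => e e0; have e2 : 0 < e / 2 by rewrite divr_gt0.
    have [|t [t0 Wt] te] := glt x (gauge W x + e / 2); first by rewrite ltrDl.
    have [|s [s0 Ws] se] := glt y (gauge W y + e / 2); first by rewrite ltrDl.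
    have ts0 : 0 < t + s by rewrite addr_gt0.
    apply: (@le_trans _ _ (t + s)); last by lra.
    (* With this weight both coefficients of the convex combination become [(t + s)^-1]. *)
    apply: gle => //; have h : 0 <= t / (t + s) <= 1.
      apply/andP; split; first by apply: divr_ge0; exact: ltW.
      by rewrite ler_pdivrMr // mul1r lerDl ltW.
    have := Wconv _ _ _ h Wt Ws; rewrite !scalerA -!embM.
    have -> : t / (t + s) / t = (t + s)^-1 by field; rewrite !gt_eqF.
    have -> : (1 - t / (t + s)) / s = (t + s)^-1 by field; rewrite !gt_eqF.
    by rewrite -scalerDr.
  - apply/eqP; rewrite eq_le g0 andbT; apply/ler_addgt0Pr => e e0.
    by rewrite add0r; apply: gle; rewrite ?scaler0.
  - have ma : 0 < mag a.
      by rewrite lt_neqAle mag_ge0 andbT eq_sym; apply: contra a0 => /eqP/mag_eq0 ->.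
    rewrite -ler_pdivrMl //; apply: (lb_le_inf (Tne x)) => t [t0 Wt].
    rewrite ler_pdivrMl //; apply: gle; first exact: mulr_gt0.
    have -> : emb (mag a * t)^-1 *: (a *: x) = (emb (mag a)^-1 * a) *: (emb t^-1 *: x).
      by rewrite !scalerA invfM embM mulrAC.
    apply: Wbal => //; rewrite magM mag_emb ger0_norm ?invr_ge0 ?(ltW ma) //.
    by rewrite mulVf // gt_eqF.
split; first split=> //.
  apply: filterS (nbhs0_scalel (emb 2) W0) => x /= Wx.
  apply: (@le_lt_trans _ _ (2^-1)); last by lra.
  by apply: gle; [lra|rewrite invrK].
move=> x /glt[t [t0 Wt] t1].
have := Wbal (emb t) _ _ Wt; rewrite scalerA -embM mulfV ?gt_eqF // emb1 scale1r.
by apply; rewrite mag_emb ger0_norm ltW.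
Qed.

Lemma convex_setP E (A : set E) : convex_set A ->
  forall t x y, 0 <= t <= 1 -> A x -> A y -> A (emb t *: x + emb (1 - t) *: y).
Proof.
move=> Ac t x y /andP[t0 t1] Ax Ay.
have et0 : 0 <= emb t by rewrite -(emb0 R c) ler_emb.
have et1 : emb t <= 1 by rewrite -(emb1 R c) ler_emb.
have := Ac x y (Itv01 et0 et1) (mem_set Ax) (mem_set Ay).
by rewrite inE embB emb1.
Qed.

Lemma seminorm_ball_convex E (p : E -> R) x e : real_seminorm p ->
  convex_set ([set y | p (y - x) < e] : set E).
Proof.
move=> ps y z l; rewrite !inE /= => py pz.
have [l0 l1] : 0 <= (l%:num : k) /\ (l%:num : k) <= 1 by [].
have lE := emb_mag l0; set t := mag (l%:num : k) in lE.
have t0 : 0 <= t by exact: mag_ge0.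
have t1 : t <= 1 by rewrite -(ler_emb c) lE emb1.
change (p ((l%:num : k) *: y + (1 - (l%:num : k)) *: z - x) < e).
have -> : (l%:num : k) *: y + (1 - (l%:num : k)) *: z - x =
    emb t *: (y - x) + emb (1 - t) *: (z - x).
  by rewrite embB emb1 lE !scalerBr addrACA -opprD -scalerDl [l%:num + _]addrC subrK scale1r.
apply: le_lt_trans (rsn_D _ _ ps) _; rewrite !(rsn_Z _ _ ps) !mag_emb !ger0_norm ?subr_ge0 //.
have [t00|tn0] := eqVneq t 0; first by rewrite t00 mul0r add0r subr0 mul1r.
have tp : 0 < t by rewrite lt_neqAle eq_sym tn0.
have -> : e = t * e + (1 - t) * e by lra.
by apply: ltr_leD; rewrite ?ltr_pM2l // ler_wpM2l ?subr_ge0 // ltW.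
Qed.

Lemma locally_convexP E : locally_convex_tvs E <-> locally_seminormed E.
Proof.
split=> [[B Bconv [Bopen Bbase]] U U0|lcE].
  have [C [BC C0] CU] := Bbase 0 _ U0.
  have Cn : nbhs (0 : E) C by apply: open_nbhs_nbhs; split=> //; exact: Bopen.
  have Cc := convex_setP (Bconv _ (mem_set BC)).
  (* The balanced core of [C]: it stays convex, and it stays a neighbourhood by continuity of scalar
     multiplication at the origin. Its gauge is the required seminorm. *)
  pose W := [set x : E | forall a : k, mag a <= 1 -> C (a *: x)].
  have Wn : nbhs (0 : E) W.
    have [D D0 [e /emb_gt0[e0 eE] DC]] := nbhs0_scale Cn.
    apply: filterS (nbhs0_scalel (emb (2 / mag e)) D0) => x /= Dx a a1.
    have -> : a *: x = (a * emb (mag e / 2)) *: (emb (2 / mag e) *: x).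
      rewrite scalerA -mulrA -embM; have -> : mag e / 2 * (2 / mag e) = 1.
        by field; rewrite gt_eqF.
      by rewrite emb1 mulr1.
    apply: DC => //; rewrite -[ltRHS]eE normE ltr_emb magM mag_emb ger0_norm; last by lra.
    apply: (@le_lt_trans _ _ (1 * (mag e / 2))); last by lra.
    by rewrite ler_wpM2r //; lra.
  have [] := gauge_seminorm Wn.
  - move=> a x a1 Wx b b1; rewrite scalerA; apply: Wx.
    by rewrite magM -[1]mulr1 ler_pM ?mag_ge0.
  - move=> t x y t01 Wx Wy a a1; rewrite scalerDr !scalerA ![a * _]mulrC -!scalerA.
    by apply: Cc => //; [exact: Wx|exact: Wy].
  move=> gc gW; exists (gauge W) => // x /gW Wx; apply: CU.
  by have := Wx 1; rewrite mag1 scale1r; apply.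
exists [set A | exists x (p : E -> R) e, cont_seminorm p /\ A = [set y | p (y - x) < e]].
  by move=> b; rewrite inE => -[x [p [e [[ps _] ->]]]]; exact: seminorm_ball_convex.
split.
  move=> _ [x [p [e [pc ->]]]]; rewrite openE => y /= ye; apply/nbhs_translate.
  have h : 0 < e - p (y - x) by rewrite subr_gt0.
  apply: filterS (csn_nbhs pc h) => z /= pz; rewrite -[y + z - x]addrAC.
  by have := rsn_D (y - x) z (proj1 pc); lra.
move=> x A /nbhs_translate/lcE[p pc pA].
exists [set y | p (y - x) < 1].
  by split; [exists x, p, 1|rewrite /= subrr (rsn_0 (proj1 pc))].
by move=> y /pA /=; rewrite addrC subrK.
Qed.

Lemma csn_sum E (p : nat -> E -> R) n : (forall i, cont_seminorm (p i)) ->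
  cont_seminorm (fun x => \sum_(i < n) p i x).
Proof.
move=> pc; elim: n => [|n IH].
  have -> : (fun x => \sum_(i < 0) p i x) = fun=> 0.
    by apply/funext => x; rewrite big_ord0.
  split; last by apply: filterE => x /=.
  by split=> [x|x y|a x] //; rewrite ?addr0 ?mulr0.
have -> : (fun x => \sum_(i < n.+1) p i x) = fun x => \sum_(i < n) p i x + p n x.
  by apply/funext => x; rewrite big_ord_recr.
exact: csn_add.
Qed.

(** The unit balls themselves form a base, so multiples of a seminorm have to be listed in the
    family. *)
Definition countably_seminormed E := exists p : nat -> E -> R,
  (forall n, cont_seminorm (p n)) /\
  forall U, nbhs (0 : E) U -> exists n, [set x | p n x < 1] `<=` U.

Lemma metrizableP E : locally_convex_tvs E ->
  (metrizable E <-> separated E /\ countably_seminormed E).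
Proof.
move=> /locally_convexP lcE; split.
  move=> [d [d0 dC dT dnb]]; split.
    move=> x hx; apply/esym/d0/eqP; rewrite eq_le; apply/andP; split.
      apply/ler_addgt0Pr => e e0; rewrite add0r ltW //.
      by apply: (hx [set y | d 0 y < e]); apply/dnb; exists e.
    have := dT 0 x 0; rewrite (dC x 0) (proj2 (d0 0 0)) //; lra.
  have h n : exists p : E -> R, cont_seminorm p /\ [set x | p x < 1] `<=` [set y | d 0 y < n.+1%:R^-1].
    have [|p pc pU] := lcE [set y | d 0 y < n.+1%:R^-1]; last by exists p.
    by apply/dnb; exists n.+1%:R^-1; rewrite ?invr_gt0.
  have [p pP] := choice h; exists p; split=> [n|U /dnb[e e0 eU]]; first by have [] := pP n.
  exists (Num.truncn e^-1); have [_ pU] := pP (Num.truncn e^-1).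
  apply: subset_trans pU _; apply: subset_trans eU => y /= /lt_trans; apply.
  by rewrite invf_plt ?posrE // truncnS_gt.
move=> [sE [p [pc pb]]].
(* The metric is the supremum over [n] of these capped seminorms. The caps leave only finitely many
   terms above a given [e], so the supremum keeps the topology, and capping preserves the triangle
   inequality. *)
pose f n (x : E) := Num.min (p n x) n.+1%:R^-1.
pose S x := [set f n x | n in [set: nat]].
have n0 n : 0 < n.+1%:R^-1 :> R by rewrite invr_gt0.
have pge n x : 0 <= p n x by apply: rsn_ge0; case: (pc n).
have Sub x : has_sup (S x).
  split; first by exists (f 0%N x), 0%N.
  exists 1 => _ [n _ <-]; rewrite ge_min; apply/orP; right.
  by rewrite invf_le1 // ler1n.
have fS n x : f n x <= sup (S x) by apply: sup_upper_bound => //; exists n.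
have Sle x t : (forall n, f n x <= t) -> sup (S x) <= t.
  by move=> h; apply: ge_sup; [exists (f 0%N x), 0%N|move=> _ [n _ <-]].
exists (fun x y => sup (S (x - y))); split.
- move=> x y; split=> [s0|->].
    apply/eqP; rewrite -subr_eq0; apply/eqP/sE => U /pb[n]; apply => /=.
    have := fS n (x - y); rewrite s0 ge_min => /orP[h|]; first exact: le_lt_trans h ltr01.
    by rewrite leNgt n0.
  apply/eqP; rewrite eq_le; apply/andP; split.
    by apply: Sle => n; rewrite subrr /f (rsn_0 (proj1 (pc n))) ge_min lexx.
  apply: le_trans (fS 0%N (y - y)).
  by rewrite le_min pge ltW.
- move=> x y; congr sup; congr image; apply/funext => n.
  by rewrite /f (rsn_subC _ _ (proj1 (pc n))).
- move=> x y z; apply: Sle => n.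
  apply: le_trans (lerD (fS n (x - y)) (fS n (y - z))).
  have h := rsn_tri y x z (proj1 (pc n)); have h1 := pge n (x - y); have h2 := pge n (y - z).
  have := n0 n; rewrite /f; move: (n.+1%:R^-1) => t h3; case: (leP (p n (x - z))) => A1; case: (leP (p n (x - y))) => A2;
    case: (leP (p n (y - z))) => A3; lra.
- move=> x A; split.
    move/nbhs_translate/pb => [n nA]; exists n.+1%:R^-1 => // y /= h.
    have := le_lt_trans (fS n _) h; rewrite gt_min ltxx orbF => hp.
    rewrite -[y](subrK x) addrC; apply: nA => /=.
    rewrite (rsn_subC _ _ (proj1 (pc n))); apply: lt_le_trans hp _.
    by rewrite invf_le1 // ler1n.
  move=> [e e0 eA]; have e2 : 0 < e / 2 by rewrite divr_gt0.
  (* From index [N] on the caps are at most [e / 2]; the earlier seminorms are bounded together by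
     their sum. *)
  apply/nbhs_translate; pose N := Num.truncn (e / 2)^-1.
  apply: filterS (csn_nbhs (csn_sum N pc) e2) => y /= hy; apply: eA => /=.
  apply: (@le_lt_trans _ _ (e / 2)); last by lra.
  apply: Sle => n; rewrite ge_min opprD addrA subrr add0r (rsn_N _ (proj1 (pc n))).
  have [nN|Nn] := ltnP n N; apply/orP.
    left; apply: le_trans (ltW hy).
    rewrite (bigD1 (Ordinal nN)) //= lerDl sumr_ge0 // => i _; exact: pge.
  right; rewrite invf_ple ?posrE // ltW //.
  apply: lt_le_trans (truncnS_gt _) _; rewrite ler_nat ltnS //.
Qed.

End LocallyConvex.

(** * Completeness of subspaces, products and quotients *)

Section Completeness.
Variables (R : realType) (c : scalar_kind).
Local Notation k := (scalar_field R c).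
Implicit Types E F P Q : topologicalLmodType k.

Lemma complete_tvsP E : complete_tvs E <-> forall F : set_system E, ProperFilter F ->
  (forall U, nbhs (0 : E) U -> exists2 A, F A & forall x y, A x -> A y -> U (x - y)) ->
  exists x, forall U, nbhs (0 : E) U -> F [set y | U (y - x)].
Proof.
split=> h F FF Fc.
  have [|x Fx] := h F FF.
    by move=> U /Fc[A FA AU]; exists (A, A) => // -[x y] /= [Ax Ay]; exact: AU.
  exists x => U U0; apply: Fx; apply/nbhs_translate.
  by apply: filterS U0 => y /=; rewrite addrC addKr.
have [|x Fx] := h F FF.
  move=> U U0; have [[A B] /= [FA FB] AB] := Fc _ U0.
  exists (A `&` B); first exact: filterI.
  by move=> x y [Ax _] [_ By]; exact: (AB (x, y)).
exists x => U /nbhs_translate/Fx; apply: filterS => y /=.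
by rewrite addrC subrK.
Qed.

Definition tvs_cauchy E (u : nat -> E) := forall U, nbhs (0 : E) U ->
  exists N, forall m n, (N <= m)%N -> (N <= n)%N -> U (u m - u n).

Definition tvs_lim E (u : nat -> E) (l : E) := forall U, nbhs (0 : E) U ->
  exists N, forall n, (N <= n)%N -> U (u n - l).

Lemma complete_seq E (u : nat -> E) : complete_tvs E -> tvs_cauchy u ->
  exists l, tvs_lim u l.
Proof.
move=> /complete_tvsP/(_ (u @ \oo) _) cE cu; have [|l lu] := cE.
  move=> U /cu[N NU]; exists [set u n | n in [set n | (N <= n)%N]].
    by exists N => // n /= Nn; exists n.
  by move=> _ _ [m /= Nm <-] [n /= Nn <-]; exact: NU.
by exists l => U /lu[N _ NU]; exists N => n Nn; exact: NU.
Qed.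

(** A Cauchy filter is followed by a sequence [u] chosen in a decreasing family [B n] of its
    members, where [B n] has diameter below 1 for [p n]; a limit of [u] is a limit of the filter. *)
Lemma seq_complete E : countably_seminormed E ->
  (forall u : nat -> E, tvs_cauchy u -> exists l, tvs_lim u l) -> complete_tvs E.
Proof.
move=> [p [pc pb]] sE; apply/complete_tvsP => F FF Fc.
have h n : exists A, F A /\ forall x y, A x -> A y -> p n (x - y) < 1.
  by have [A FA AU] := Fc _ (proj2 (pc n)); exists A.
have [A AP] := choice h.
pose B n := \bigcap_(i in [set i | (i <= n)%N]) A i.
have FB n : F (B n).
  elim: n => [|n IH].
    by apply: filterS (proj1 (AP 0%N)) => x Ax i /=; rewrite leqn0 => /eqP ->.
  apply: filterS (filterI IH (proj1 (AP n.+1))) => x [Bx Ax] i /=.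
  by rewrite leq_eqVlt ltnS => /orP[/eqP ->|/Bx].
have [u uB] := choice (fun n => filter_ex (FB n)).
have [|l lu] := sE u.
  move=> U /pb[n nU]; exists n => m m' nm nm'; apply: nU.
  by apply: (proj2 (AP n)); [exact: (uB m)|exact: (uB m')].
exists l => U /nbhs0_add[V V0 VU]; have [n nV] := pb _ V0; have [N NV] := lu _ V0.
apply: filterS (FB n) => y By /=; pose m := maxn n N.
rewrite -(subrKA (u m)); apply: VU; last by apply: NV; exact: leq_maxr.
apply: nV; apply: (proj2 (AP n)); first exact: (By n (leqnn n)).
by apply: (uB m); exact: leq_maxl.
Qed.

Lemma complete_embedding E F (i : clin E F) : embedding i -> is_closed (range i) ->
  complete_tvs F -> complete_tvs E.
Proof.
move=> [_ iemb] icl /complete_tvsP cF; apply/complete_tvsP => G GG Gc.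
have [|y Gy] := cF (i @ G) _.
  move=> U /(clin_nbhs0 i)/Gc[A GA AU]; exists (i @` A).
    by change (G (i @^-1` (i @` A))); apply: filterS GA => x Ax; exists x.
  by move=> _ _ [x Ax <-] [z Az <-]; rewrite -clin_B; exact: AU.
have [x _ xy] : range i y.
  apply: icl => U /nbhs0_opp/Gy GU; have [x /= Ux] := @filter_ex _ G _ _ GU.
  exists (i x); first by exists x.
  by rewrite -opprB.
exists x => U /iemb[B /Gy GB BU]; change (G [set z | B (i z - y)]) in GB.
apply: filterS GB => z /= Bz.
by apply: BU; rewrite clin_B xy.
Qed.

Lemma complete_product E F P (p1 : clin P E) (p2 : clin P F) : is_product p1 p2 ->
  complete_tvs E -> complete_tvs F -> complete_tvs P.
Proof.
move=> [surj nb] /complete_tvsP cE /complete_tvsP cF; apply/complete_tvsP => G GG Gc.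
have im Q (f : clin P Q) U : nbhs (0 : Q) U ->
    exists2 A, (f @ G) A & forall x y, A x -> A y -> U (x - y).
  move=> /(clin_nbhs0 f)/Gc[A GA AU]; exists (f @` A).
    by change (G (f @^-1` (f @` A))); apply: filterS GA => x Ax; exists x.
  by move=> _ _ [x Ax <-] [z Az <-]; rewrite -clin_B; exact: AU.
have [x Gx] := cE (p1 @ G) _ (im _ p1); have [y Gy] := cF (p2 @ G) _ (im _ p2).
have [z [zx zy]] := surj x y; exists z => U /nb[B1 [B2 [/Gx G1 /Gy G2 BU]]].
change (G [set w | B1 (p1 w - x)]) in G1; change (G [set w | B2 (p2 w - y)]) in G2.
apply: filterS (filterI G1 G2) => w [/= h1 h2].
by apply: BU; rewrite clin_B ?zx ?zy.
Qed.

Lemma cs_monotone E : countably_seminormed E -> exists p : nat -> E -> R,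
  [/\ forall n, cont_seminorm (p n), forall n x, p n x <= p n.+1 x &
    forall U, nbhs (0 : E) U -> exists n, [set x | p n x < 1] `<=` U].
Proof.
move=> [p [pc pb]]; have p0 n x : 0 <= p n x by apply: rsn_ge0; case: (pc n).
exists (fun n x => \sum_(i < n.+1) p i x); split.
- by move=> n; exact: csn_sum.
- by move=> n x; rewrite [leRHS]big_ord_recr /= lerDl.
- move=> U /pb[n nU]; exists n => x /= h; apply: nU => /=.
  by apply: le_lt_trans h; rewrite big_ord_recr /= lerDr sumr_ge0.
Qed.

Lemma cs_embedding E F (i : clin E F) : embedding i ->
  countably_seminormed F -> countably_seminormed E.
Proof.
move=> [_ iemb] [p [pc pb]]; exists (fun n x => p n (i x)); split.
  by move=> n; exact: csn_comp.
by move=> U /iemb[B /pb[n nB] BU]; exists n => x /nB/BU.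
Qed.

Lemma cs_product E F P (p1 : clin P E) (p2 : clin P F) : is_product p1 p2 ->
  countably_seminormed E -> countably_seminormed F -> countably_seminormed P.
Proof.
move=> [_ nb] /cs_monotone[p [pc pm pb]] /cs_monotone[q [qc qm qb]].
exists (fun n z => p n (p1 z) + q n (p2 z)); split.
  by move=> n; apply: csn_add; exact: csn_comp.
have mono (G : topologicalLmodType k) (r : nat -> G -> R) (rm : forall n x, r n x <= r n.+1 x) x :
    forall m n, (m <= n)%N -> r m x <= r n x.
  by move=> m n /subnK <-; elim: (n - m)%N => [|d IH] //; apply: le_trans IH (rm _ _).
move=> U /nb[B1 [B2 [/pb[n nB] /qb[m mB] BU]]]; exists (maxn n m) => z /= h.
have h1 := mono _ _ pm (p1 z) _ _ (leq_maxl n m).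
have h2 := mono _ _ qm (p2 z) _ _ (leq_maxr n m).
have h3 := rsn_ge0 (p1 z) (proj1 (pc (maxn n m))).
have h4 := rsn_ge0 (p2 z) (proj1 (qc (maxn n m))).
by apply: BU; [apply: nB|apply: mB] => /=; lra.
Qed.

Lemma cs_quotient E Q (f : clin E Q) : open_surjection f ->
  countably_seminormed E -> countably_seminormed Q.
Proof.
move=> fo [p [pc pb]]; exists (fun n => quotient_seminorm f (p n)); split.
  by move=> n; exact: csn_quotient.
move=> U /(clin_nbhs0 f)/pb[n nU]; exists n => y /= /(qsn_lt (proj1 fo))[x <-].
exact: nU.
Qed.

Lemma ls_embedding E F (i : clin E F) : embedding i ->
  locally_seminormed F -> locally_seminormed E.
Proof.
move=> [_ iemb] lF U /iemb[B /lF[p pc pB] BU]; exists (fun x => p (i x)).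
  exact: csn_comp.
by move=> x /pB/BU.
Qed.

Lemma ls_product E F P (p1 : clin P E) (p2 : clin P F) : is_product p1 p2 ->
  locally_seminormed E -> locally_seminormed F -> locally_seminormed P.
Proof.
move=> [_ nb] lE lF U /nb[B1 [B2 [/lE[p pc pB] /lF[q qc qB] BU]]].
exists (fun z => p (p1 z) + q (p2 z)); first by apply: csn_add; exact: csn_comp.
move=> z /= h; have h3 := rsn_ge0 (p1 z) (proj1 pc); have h4 := rsn_ge0 (p2 z) (proj1 qc).
by apply: BU; [apply: pB|apply: qB] => /=; lra.
Qed.

Lemma ls_quotient E Q (f : clin E Q) : open_surjection f ->
  locally_seminormed E -> locally_seminormed Q.
Proof.
move=> fo lE U /(clin_nbhs0 f)/lE[p pc pU]; exists (quotient_seminorm f p).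
  exact: csn_quotient.
by move=> y /= /(qsn_lt (proj1 fo))[x <-]; exact: pU.
Qed.

(** A subsequence has consecutive differences that lift to vectors [u n] with [p n (u n) < 2^-n];
    their partial sums converge in [E], and the image of the limit is the limit. Passing to such a
    subsequence is where the countable family of seminorms enters. *)
Lemma complete_quotient E Q (f : clin E Q) : open_surjection f ->
  countably_seminormed E -> complete_tvs E -> complete_tvs Q.
Proof.
move=> fo csE cE; apply: seq_complete; first exact: (cs_quotient fo csE).
have [p [pc pm pb]] := cs_monotone csE => z zc.
have pge n x : 0 <= p n x by apply: rsn_ge0; case: (pc n).
have mono x m n : (m <= n)%N -> p m x <= p n x.
  by move=> /subnK <-; elim: (n - m)%N => [|d IH] //; apply: le_trans IH (pm _ _).
have half0 n : 0 < 2^-1 ^+ n :> R by apply: exprn_gt0; lra.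
have h n : exists N, forall i j, (N <= i)%N -> (N <= j)%N ->
    exists u, f u = z i - z j /\ p n u < 2^-1 ^+ n.
  have [N NP] := zc _ (proj2 fo _ (csn_nbhs (pc n) (half0 n))).
  by exists N => i j Ni Nj; have [u /= pu fu] := NP i j Ni Nj; exists u.
have [N NP] := choice h.
(* The successors make [s] strictly increasing, and [s n] and [s n.+1] both exceed [N n], so their
   terms may be compared through [NP n]. *)
pose s n := (\sum_(i < n.+1) (N i).+1)%N.
have sS n : s n.+1 = (s n + (N n.+1).+1)%N by rewrite /s big_ord_recr.
have Ns n : (N n <= s n)%N by rewrite /s big_ord_recr /= addnS leqW // leq_addl.
have Ns1 n : (N n <= s n.+1)%N by rewrite sS (leq_trans (Ns n)) // leq_addr.
have sge n : (n <= s n)%N.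
  by elim: n => [|n IH] //; rewrite sS addnS ltnS (leq_trans IH) // leq_addr.
have [u uP] := choice (fun n => NP n _ _ (Ns1 n) (Ns n)).
have [x0 x0E] := proj1 fo (z (s 0%N)).
pose x n := x0 + \sum_(i < n) u i.
have xS n : x n.+1 = x n + u n by rewrite /x big_ord_recr addrA.
have fx n : f (x n) = z (s n).
  elim: n => [|n IH]; first by rewrite /x big_ord0 addr0.
  by rewrite xS clin_D IH (proj1 (uP n)) addrC subrK.
(* The right side is the sum of [2^-i] for [n <= i < n + d], kept exact so that the induction
   closes. *)
have xbound j n d : (j <= n)%N -> p j (x (n + d)%N - x n) <= 2 * 2^-1 ^+ n - 2 * 2^-1 ^+ (n + d).
  move=> jn; elim: d => [|d IH].
    by rewrite addn0 !subrr (rsn_0 (proj1 (pc j))).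
  rewrite addnS xS addrAC; apply: le_trans (rsn_D _ _ (proj1 (pc j))) _.
  have h1 := mono (u (n + d)%N) _ _ (leq_trans jn (leq_addr d n)).
  have h2 := proj2 (uP (n + d)%N).
  rewrite exprS; lra.
have xc : tvs_cauchy x.
  move=> U /pb[j jU].
  have [M MP] : exists M, 4 * 2^-1 ^+ M < 1 :> R by exists 3%N; rewrite !exprS expr0; lra.
  exists (maxn j M) => m n mj nj; apply: jU => /=.
  have key i : (maxn j M <= i)%N -> p j (x i - x (maxn j M)) <= 2 * 2^-1 ^+ M.
    move=> /subnKC <-; apply: le_trans (xbound _ _ _ (leq_maxl _ _)) _.
    have h1 := half0 (maxn j M + (i - maxn j M))%N.
    have h2 : 2^-1 ^+ (maxn j M) <= 2^-1 ^+ M :> R.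
      by apply: ler_wiXn2l; rewrite ?leq_maxr //; lra.
    lra.
  have h1 := key _ mj; have h2 := key _ nj.
  have h3 := rsn_tri (x m) (x (maxn j M)) (x n) (proj1 (pc j)).
  have h4 := rsn_tri (x (maxn j M)) (x m) (x n) (proj1 (pc j)).
  rewrite (rsn_subC (x (maxn j M)) _ (proj1 (pc j))) in h4; lra.
have [l lP] := complete_seq cE xc; exists (f l) => U /nbhs0_add[V V0 VU].
have [M1 h1] := zc _ V0; have [M2 h2] := lP _ (clin_nbhs0 f V0).
exists M1 => n M1n.
pose m := maxn M1 M2; rewrite -(subrKA (z (s m))); apply: VU.
  by apply: h1 => //; apply: leq_trans (sge m); exact: leq_maxl.
by rewrite -fx -clin_B; apply: h2; exact: leq_maxr.
Qed.

End Completeness.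

(** * Products, subspaces and quotients, and properties that they preserve *)

Section Constructions.
Variable k : numFieldType.
Implicit Types E F G Q : topologicalLmodType k.

(** The initial topology of two maps serves both constructions: subspaces with [f = g] the
    inclusion, products with the two projections. *)
Lemma initial_tvs E F (V : lmodType k) (f : {linear V -> E}) (g : {linear V -> F}) :
  exists (G : topologicalLmodType k) (j : {linear V -> G}), bijective j /\
    forall A, nbhs (0 : G) A <-> exists B1 B2, [/\ nbhs (0 : E) B1, nbhs (0 : F) B2
      & forall v, B1 (f v) -> B2 (g v) -> A (j v)].
Proof.
pose N := [set A : set V | exists B1 B2, [/\ nbhs (0 : E) B1, nbhs (0 : F) B2
  & forall v, B1 (f v) -> B2 (g v) -> A v]].
have axN : zero_nbhs_axioms N.
  split.
  - split.
    + by exists setT, setT; split=> //; exact: filter_nbhsT.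
    + move=> A B [A1 [A2 [A10 A20 hA]]] [B1 [B2 [B10 B20 hB]]].
      exists (A1 `&` B1), (A2 `&` B2); split; [exact: filterI|exact: filterI|].
      by move=> v [A1v B1v] [A2v B2v]; split; [exact: hA|exact: hB].
    + move=> A B AB [B1 [B2 [B10 B20 hB]]]; exists B1, B2; split=> // v h1 h2.
      by apply: AB; exact: hB.
  - move=> A [B1 [B2 [B10 B20]]]; apply; rewrite linear0; exact: nbhs_singleton.
  - move=> A [B1 [B2 [/nbhs0_add[C1 C10 CB1] /nbhs0_add[C2 C20 CB2] hA]]].
    exists [set v | C1 (f v) /\ C2 (g v)]; first by exists C1, C2.
    by move=> x y [x1 x2] [y1 y2]; apply: hA; rewrite linearD; [exact: CB1|exact: CB2].
  - move=> A [B1 [B2 [/nbhs0_scale[C1 C10 [e e0 CB1]] /nbhs0_scale[C2 C20 [d d0 CB2]] hA]]].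
    exists [set v | C1 (f v) /\ C2 (g v)]; first by exists C1, C2.
    (* The order of [k] is not total, so this expression replaces the minimum of [e] and [d] as a
       positive lower bound of both. *)
    have h : 0 < (e^-1 + d^-1)^-1 by rewrite invr_gt0 addr_gt0 // invr_gt0.
    exists (e^-1 + d^-1)^-1 => // a x ax [x1 x2].
    have le : (e^-1 + d^-1)^-1 <= e.
      by rewrite invf_ple ?posrE ?addr_gt0 ?invr_gt0 // lerDl invr_ge0 ltW.
    have ld : (e^-1 + d^-1)^-1 <= d.
      by rewrite invf_ple ?posrE ?addr_gt0 ?invr_gt0 // lerDr invr_ge0 ltW.
    apply: hA; rewrite linearZ /=; [apply: CB1|apply: CB2] => //.
      exact: lt_le_trans le.
    exact: lt_le_trans ld.
  - move=> A x [B1 [B2 [B10 B20 hA]]].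
    have [e e0 CB1] := nbhs0_absorb (f x) B10; have [d d0 CB2] := nbhs0_absorb (g x) B20.
    have h : 0 < (e^-1 + d^-1)^-1 by rewrite invr_gt0 addr_gt0 // invr_gt0.
    exists (e^-1 + d^-1)^-1 => // a ax.
    have le : (e^-1 + d^-1)^-1 <= e.
      by rewrite invf_ple ?posrE ?addr_gt0 ?invr_gt0 // lerDl invr_ge0 ltW.
    have ld : (e^-1 + d^-1)^-1 <= d.
      by rewrite invf_ple ?posrE ?addr_gt0 ?invr_gt0 // lerDr invr_ge0 ltW.
    apply: hA; rewrite linearZ /=; [apply: CB1|apply: CB2].
      exact: lt_le_trans le.
    exact: lt_le_trans ld.
  - move=> A a [B1 [B2 [B10 B20 hA]]].
    exists [set x | B1 (a *: x)], [set x | B2 (a *: x)].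
    by split; [exact: nbhs0_scalel|exact: nbhs0_scalel|move=> v h1 h2; apply: hA; rewrite linearZ].
have [G [j [jbij nb]]] := exists_tvs axN.
by exists G, j; split=> // A; apply: iff_trans (nb A) _.
Qed.

Lemma exists_sub E (S : set E) : is_submod S ->
  exists F (i : clin F E), embedding i /\ range i = S.
Proof.
move=> /sub_lmodule[W [j [jinj jS]]]; have [F [h [[h' h'K hK] nb]]] := initial_tvs j j.
have il : linear (j \o h').
  move=> a x y /=; rewrite -linearP; congr (j _).
  by apply: (can_inj h'K); rewrite linearP !hK.
have ic A : nbhs (0 : E) A -> nbhs (0 : F) ((j \o h') @^-1` A).
  by move=> A0; apply/nb; exists A, A; split=> // v Av _ /=; rewrite h'K.
have [i iE] := clin_intro il ic; exists F, i; split; last first.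
  rewrite -jS; apply/seteqP; split=> [_ [x _ <-]|_ [x _ <-]].
    by rewrite iE; exists (h' x).
  by exists (h x) => //; rewrite iE /= h'K.
split=> [x y|A /nb[B1 [B2 [B10 B20 hB]]]].
  by rewrite !iE /= => /jinj; apply: (can_inj hK).
exists (B1 `&` B2); first exact: filterI.
by move=> x; rewrite iE /= -{3}[x]hK => -[]; exact: hB.
Qed.

Lemma exists_product E F : separated E -> separated F ->
  exists P (p1 : clin P E) (p2 : clin P F), is_product p1 p2 /\ separated P.
Proof.
move=> sE sF.
have [P [h [[h' h'K hK] nb]]] := initial_tvs (fst : {linear (E * F)%type -> E}) (snd : {linear (E * F)%type -> F}).
have h'l : linear h'.
  by move=> a x y /=; apply: (can_inj h'K); rewrite linearP !hK.
have [p1 p1E] : exists p1 : clin P E, forall x, p1 x = (h' x).1.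
  apply: clin_intro => [a x y|A A0]; first by rewrite h'l.
  by apply/nb; exists A, setT; split=> //; [exact: filter_nbhsT|move=> v Av _ /=; rewrite h'K].
have [p2 p2E] : exists p2 : clin P F, forall x, p2 x = (h' x).2.
  apply: clin_intro => [a x y|A A0]; first by rewrite h'l.
  by apply/nb; exists setT, A; split=> //; [exact: filter_nbhsT|move=> v _ Av /=; rewrite h'K].
exists P, p1, p2; split; first split=> [x y|A /nb[B1 [B2 [B10 B20 hB]]]].
- by exists (h (x, y)); rewrite p1E p2E h'K.
- by exists B1, B2; split=> // z; rewrite p1E p2E -{3}[z]hK; exact: hB.
- move=> z hz; rewrite -[z]hK; have -> : h' z = 0; last by rewrite linear0.
  have -> : h' z = (p1 z, p2 z) by rewrite p1E p2E; case: (h' z).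
  have -> : p1 z = 0 by apply: sE => A /(clin_nbhs0 p1)/hz.
  by have -> : p2 z = 0 by apply: sF => A /(clin_nbhs0 p2)/hz.
Qed.

Lemma exists_quotient E (S : set E) : is_submod S -> is_closed S ->
  exists Q (p : clin E Q), [/\ open_surjection p, forall x, p x = 0 <-> S x & separated Q].
Proof.
move=> subS clS; have [Q0 [p0 [psurj pker]]] := quotient_lmodule subS.
pose N := [set A : set Q0 | nbhs (0 : E) (p0 @^-1` A)].
have axN : zero_nbhs_axioms N.
  have imN B : nbhs (0 : E) B -> N (p0 @` B).
    by move=> B0; apply: (filterS (P := B)) => // x Bx; exists x.
  split.
  - split.
    + by rewrite /N /= preimage_setT; exact: filter_nbhsT.
    + by move=> A B NA NB; rewrite /N /= preimage_setI; exact: filterI.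
    + by move=> A B AB; apply: filterS => x; exact: AB.
  - by move=> A /nbhs_singleton /=; rewrite linear0.
  - move=> A /nbhs0_add[B B0 BA]; exists (p0 @` B); first exact: imN.
    by move=> _ _ [x Bx <-] [y By <-]; rewrite -linearD; exact: BA.
  - move=> A /nbhs0_scale[B B0 [e e0 BA]]; exists (p0 @` B); first exact: imN.
    by exists e => // a _ ae [x Bx <-]; rewrite -linearZ; exact: BA.
  - move=> A y; have [x <-] := psurj y => /(nbhs0_absorb x)[e e0 eA].
    by exists e => // a ae; rewrite -linearZ; exact: eA.
  - move=> A a /(nbhs0_scalel a); apply: filterS => x /=.
    by rewrite linearZ.
have [Q [j [[j' j'K jK] nb]]] := exists_tvs axN.
have [p pE] : exists p : clin E Q, forall x, p x = j (p0 x).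
  apply: clin_intro => [a x y|A /nb //]; by rewrite !linearP.
have pk x : p x = 0 <-> S x.
  rewrite pE; split=> [|/pker ->]; last by rewrite linear0.
  by rewrite -(linear0 j) => /(can_inj j'K)/pker.
have po : open_surjection p.
  split=> [y|A A0].
    by have [x xE] := psurj (j' y); exists x; rewrite pE xE jK.
  apply/nb; apply: (filterS (P := A)) => // x Ax; exists x => //; exact: pE.
exists Q, p; split=> // y hy; have [x xE] := proj1 po y; rewrite -xE.
apply/pk/clS => A A0; have : (p @` A) y by apply: hy; exact: (proj2 po).
move=> [z Az zE]; exists (x - z); last by rewrite subKr.
by apply/pk; rewrite clin_B xE zE subrr.
Qed.

Lemma separated_embedding E F (i : clin E F) : embedding i -> separated F -> separated E.
Proof.
move=> [inj _] sF x hx; apply: inj; rewrite clin_0; apply: sF => A /(clin_nbhs0 i).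
exact: hx.
Qed.

(** Arbitrary closed embeddings and open surjections, in place of chosen subspaces and quotients,
    make invariance under isomorphism part of the definition. *)
Record permanent (P : topologicalLmodType k -> Prop) : Prop := Permanent {
  perm_sep : forall E, P E -> separated E;
  perm_prod : forall E F G (p1 : clin G E) (p2 : clin G F), is_product p1 p2 ->
    separated G -> P E -> P F -> P G;
  perm_sub : forall E F (i : clin E F), embedding i -> is_closed (range i) -> P F -> P E;
  perm_quot : forall E Q (p : clin E Q), open_surjection p -> separated Q -> P E -> P Q }.

(** By the last hypothesis [P] only has to describe the objects up to isomorphism, while [U] may
    come from objects with more structure, such as a norm. *)
Lemma permanent_stable (P : topologicalLmodType k -> Prop) (T : Type)
    (U : T -> topologicalLmodType k) : permanent P -> (exists E, P E) ->
  (forall t, P (U t)) ->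
  (forall E, P E -> exists t (f : clin (U t) E) (g : clin E (U t)), cancel f g /\ cancel g f) ->
  stable_class U.
Proof.
move=> [Psep Pprod Psub Pquot] [E0 PE0] PU UP; split.
- by have [t _] := UP _ PE0; exists.
- by move=> t; exact: Psep.
- move=> s t; have [G [p1 [p2 [[surj nb] sG]]]] := exists_product (Psep _ (PU s)) (Psep _ (PU t)).
  have [q [f [g [fK gK]]]] := UP _ (Pprod _ _ _ _ _ (conj surj nb) sG (PU s) (PU t)).
  exists q, (clin_comp p1 f), (clin_comp p2 f); split=> [x y|A A0].
    by have [z [z1 z2]] := surj x y; exists (g z) => /=; rewrite gK.
  have [B1 [B2 [B10 B20 BA]]] := nb _ (clin_nbhs0 g A0); exists B1, B2; split=> // z /= h1 h2.
  by rewrite -[z]fK; exact: BA.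
- move=> t S Ssub Scl; have [F [i [iemb iS]]] := exists_sub Ssub.
  have PF : P F by apply: (Psub _ _ i iemb) => //; rewrite iS.
  have [s [f [g [fK gK]]]] := UP _ PF; exists s, (clin_comp i f); split; last first.
    rewrite -iS; apply/seteqP; split=> [_ [x _ <-]|_ [x _ <-]]; first by exists (f x).
    by exists (g x) => //=; rewrite gK.
  split=> [x y /(proj1 iemb)/(can_inj fK) //|A A0].
  have [B B0 BA] := proj2 iemb _ (clin_nbhs0 g A0); exists B => // x /BA /=.
  by rewrite fK.
- move=> t S Ssub Scl; have [Q [p [po pk sQ]]] := exists_quotient Ssub Scl.
  have [q [f [g [fK gK]]]] := UP _ (Pquot _ _ _ po sQ (PU t)); exists q, (clin_comp g p).
  split; last first.
    by move=> x; rewrite -pk /= -(clin_0 g); split=> [/(can_inj gK)|->].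
  split=> [y|A A0]; first by have [x xE] := proj1 po (f y); exists x => /=; rewrite xE fK.
  apply: filterS (clin_nbhs0 f (proj2 po _ A0)) => y [x Ax xE].
  by exists x => //=; rewrite xE fK.
Qed.

Lemma permanent_full (P : topologicalLmodType k -> Prop) : permanent P ->
  (exists E, P E) -> stable_class (@proj1_sig _ P).
Proof.
move=> Pp Pex; apply: (permanent_stable Pp Pex); first by case.
by move=> E PE; exists (exist P E PE), (clin_id E), (clin_id E).
Qed.

End Constructions.

(** * Stable classes of spaces *)

Section Classes.
Variables (R : realType) (c : scalar_kind).
Local Notation k := (scalar_field R c).
Local Notation emb := (emb c).
Implicit Types E F G Q : topologicalLmodType k.

Lemma permanent_eq (P1 P2 : topologicalLmodType k -> Prop) :
  (forall E, P1 E <-> P2 E) -> permanent P1 -> permanent P2.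
Proof.
move=> e [h1 h2 h3 h4]; split.
- by move=> E /e/h1.
- by move=> E F G p1 p2 h sG /e PE /e PF; apply/e; exact: h2 h sG PE PF.
- by move=> E F i h cl /e PF; apply/e; exact: h3 h cl PF.
- by move=> E Q p h sQ /e PE; apply/e; exact: h4 h sQ PE.
Qed.

(** The quotient clause for [P2] may use [P1], as in the passage of completeness to quotients, which
    rests on countably many seminorms. *)
Lemma permanent_and (P1 P2 : topologicalLmodType k -> Prop) :
  permanent P1 -> (forall E F G (p1 : clin G E) (p2 : clin G F), is_product p1 p2 ->
    separated G -> P2 E -> P2 F -> P2 G) ->
  (forall E F (i : clin E F), embedding i -> is_closed (range i) -> P2 F -> P2 E) ->
  (forall E Q (p : clin E Q), open_surjection p -> separated Q -> P1 E -> P2 E -> P2 Q) ->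
  permanent (fun E => P1 E /\ P2 E).
Proof.
move=> [h1 h2 h3 h4] g2 g3 g4; split.
- by move=> E [/h1].
- by move=> E F G p1 p2 h sG [h5 h6] [h7 h8]; split; [exact: h2 h sG h5 h7|exact: g2 h sG h6 h8].
- by move=> E F i h cl [h5 h6]; split; [exact: h3 h cl h5|exact: g3 h cl h6].
- by move=> E Q p h sQ [h5 h6]; split; [exact: h4 h sQ h5|exact: g4 h sQ h5 h6].
Qed.

Lemma permanent_separated : permanent (@separated k).
Proof.
split=> // E F i h _ sF; exact: separated_embedding h sF.
Qed.

Lemma permanent_hausdorff : permanent (fun E => hausdorff_space E).
Proof. by apply: permanent_eq permanent_separated => E; exact: separatedP. Qed.

Lemma permanent_hausdorff_lcs : permanent (@hausdorff_lcs R c).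
Proof.
apply: (@permanent_eq (fun E => separated E /\ locally_seminormed E)).
  by move=> E; split=> -[/separatedP h1 /locally_convexP h2].
apply: permanent_and => [|E F G p1 p2 h _ h1 h2|E F i h _ h1|E Q p h _ _ h1].
- exact: permanent_separated.
- exact: ls_product h h1 h2.
- exact: ls_embedding h h1.
- exact: ls_quotient h h1.
Qed.

Lemma cs_ls E : countably_seminormed E -> locally_seminormed E.
Proof. by move=> [p [pc pb]] U /pb[n nU]; exists (p n). Qed.

Lemma frechetP E : frechet E <->
  (separated E /\ countably_seminormed E) /\ complete_tvs E.
Proof.
split=> [[cE mE lE]|[[sE csE] cE]].
  by split=> //; apply/(metrizableP lE).
have lE : locally_convex_tvs E by apply/locally_convexP/cs_ls.
by split=> //; apply/(metrizableP lE).
Qed.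

Lemma permanent_frechet : permanent (@frechet R c).
Proof.
apply: (@permanent_eq (fun E => (separated E /\ countably_seminormed E) /\ complete_tvs E)).
  by move=> E; apply: iff_sym; exact: frechetP.
apply: permanent_and => [|E F G p1 p2 h _ h1 h2|E F i h cl h1|E Q p h _ [_ h1] h2].
- apply: permanent_and => [|E F G p1 p2 h _ h1 h2|E F i h _ h1|E Q p h _ _ h1].
  + exact: permanent_separated.
  + exact: cs_product h h1 h2.
  + exact: cs_embedding h h1.
  + exact: cs_quotient h h1.
- exact: complete_product h h1 h2.
- exact: complete_embedding h cl h1.
- exact: complete_quotient h h1 h2.
Qed.

Lemma permanent_frechet_schwartz : permanent (@frechet_schwartz R c).
Proof.
apply: permanent_and => [|E F G p1 p2 [surj nb] _ h1 h2|E F i [inj iemb] _ h|E Q p h _ _ h1].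
- exact: permanent_frechet.
- move=> U /nb[B1 [B2 [/h1[V1 V10 h3] /h2[V2 V20 h4] BU]]].
  exists (p1 @^-1` V1 `&` p2 @^-1` V2); first by apply: filterI; exact: clin_nbhs0.
  move=> e e0; have [s1 s1P] := h3 e e0; have [s2 s2P] := h4 e e0.
  have [z zP] := choice (fun xy : E * F => surj xy.1 xy.2).
  exists [seq z (x, y) | x <- s1, y <- s2] => v [/= /s1P[x xs [u uB xE]] /s2P[y ys [w wB yE]]].
  exists (z (x, y)); first exact: allpairs_f.
  exists (e^-1 *: (v - z (x, y))).
    have [/= z1 z2] := zP (x, y); have en0 : e != 0 by rewrite gt_eqF.
    apply: BU; rewrite clin_Z clin_B ?z1 ?z2 ?xE ?yE addrAC subrr add0r scalerA mulVf //;
      by rewrite scale1r.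
  by rewrite scalerA mulfV ?gt_eqF // scale1r addrC subrK.
- move=> U /iemb[B0 /nbhs0_sub[B B_0 BB0] B0U]; have [V V0 h1] := h _ B_0.
  exists (i @^-1` V); first exact: clin_nbhs0.
  move=> e e0; have [s sP] := h1 e e0.
  (* The centres found in [F] need not lie in the subspace. Each is replaced by a point of the
     subspace within [e *: B] of it, if there is one; two members of [B] then differ by a member of
     [B0]. *)
  have ex x : exists y, (exists y', exists2 u, B u & i y' = x + e *: u) ->
      exists2 u, B u & i y = x + e *: u.
    have [[y' yP]|no] := pselect (exists y', exists2 u, B u & i y' = x + e *: u).
      by exists y'.
    by exists 0 => /no.
  have [y yP] := choice ex.
  exists [seq y x | x <- s] => v /= /sP[x xs [u uB xE]]; exists (y x); first exact: map_f.
  have [|w wB yE] := yP x; first by exists v, u.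
  have en0 : e != 0 by rewrite gt_eqF.
  exists (e^-1 *: (v - y x)); last by rewrite scalerA mulfV // scale1r addrC subrK.
  apply: B0U; rewrite clin_Z clin_B xE yE opprD addrACA subrr add0r -scalerBr scalerA.
  by rewrite mulVf // scale1r; exact: BB0.
- move=> U /(clin_nbhs0 p)/h1[V V0 VP]; exists (p @` V); first exact: (proj2 h).
  move=> e /VP[s sP]; exists [seq p x | x <- s] => _ [v /sP[x xs [u uU xE]] <-].
  exists (p x); first exact: map_f.
  by exists (p u) => //; rewrite xE clin_D clin_Z.
Qed.

Definition seminormable E := exists p : E -> R, cont_seminorm p /\
  forall U, nbhs (0 : E) U -> exists2 e : R, 0 < e & [set x | p x < e] `<=` U.

Lemma permanent_normable : permanent (fun E => separated E /\ seminormable E).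
Proof.
apply: permanent_and => [|E F G p1 p2 [surj nb] _ [p [pc pb]] [q [qc qb]]|E F i h _ [p [pc pb]]
  |E Q f h _ _ [p [pc pb]]].
- exact: permanent_separated.
- exists (fun z => p (p1 z) + q (p2 z)); split; first by apply: csn_add; exact: csn_comp.
  move=> U /nb[B1 [B2 [/pb[e e0 eB] /qb[d d0 dB] BU]]].
  exists (Num.min e d); first by rewrite lt_min e0.
  move=> z /=; rewrite lt_min => /andP[h1 h2].
  have h3 := rsn_ge0 (p1 z) (proj1 pc); have h4 := rsn_ge0 (p2 z) (proj1 qc).
  by apply: BU; [apply: eB|apply: dB] => /=; lra.
- exists (fun x => p (i x)); split; first exact: csn_comp.
  by move=> U /(proj2 h)[B /pb[e e0 eB] BU]; exists e => // x /= /eB/BU.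
- exists (quotient_seminorm f p); split; first exact: csn_quotient.
  move=> U /(clin_nbhs0 f)/pb[e e0 eU]; exists e => // y /= /(qsn_lt (proj1 h))[x <-].
  exact: eU.
Qed.

Lemma normed_nbhs0 (N : normedModType k) (A : set N) : nbhs (0 : N) A <->
  exists2 e : R, 0 < e & [set x | mag `|x| < e] `<=` A.
Proof.
split=> [/nbhs_ballP[e /emb_gt0[e0 eE] eA]|[e e0 eA]].
  exists (mag e) => // x /= xe; apply: eA; rewrite -ball_normE /= sub0r normrN -eE.
  by rewrite -[`|x|]emb_mag // ltr_emb.
apply/nbhs_ballP; exists (emb e); first by rewrite /= -(emb0 R c) ltr_emb.
move=> x; rewrite -ball_normE /= sub0r normrN => xe; apply: eA => /=.
by rewrite -(ltr_emb c) emb_mag.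
Qed.

Lemma norm_seminorm (N : normedModType k) : real_seminorm (fun x : N => mag `|x|).
Proof.
split=> [x|x y|a x]; first exact: mag_ge0.
  by rewrite -(ler_emb c) embD !emb_mag // ler_normD.
by rewrite normrZ magM [`|a|]normE mag_emb ger0_norm ?mag_ge0.
Qed.

Lemma normed_seminormable (N : normedModType k) : seminormable N.
Proof.
exists (fun x => mag `|x|); split; last by move=> U /normed_nbhs0.
by split; [exact: norm_seminorm|apply/normed_nbhs0; exists 1].
Qed.

Lemma normed_separated (N : normedModType k) : separated (N : topologicalLmodType k).
Proof. by apply/separatedP; exact: norm_hausdorff. Qed.

Lemma seminormable_iso E : separated E -> seminormable E ->
  exists (N : normedModType k) (f : clin N E) (g : clin E N), cancel f g /\ cancel g f.
Proof.
move=> sE [p [pc pb]]; have ps := proj1 pc.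
have [||x px|N [j [[j' jK j'K] jn]]] := @exists_normed k E (fun x => emb (p x)).
- by move=> x y; rewrite -embD ler_emb rsn_D.
- by move=> a x; rewrite (rsn_Z _ _ ps) embM normE.
- apply: sE => A /pb[e e0 eA]; apply: eA => /=.
  by have -> : p x = 0 by apply: (@emb_inj R c); rewrite emb0.
have jnR x : mag `|j x| = p x by rewrite jn mag_emb ger0_norm // rsn_ge0.
have [g gE] : exists g : clin E N, forall x, g x = j x.
  apply: clin_intro => [a x y|A /normed_nbhs0[e e0 eA]]; first exact: linearP.
  by apply: filterS (csn_nbhs pc e0) => x /= h; apply: eA; rewrite /= jnR.
have [f fE] : exists f : clin N E, forall x, f x = j' x.
  apply: clin_intro => [a x y|A /pb[e e0 eA]].
    by apply: (can_inj jK); rewrite linearP !j'K.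
  by apply/normed_nbhs0; exists e => // x /= xe; apply: eA; rewrite /= -jnR j'K.
by exists N, f, g; split=> x; rewrite fE gE.
Qed.

Lemma iso_embedding E F (f : clin E F) (g : clin F E) : cancel f g -> cancel g f ->
  embedding f /\ is_closed (range f).
Proof.
move=> fK gK; split; last by move=> y _; exists (g y).
split; first exact: can_inj fK.
by move=> A /(clin_nbhs0 g) A0; exists (g @^-1` A) => // x /=; rewrite fK.
Qed.

Lemma complete_iso E F (f : clin E F) (g : clin F E) : cancel f g -> cancel g f ->
  complete_tvs F -> complete_tvs E.
Proof. by move=> fK gK; have [h1 h2] := iso_embedding fK gK; exact: (complete_embedding h1 h2). Qed.

Lemma permanent_banach : permanent
  (fun E => (separated E /\ seminormable E) /\ complete_tvs E).
Proof.
apply: permanent_and => [|E F G p1 p2 h _ h1 h2|E F i h cl h1|E Q f h _ [_ [p [pc pb]]] h2].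
- exact: permanent_normable.
- exact: complete_product h h1 h2.
- exact: complete_embedding h cl h1.
- apply: (complete_quotient h) h2.
  exists (fun n x => n.+1%:R * p x); split=> [n|U /pb[e e0 eU]].
    by apply: csn_scale pc.
  exists (Num.truncn e^-1) => x /= h1; apply: eU => /=.
  have h3 : e^-1 < (Num.truncn e^-1).+1%:R by exact: truncnS_gt.
  have h4 : 1 < (Num.truncn e^-1).+1%:R * e by rewrite -ltr_pdivrMr // mul1r.
  by rewrite -(@ltr_pM2l _ (Num.truncn e^-1).+1%:R) //; exact: lt_trans h1 h4.
Qed.

Lemma complete_normed (N : completeNormedModType k) : complete_tvs (N : topologicalLmodType k).
Proof.
move=> F PF cF; suff /cauchy_cvg/cvg_ex[x Fx] : cauchy F by exists x.
move=> A; rewrite -entourage_ballE => -[e /= e0 eA].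
have : nbhs (0 : N) (ball 0 e) by exact: nbhsx_ballx.
move/cF; rewrite /= => -[[P Q] /= [FP FQ] PQ]; exists (P, Q) => // -[x y] /= [Px Qy].
apply: eA => /=; have := PQ (x, y) (conj Px Qy).
by rewrite /= -!ball_normE /= sub0r normrN.
Qed.

Lemma banach_iso E : separated E -> seminormable E -> complete_tvs E ->
  exists (N : completeNormedModType k) (f : clin N E) (g : clin E N), cancel f g /\ cancel g f.
Proof.
move=> sE nE cE; have [N [f [g [fK gK]]]] := seminormable_iso sE nE.
have [B [j [[j' jK j'K] jn]]] := exists_complete_normed (complete_iso fK gK cE).
have [f' f'E] : exists f' : clin B N, forall x, f' x = j' x.
  apply: clin_intro => [a x y|A /normed_nbhs0[e e0 eA]].
    by apply: (can_inj jK); rewrite linearP !j'K.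
  by apply/normed_nbhs0; exists e => // x /= xe; apply: eA; rewrite /= -jn j'K.
have [g' g'E] : exists g' : clin N B, forall x, g' x = j x.
  apply: clin_intro => [a x y|A /normed_nbhs0[e e0 eA]]; first exact: linearP.
  by apply/normed_nbhs0; exists e => // x /= xe; apply: eA; rewrite /= jn.
exists B, (clin_comp f f'), (clin_comp g' g).
by split=> x /=; rewrite f'E g'E ?fK ?jK // j'K gK.
Qed.

Lemma stable_NOR : stable_class (fun N : normedModType k => N : topologicalLmodType k).
Proof.
apply: (permanent_stable permanent_normable).
- by exists k^o; split; [exact: normed_separated|exact: normed_seminormable].
- by move=> N; split; [exact: normed_separated|exact: normed_seminormable].
- by move=> E [sE nE]; exact: seminormable_iso.
Qed.

Lemma stable_BAN (B : completeNormedModType k) :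
  stable_class (fun N : completeNormedModType k => N : topologicalLmodType k).
Proof.
apply: (permanent_stable permanent_banach).
- exists B; split; last exact: complete_normed.
  by split; [exact: normed_separated|exact: normed_seminormable].
- move=> N; split; last exact: complete_normed.
  by split; [exact: normed_separated|exact: normed_seminormable].
- by move=> E [[sE nE] cE]; exact: banach_iso.
Qed.

End Classes.

(** * Positive semi-definite forms *)

Section HermitianForms.
Variables (R : realType) (c : scalar_kind).
Local Notation k := (scalar_field R c).
Local Notation emb := (@emb R c).
Local Notation conj := (@scalar_conj R c).

Record psd_form (V : lmodType k) (f : V -> V -> k) : Prop := PsdForm {
  psd_linear : forall a x y z, f (a *: x + y) z = a * f x z + f y z;
  psd_sym : forall x y, f x y = conj (f y x);
  psd_ge0 : forall x, 0 <= f x x }.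

Definition form_norm (V : lmodType k) (f : V -> V -> k) (x : V) : R := Num.sqrt (mag (f x x)).

(** With [M] the square of [|f x y|], the polynomial is the squared norm of [x - t f(x, y) y]. It is
    evaluated at [t = 1 / Y]; for [Y = 0] it is affine and can only stay nonnegative if [M = 0]. *)
Lemma quadratic_bound (X M Y : R) : 0 <= X -> 0 <= M -> 0 <= Y ->
  (forall t, 0 <= X - 2 * t * M + t ^+ 2 * M * Y) -> M <= X * Y.
Proof.
move=> X0 M0 Y0 h; have [Y00|Yn0] := eqVneq Y 0.
  have [M00|Mn0] := eqVneq M 0; first by rewrite M00 mulr_ge0.
  have := h ((X + 1) / M); rewrite Y00 mulr0 addr0.
  have -> : 2 * ((X + 1) / M) * M = 2 * (X + 1) by rewrite -mulrA divfK.
  lra.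
have Yp : 0 < Y by rewrite lt_neqAle eq_sym Yn0.
have := h Y^-1; have -> : X - 2 * Y^-1 * M + Y^-1 ^+ 2 * M * Y = (X * Y - M) / Y by field.
by rewrite pmulr_lge0 ?invr_gt0 // subr_ge0.
Qed.

Section Form.
Variables (V : lmodType k) (f : V -> V -> k) (ff : psd_form f).
Local Notation N := (form_norm f).

Lemma psdDl x y z : f (x + y) z = f x z + f y z.
Proof. by have := psd_linear ff 1 x y z; rewrite scale1r mul1r. Qed.

Lemma psd0l z : f 0 z = 0.
Proof. by apply: (@addrI _ (f 0 z)); rewrite -psdDl !addr0. Qed.

Lemma psdZl a x z : f (a *: x) z = a * f x z.
Proof. by rewrite -[a *: x]addr0 (psd_linear ff) psd0l addr0. Qed.

Lemma psdNl x z : f (- x) z = - f x z.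
Proof. by rewrite -scaleN1r psdZl mulN1r. Qed.

Lemma psdBl x y z : f (x - y) z = f x z - f y z.
Proof. by rewrite psdDl psdNl. Qed.

Lemma psdDr x y z : f x (y + z) = f x y + f x z.
Proof. by rewrite (psd_sym ff) psdDl conjD -!(psd_sym ff). Qed.

Lemma psdZr a x z : f x (a *: z) = conj a * f x z.
Proof. by rewrite (psd_sym ff) psdZl conjM -(psd_sym ff). Qed.

Lemma psdNr x z : f x (- z) = - f x z.
Proof. by rewrite (psd_sym ff) psdNl conjN -(psd_sym ff). Qed.

Lemma psdBr x y z : f x (y - z) = f x y - f x z.
Proof. by rewrite psdDr psdNr. Qed.

Lemma form_norm_ge0 x : 0 <= N x.
Proof. exact: sqrtr_ge0. Qed.

Lemma form_normE x : f x x = emb (N x ^+ 2).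
Proof. by rewrite sqr_sqrtr ?mag_ge0 // emb_mag // (psd_ge0 ff). Qed.

Lemma form_perturb x y t : N (x - (emb t * f x y) *: y) ^+ 2 =
  N x ^+ 2 - 2 * t * mag (f x y) ^+ 2 + t ^+ 2 * mag (f x y) ^+ 2 * N y ^+ 2.
Proof.
apply: (@emb_inj R c); rewrite -form_normE psdBl !psdBr !psdZr !psdZl conjM conj_emb.
rewrite (psd_sym ff y x) !form_normE.
have := mul_conj (f x y); move: (mag (f x y) ^+ 2) => M.
move: (conj (f x y)) => w; move: (f x y) => z zw.
move: (N x ^+ 2) (N y ^+ 2) => X Y.
have -> : emb (X - 2 * t * M + t ^+ 2 * M * Y) =
    emb X - 2 * emb t * (z * w) + emb t ^+ 2 * (z * w) * emb Y.
  have e2 : emb 2 = 2 by transitivity (emb 1 + emb 1); [exact: (@embD R c)|rewrite emb1].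
  by rewrite zw -e2 -embX -!embM -embB -embD.
by ring.
Qed.

Lemma form_cauchy_schwarz x y : mag (f x y) <= N x * N y.
Proof.
rewrite -(@ler_pXn2r _ 2) ?nnegrE ?mag_ge0 ?mulr_ge0 ?form_norm_ge0 // exprMn.
apply: quadratic_bound; rewrite ?sqr_ge0 // => t.
by rewrite -form_perturb sqr_ge0.
Qed.

Lemma form_norm_seminorm : real_seminorm N.
Proof.
split=> [x|x y|a x]; first exact: form_norm_ge0.
  rewrite -(@ler_pXn2r _ 2) ?nnegrE ?addr_ge0 ?form_norm_ge0 //.
  rewrite -[leLHS]ger0_norm ?sqr_ge0 // -(mag_emb c) -form_normE psdDl !psdDr.
  have := magD (f x x + f x y) (f y x + f y y).
  have := magD (f x x) (f x y); have := magD (f y x) (f y y).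
  rewrite !form_normE !mag_emb !ger0_norm ?sqr_ge0 //.
  have := form_cauchy_schwarz x y; have := form_cauchy_schwarz y x; nra.
apply/eqP; rewrite -(@eqrXn2 _ 2) ?mulr_ge0 ?mag_ge0 ?form_norm_ge0 //; apply/eqP.
apply: (@emb_inj R c); rewrite -form_normE psdZl psdZr form_normE mulrA mul_conj -embM.
by rewrite exprMn.
Qed.

Variables (E : lmodType k) (J : E -> V) (Jl : linear J).

(* Minimizing sequences replace orthogonal projections: [V] need not be
   complete and [range J] need not be closed. *)
Lemma approx_projection : exists pr : V -> nat -> E, forall v n g,
  mag (f (v - J (pr v n)) (J g)) <= n.+1%:R^-1 * N (J g).
Proof.
suff h v n : exists x, forall g, mag (f (v - J x) (J g)) <= n.+1%:R^-1 * N (J g).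
  have [pr prP] := choice (fun vn : V * nat => h vn.1 vn.2).
  by exists (fun v n => pr (v, n)) => v n g; exact: prP (v, n) g.
pose D := [set N (v - J x) ^+ 2 | x in [set: E]].
have Dinf : has_inf D.
  split; first by exists (N (v - J 0) ^+ 2), 0.
  by exists 0 => _ [x _ <-]; exact: sqr_ge0.
set d := n.+1%:R^-1; have d0 : 0 < d by rewrite /d invr_gt0.
have [_ [x _ <-] xD] := inf_adherent (exprn_gt0 2 d0) Dinf.
exists x => g; rewrite -(@ler_pXn2r _ 2) ?nnegrE ?mag_ge0 ?mulr_ge0 ?form_norm_ge0 ?(ltW d0) //.
(* A near-minimizer is nearly orthogonal: the perturbed vector still competes for the infimum, so
   its squared norm drops by at most [d ^+ 2], which plays the part of [X]. *)
rewrite exprMn; apply: quadratic_bound; rewrite ?sqr_ge0 // => t.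
have J0 : J 0 = 0 by have := Jl (-1) 0 0; rewrite scaler0 addr0 scaleN1r addNr.
have : inf D <= N (v - J x - (emb t * f (v - J x) (J g)) *: J g) ^+ 2.
  apply: (ge_inf (proj2 Dinf)); exists ((emb t * f (v - J x) (J g)) *: g + x) => //.
  by rewrite Jl [_ + J x]addrC opprD addrA.
by rewrite form_perturb; lra.
Qed.

End Form.

End HermitianForms.

(** * Limits for seminorms and extension of operators by approximation *)

Section Limits.
Variables (R : realType) (c : scalar_kind).
Local Notation k := (scalar_field R c).
Variables (V : lmodType k) (q : V -> R) (qs : real_seminorm q).

Lemma slim_unique u l l' : (forall x, q x = 0 -> x = 0) -> slim q u l -> slim q u l' -> l = l'.
Proof.
move=> q0 ul ul'; apply/eqP; rewrite -subr_eq0; apply/eqP/q0/eqP.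
rewrite eq_le (rsn_ge0 _ qs) andbT; apply/ler_addgt0Pr => e e0.
have e2 : 0 < e / 2 by rewrite divr_gt0.
have [N h] := ul _ e2; have [N' h'] := ul' _ e2.
have := h _ (leq_maxl N N'); have := h' _ (leq_maxr N N').
have := rsn_tri (u (maxn N N')) l l' qs.
rewrite (rsn_subC l (u _) qs); lra.
Qed.

Lemma slimD u v l m : slim q u l -> slim q v m -> slim q (fun n => u n + v n) (l + m).
Proof.
move=> ul vm e e0; have e2 : 0 < e / 2 by rewrite divr_gt0.
have [N h] := ul _ e2; have [N' h'] := vm _ e2; exists (maxn N N') => n.
rewrite geq_max => /andP[/h h1 /h' h2]; rewrite opprD addrACA.
have := rsn_D (u n - l) (v n - m) qs; lra.
Qed.

Lemma slimZ a u l : slim q u l -> slim q (fun n => a *: u n) (a *: l).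
Proof.
move=> ul e e0; have m0 : 0 < mag a + 1 by have := mag_ge0 a; lra.
have [N h] := ul _ (divr_gt0 e0 m0); exists N => n /h h1.
rewrite -scalerBr (rsn_Z _ _ qs); rewrite ltr_pdivlMr // in h1.
have := rsn_ge0 (u n - l) qs; lra.
Qed.

Lemma slim_cst l : slim q (fun=> l) l.
Proof. by move=> e e0; exists 0%N => n _; rewrite subrr (rsn_0 qs). Qed.

Lemma slim_small u v l : slim q u l -> (forall e, 0 < e -> exists N, forall n, (N <= n)%N ->
  q (u n - v n) < e) -> slim q v l.
Proof.
move=> ul uv e e0; have e2 : 0 < e / 2 by rewrite divr_gt0.
have [N h] := ul _ e2; have [N' h'] := uv _ e2; exists (maxn N N') => n.
rewrite geq_max => /andP[/h h1 /h' h2].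
have := rsn_tri (u n) (v n) l qs; rewrite (rsn_subC (v n) (u n) qs); lra.
Qed.

Lemma slim_le u l B : slim q u l -> (forall e, 0 < e -> exists N, forall n, (N <= n)%N ->
  q (u n) <= B + e) -> q l <= B.
Proof.
move=> ul uB; apply/ler_addgt0Pr => e e0; have e2 : 0 < e / 2 by rewrite divr_gt0.
have [N h] := ul _ e2; have [N' h'] := uB _ e2.
have := h _ (leq_maxl N N'); have := h' _ (leq_maxr N N').
have := rsn_dist l (u (maxn N N')) qs; rewrite (rsn_subC l _ qs); lra.
Qed.

Lemma slim_bounded u l B : slim q u l -> (forall n, q (u n) <= B) -> q l <= B.
Proof.
by move=> ul uB; apply: slim_le ul _ => e e0; exists 0%N => n _; have := uB n; lra.
Qed.

Lemma bounded_series_cauchy (u : nat -> V) M : (forall N, \sum_(n < N) q (u n) <= M) ->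
  scauchy q (fun N => \sum_(n < N) u n).
Proof.
move=> uM e e0; pose S := [set \sum_(n < N) q (u n) | N in [set: nat]].
have Ssup : has_sup S.
  by split; [exists (\sum_(n < 0) q (u n)), 0%N|exists M => _ [N _ <-]].
have e3 : 0 < e / 3 by rewrite divr_gt0.
have [_ [N _ <-] hN] := sup_adherent e3 Ssup.
have tail n : (N <= n)%N -> q (\sum_(i < n) u i - \sum_(i < N) u i) <= e / 3.
  move=> Nn; suff h d : q (\sum_(i < N + d) u i - \sum_(i < N) u i) <=
      \sum_(i < N + d) q (u i) - \sum_(i < N) q (u i).
    rewrite -(subnKC Nn); apply: le_trans (h _) _.
    have : \sum_(i < N + (n - N)) q (u i) <= sup S by apply: sup_upper_bound => //; exists (N + (n - N))%N.
    lra.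
  elim: d => [|d IH]; first by rewrite addn0 !subrr (rsn_0 qs).
  rewrite addnS !big_ord_recr /= addrAC; apply: le_trans (rsn_D _ _ qs) _.
  by rewrite [leRHS]addrAC lerD2r.
exists N => m n /tail h1 /tail h2.
have := rsn_tri (\sum_(i < N) u i) (\sum_(i < m) u i) (\sum_(i < n) u i) qs.
rewrite (rsn_subC (\sum_(i < N) u i) (\sum_(i < n) u i) qs); lra.
Qed.

End Limits.

Lemma mag_seminorm (R : realType) (c : scalar_kind) :
  real_seminorm (@mag R c : (scalar_field R c)^o -> R).
Proof. by split=> [x|x y|a x]; [exact: mag_ge0|exact: magD|exact: magM]. Qed.

(** What approximate orthogonal projections onto [range J] and approximation from a dense [range J]
    have in common, with explicit errors. It is exactly what [extension] consumes. *)
Record approximation (R : realType) (c : scalar_kind) (V E : lmodType (scalar_field R c))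
    (N : V -> R) (s : E -> R) (J : E -> V) (pr : V -> nat -> E) : Prop := Approximation {
  approx_cauchy : forall v m n, s (pr v m - pr v n) <= m.+1%:R^-1 + n.+1%:R^-1;
  approx_linear : forall a v w n,
    s (pr (a *: v + w) n - (a *: pr v n + pr w n)) <= (2 + mag a) * n.+1%:R^-1;
  approx_bounded : forall v n, s (pr v n) <= N v + n.+1%:R^-1;
  approx_range : forall x n, s (pr (J x) n - x) <= n.+1%:R^-1 }.

Lemma inv_small (R : realType) (e : R) : 0 < e ->
  exists M, forall n, (M <= n)%N -> n.+1%:R^-1 < e.
Proof.
move=> e0; exists (Num.truncn e^-1) => n Mn; rewrite invf_plt ?posrE //.
by apply: lt_le_trans (truncnS_gt _) _; rewrite ler_nat ltnS.
Qed.

Section ProjectionApproximation.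
Variables (R : realType) (c : scalar_kind).
Local Notation k := (scalar_field R c).
Variables (V E : lmodType k) (f : V -> V -> k) (ff : psd_form f) (J : E -> V) (Jl : linear J).
Local Notation N := (form_norm f).
Variable pr : V -> nat -> E.
Hypothesis prP : forall v n g, mag (f (v - J (pr v n)) (J g)) <= n.+1%:R^-1 * N (J g).

Let Ns : real_seminorm N := form_norm_seminorm ff.
Let JB x y : J (x - y) = J x - J y.
Proof. by have := Jl (-1) y x; rewrite !scaleN1r ![- _ + _]addrC. Qed.

(** Test with [g = x] and divide by the norm. The estimates below write [J] of their error vector
    through residuals [v - J (pr v n)], which are nearly orthogonal to [range J]. *)
Lemma small_of_orthogonal x s : 0 <= s ->
  (forall g, mag (f (J x) (J g)) <= s * N (J g)) -> N (J x) <= s.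
Proof.
move=> s0 /(_ x); rewrite (form_normE ff) mag_emb ger0_norm ?sqr_ge0 // expr2.
have [->|n0] := eqVneq (N (J x)) 0; first by [].
by rewrite ler_pM2r // lt_neqAle eq_sym n0 form_norm_ge0.
Qed.

Lemma pr_cauchy v m n : N (J (pr v m - pr v n)) <= m.+1%:R^-1 + n.+1%:R^-1.
Proof.
apply: small_of_orthogonal => [|g]; first by rewrite addr_ge0 // invr_ge0.
have -> : J (pr v m - pr v n) = (v - J (pr v n)) - (v - J (pr v m)).
  by rewrite JB opprB [RHS]addrC addrA subrK.
rewrite (psdBl ff) mulrDl [leRHS]addrC; apply: le_trans (magD _ _) _; rewrite magN.
by apply: lerD; exact: prP.
Qed.

Lemma pr_linear a v w n : N (J (pr (a *: v + w) n - (a *: pr v n + pr w n))) <=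
  (2 + mag a) * n.+1%:R^-1.
Proof.
have t0 : 0 <= n.+1%:R^-1 :> R by rewrite invr_ge0.
have m0 := mag_ge0 a; apply: small_of_orthogonal => [|g]; first by rewrite mulr_ge0 //; lra.
have -> : J (pr (a *: v + w) n - (a *: pr v n + pr w n)) =
  (a *: (v - J (pr v n)) + (w - J (pr w n))) - (a *: v + w - J (pr (a *: v + w) n)).
  by rewrite JB Jl scalerBr [X in _ = X - _]addrACA -opprD opprB [RHS]addrC addrA subrK.
rewrite (psdBl ff) (psd_linear ff); apply: le_trans (magD _ _) _; rewrite magN.
have := magD (a * f (v - J (pr v n)) (J g)) (f (w - J (pr w n)) (J g)); rewrite magM.
have := prP v n g; have := prP w n g; have := prP (a *: v + w) n g.
move=> h1 h2 h3; have := ler_wpM2l m0 h3; rewrite -(mulrA (2 + mag a)) mulrDl.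
move: (n.+1%:R^-1 * N (J g)) h1 h2 => s; lra.
Qed.

Lemma pr_bounded v n : N (J (pr v n)) <= N v + n.+1%:R^-1.
Proof.
apply: small_of_orthogonal => [|g]; first by rewrite addr_ge0 ?form_norm_ge0 ?invr_ge0.
have -> : J (pr v n) = v - (v - J (pr v n)) by rewrite subKr.
rewrite (psdBl ff) mulrDl; apply: le_trans (magD _ _) _; rewrite magN.
by apply: lerD; [exact: form_cauchy_schwarz|exact: prP].
Qed.

Lemma pr_range x n : N (J (pr (J x) n - x)) <= n.+1%:R^-1.
Proof.
apply: small_of_orthogonal => [|g]; first by rewrite invr_ge0.
by rewrite JB -opprB (psdNl ff) magN; exact: prP.
Qed.

Lemma projection_approximation : approximation N (fun x => N (J x)) J pr.
Proof.
by split; [exact: pr_cauchy|exact: pr_linear|exact: pr_bounded|exact: pr_range].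
Qed.

End ProjectionApproximation.

Section Extension.
Variables (R : realType) (c : scalar_kind).
Local Notation k := (scalar_field R c).
Variables (V E : lmodType k) (N : V -> R) (s : E -> R) (J : E -> V) (pr : V -> nat -> E).
Hypothesis ap : approximation N s J pr.
Variables (W : lmodType k) (q : W -> R) (qs : real_seminorm q).
Hypotheses (q_definite : forall x, q x = 0 -> x = 0)
  (q_complete : forall u, scauchy q u -> exists l, slim q u l).
Variables (L : E -> W) (Ll : linear L) (C : R).
Hypotheses (C_ge0 : 0 <= C) (L_bounded : forall x, q (L x) <= C * s x).

(** [X v] is the limit of [L (pr v n)]. For a dense range this is extension by continuity; for
    approximate projections it is the extension that vanishes on the orthogonal complement of
    [range J]. *)
Lemma extension : exists X : V -> W,
  [/\ linear X, forall v n, q (L (pr v n) - X v) <= C * n.+1%:R^-1, forall x, X (J x) = L x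
    & forall v, q (X v) <= C * N v].
Proof.
have LB x y : L (x - y) = L x - L y.
  by have := Ll (-1) y x; rewrite !scaleN1r ![- _ + _]addrC.
have small (e D : R) : 0 < e -> 0 <= D -> exists M, forall n, (M <= n)%N -> C * (D * n.+1%:R^-1) < e.
  move=> e0 D0; have h : 0 < e / (C * D + 1) by rewrite divr_gt0 // ltr_wpDl // mulr_ge0.
  have [M MP] := inv_small h; exists M => n /MP; rewrite ltr_pdivlMr; last first.
    by rewrite ltr_wpDl // mulr_ge0.
  have : 0 <= n.+1%:R^-1 :> R by rewrite invr_ge0.
  move: (n.+1%:R^-1) => t t0 h1.
  have -> : C * (D * t) = t * (C * D + 1) - t by ring.
  lra.
have cau v : scauchy q (fun n => L (pr v n)).
  move=> e e0; have [M MP] := small e 2 e0 (ler0n _ 2).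
  exists M => m n /MP hm /MP hn; rewrite -LB; apply: le_lt_trans (L_bounded _) _.
  have := ler_wpM2l C_ge0 (approx_cauchy ap v m n); rewrite !mulrDr.
  move: (m.+1%:R^-1) (n.+1%:R^-1) hm hn => t r; lra.
have [X XP] := choice (fun v => q_complete (cau v)).
exists X; split=> //.
- move=> a v w; apply: (slim_unique qs q_definite (XP _)).
  apply: (slim_small qs (slimD qs (slimZ qs a (XP v)) (XP w))) => e e0.
  have [M MP] := small e (2 + mag a) e0 (addr_ge0 (ler0n _ 2) (mag_ge0 a)).
  exists M => n /MP h; rewrite (rsn_subC _ _ qs) -Ll -LB.
  by apply: le_lt_trans (L_bounded _) (le_lt_trans (ler_wpM2l C_ge0 (approx_linear ap _ _ _ _)) h).
- move=> v n; have XPn := slimD qs (slim_cst qs (L (pr v n))) (slimZ qs (-1) (XP v)).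
  rewrite -scaleN1r; apply: (slim_le qs XPn) => e e0.
  have [M MP] := small e 1 e0 ler01; exists M => m /MP; rewrite mul1r scaleN1r -LB => h.
  apply: le_trans (L_bounded _) (le_trans (ler_wpM2l C_ge0 (approx_cauchy ap v n m)) _).
  by rewrite mulrDr lerD2l ltW.
- move=> x; apply: (slim_unique qs q_definite (XP _)) => e e0.
  have [M MP] := small e 1 e0 ler01; exists M => n /MP; rewrite mul1r => h; rewrite -LB.
  by apply: le_lt_trans (L_bounded _) (le_lt_trans (ler_wpM2l C_ge0 (approx_range ap _ _)) h).
- move=> v; apply: (slim_le qs (XP v)) => e e0.
  have [M MP] := small e 1 e0 ler01; exists M => n /MP; rewrite mul1r => h.
  apply: le_trans (L_bounded _) (le_trans (ler_wpM2l C_ge0 (approx_bounded ap v n)) _).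
  by rewrite mulrDr lerD2l ltW.
Qed.

End Extension.

(** * The space of square-summable sequences *)

Section SquareSummable.
Variables (R : realType) (c : scalar_kind).
Local Notation k := (scalar_field R c).
Local Notation emb := (@emb R c).
Local Notation conj := (@scalar_conj R c).

Definition sqsum (x : nat -> k^o) (N : nat) : R := \sum_(n < N) mag (x n : k) ^+ 2.

Definition square_summable : set (nat -> k^o) := [set x | exists M, forall N, sqsum x N <= M].

Lemma sqsum_mono x m n : (m <= n)%N -> sqsum x m <= sqsum x n.
Proof.
move=> /subnK <-; elim: (n - m)%N => [|d IH] //; apply: le_trans IH _.
by rewrite addSn [leRHS]/sqsum big_ord_recr /= lerDl sqr_ge0.
Qed.

Lemma sqsum_ge0 x n : 0 <= sqsum x n.
Proof. by rewrite sumr_ge0 // => i _; exact: sqr_ge0. Qed.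

Lemma square_summable_submod : is_submod square_summable.
Proof.
split; first by exists 0 => N; rewrite /sqsum big1 // => i _; rewrite mag0 expr0n.
move=> a x y [M xM] [M' yM']; exists (2 * mag a ^+ 2 * M + 2 * M') => N.
apply: (@le_trans _ _ (2 * mag a ^+ 2 * sqsum x N + 2 * sqsum y N)); last first.
  have := xM N; have := yM' N; have := sqr_ge0 (mag a); nra.
rewrite /sqsum !mulr_sumr -big_split /=; apply: ler_sum => i _.
have := magD (a * x i) (y i); rewrite magM => h.
apply: (@le_trans _ _ ((mag a * mag (x i : k) + mag (y i : k)) ^+ 2)).
  by rewrite ler_pXn2r ?nnegrE ?mag_ge0 // addr_ge0 ?mulr_ge0 ?mag_ge0.
have := sqr_ge0 (mag a * mag (x i : k) - mag (y i : k)); lra.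
Qed.

(** The form is the limit of the partial inner products, which converge absolutely since [|x y|] is
    at most [|x| ^ 2 + |y| ^ 2]. The last two clauses identify the squared norm as the supremum of
    the partial sums. *)
Lemma square_summable_space : exists (V : lmodType k) (inc : {linear V -> (nat -> k^o)})
  (f : V -> V -> k), [/\ psd_form f, injective inc, range inc = square_summable,
    forall x N, sqsum (inc x) N <= form_norm f x ^+ 2
  & forall x B, (forall N, sqsum (inc x) N <= B) -> form_norm f x ^+ 2 <= B].
Proof.
have [V [inc [inj rg]]] := sub_lmodule square_summable_submod.
have bnd x : exists M, forall N, sqsum (inc x) N <= M.
  by have : range inc (inc x) by []; rewrite rg.
pose s x := sup [set sqsum (inc x) N | N in [set: nat]].
have hs x : has_sup [set sqsum (inc x) N | N in [set: nat]].
  have [M xM] := bnd x; split; first by exists (sqsum (inc x) 0), 0%N.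
  by exists M => _ [N _ <-].
have s_ub x N : sqsum (inc x) N <= s x by apply: (sup_upper_bound (hs x)); exists N.
have s_le x B : (forall N, sqsum (inc x) N <= B) -> s x <= B.
  by move=> h; apply: (ge_sup (proj1 (hs x))) => _ [N _ <-].
have ms := @mag_seminorm R c.
have ex (xy : V * V) : exists l : k^o, slim (@mag R c : k^o -> R)
    (fun N => \sum_(n < N) ((inc xy.1 n : k) * conj (inc xy.2 n) : k^o)) l.
  have h N : \sum_(n < N) mag ((inc xy.1 n : k) * conj (inc xy.2 n)) <= s xy.1 + s xy.2.
    apply: le_trans _ (lerD (s_ub xy.1 N) (s_ub xy.2 N)).
    rewrite /sqsum -big_split /=; apply: ler_sum => i _; rewrite magM mag_conj.
    have := sqr_ge0 (mag (inc xy.1 i : k) - mag (inc xy.2 i : k)).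
    have := mag_ge0 (inc xy.1 i : k); have := mag_ge0 (inc xy.2 i : k); nra.
  apply: (scalar_complete (u := fun N => \sum_(n < N) (inc xy.1 n : k) * conj (inc xy.2 n))).
  by have := @bounded_series_cauchy R c k^o (@mag R c) ms (fun n => (inc xy.1 n : k) * conj (inc xy.2 n)) _ h.
have [f0 f0P] := choice ex; pose f x y : k := f0 (x, y).
have fP x y : slim (@mag R c : k^o -> R)
    (fun N => \sum_(n < N) ((inc x n : k) * conj (inc y n) : k^o)) (f x y) by exact: f0P (x, y).
have uniq u l l' : slim (@mag R c : k^o -> R) u l -> slim (@mag R c : k^o -> R) u l' -> l = l'.
  by apply: (slim_unique ms) => x; exact: mag_eq0.
have fE x : f x x = emb (s x).
  apply: (uniq _ _ _ (fP x x)) => e e0.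
  have [_ [N _ <-] hN] := sup_adherent e0 (hs x); exists N => n Nn.
  have -> : \sum_(i < n) ((inc x i : k) * conj (inc x i) : k^o) = emb (sqsum (inc x) n).
    by rewrite emb_sum; apply: eq_bigr => i _; rewrite mul_conj.
  rewrite -embB mag_emb ler0_norm ?subr_le0 //.
  have := sqsum_mono (inc x) Nn; rewrite -/(s x) in hN; lra.
have s0 x : 0 <= s x by apply: le_trans (s_ub x 0%N); exact: sqsum_ge0.
have nE x : form_norm f x ^+ 2 = s x.
  by rewrite /form_norm sqr_sqrtr ?mag_ge0 // fE mag_emb ger0_norm.
exists V, inc, f; split=> //; [|by move=> x N; rewrite nE|by move=> x B h; rewrite nE; exact: s_le].
split=> [a x y z|x y|x]; last by rewrite fE -(emb0 R c) ler_emb.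
- apply: (uniq _ _ _ (fP _ _)).
  have := slimD ms (slimZ ms a (fP x z)) (fP y z); congr (slim _ _ _); apply/funext => N.
  rewrite scaler_sumr -big_split; apply: eq_bigr => i _ /=.
  rewrite linearP; change (a * ((inc x i : k) * conj (inc z i)) + (inc y i : k) * conj (inc z i) =
    (a * (inc x i : k) + (inc y i : k)) * conj (inc z i)).
  by rewrite mulrDl mulrA.
- apply: (uniq _ _ _ (fP _ _)) => e e0; have [N NP] := fP y x e e0; exists N => n /NP.
  congr (_ < _); rewrite -mag_conj conjB; congr (mag (_ - _)).
  elim: n => [|n IH]; first by rewrite !big_ord0 conj0.
  by rewrite !big_ord_recr /= conjD IH conjM conj_involutive mulrC.
Qed.

End SquareSummable.

(** * The Hilbert-Schmidt condition *)

Section HilbertSchmidt.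
Variables (R : realType) (c : scalar_kind).
Local Notation k := (scalar_field R c).
Local Notation emb := (@emb R c).
Implicit Types E F G Q : topologicalLmodType k.

(** [a n] bounds the norm of [phi n] on the local space of [q]. The last clause says that [p x ^+ 2]
    is at most the full sum of [mag (phi n x) ^+ 2], phrased with partial sums. *)
Definition hs_dominated E (p q : E -> R) (phi : nat -> E -> k^o) (a : nat -> R) :=
  [/\ forall n, linear (phi n), forall n, 0 <= a n,
      forall n x, mag (phi n x : k) <= a n * q x,
      exists M, forall N, \sum_(n < N) a n ^+ 2 <= M
    & forall x e, 0 < e -> exists N, p x ^+ 2 <= \sum_(n < N) mag (phi n x : k) ^+ 2 + e].

(* By the Cauchy-Schwarz inequality, the maps between the local Banach spaces
   can be taken quasi-nuclear, and composing two of them yields a nuclear map.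
   Unlike nuclearity of the linking maps, this condition visibly passes to
   subspaces. *)
Definition hs_condition E := forall p : E -> R, cont_seminorm p ->
  exists (q : E -> R) (phi : nat -> E -> k^o) (a : nat -> R),
    cont_seminorm q /\ hs_dominated p q phi a.

Lemma sum_sq_mono (u : nat -> R) m n : (m <= n)%N ->
  \sum_(i < m) u i ^+ 2 <= \sum_(i < n) u i ^+ 2.
Proof.
move=> /subnK <-; elim: (n - m)%N => [|d IH] //; apply: le_trans IH _.
by rewrite addSn big_ord_recr /= lerDl sqr_ge0.
Qed.

(** Coordinate errors [a n * t] change a sum of squares by a multiple of [t] that does not depend on
    [N], because the [a n] are square-summable. *)
Lemma sum_sq_perturb (u v a : nat -> R) t D M N : (forall n, 0 <= u n) -> (forall n, 0 <= v n) ->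
  (forall n, 0 <= a n) -> 0 <= t <= 1 -> 0 <= D ->
  (forall n, u n <= v n + a n * t) -> (forall n, v n <= a n * D) ->
  \sum_(n < N) a n ^+ 2 <= M ->
  \sum_(n < N) u n ^+ 2 <= \sum_(n < N) v n ^+ 2 + (2 * D + 1) * M * t.
Proof.
move=> u0 v0 a0 /andP[t0 t1] D0 uv vD aM.
apply: (@le_trans _ _ (\sum_(n < N) v n ^+ 2 + (2 * D + 1) * t * \sum_(n < N) a n ^+ 2)).
  rewrite mulr_sumr -big_split /=; apply: ler_sum => n _.
  have h1 : u n ^+ 2 <= (v n + a n * t) ^+ 2.
    by rewrite ler_pXn2r ?nnegrE ?addr_ge0 ?mulr_ge0.
  apply: le_trans h1 _; have h2 : v n * (a n * t) <= a n * D * (a n * t).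
    by apply: ler_wpM2r; rewrite ?mulr_ge0.
  have h3 : a n ^+ 2 * t * t <= a n ^+ 2 * t * 1.
    by apply: ler_wpM2l; rewrite ?mulr_ge0 ?sqr_ge0.
  have -> : (v n + a n * t) ^+ 2 = v n ^+ 2 + 2 * (v n * (a n * t)) + a n ^+ 2 * t * t by ring.
  have -> : v n ^+ 2 + (2 * D + 1) * t * a n ^+ 2 =
    v n ^+ 2 + 2 * (a n * D * (a n * t)) + a n ^+ 2 * t * 1 by ring.
  lra.
rewrite lerD2l -!mulrA; apply: ler_wpM2l; first lra.
by rewrite [M * t]mulrC; apply: ler_wpM2l.
Qed.

(** The functionals assemble into [J x = (psi n x)_n], whose l^2-norm is a Hilbertian seminorm
    between [q] and a multiple of [r]. *)
Lemma hs_to_l2 E (V : lmodType k) (inc : {linear V -> (nat -> k^o)}) (f : V -> V -> k)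
    (q r : E -> R) (psi : nat -> E -> k^o) (b : nat -> R) :
  psd_form f -> injective inc -> range inc = @square_summable R c ->
  (forall x N, sqsum (inc x) N <= form_norm f x ^+ 2) ->
  (forall x B, (forall N, sqsum (inc x) N <= B) -> form_norm f x ^+ 2 <= B) ->
  real_seminorm q -> real_seminorm r -> hs_dominated q r psi b ->
  exists (J : E -> V) (C : R), [/\ linear J, forall x n, inc (J x) n = psi n x, 0 <= C,
    forall x, form_norm f (J x) <= C * r x & forall x, q x <= form_norm f (J x)].
Proof.
move=> ff inj rg nle nub qs rs [psil b0 psib [M bM] qpsi].
have M0 : 0 <= M by have := bM 0%N; rewrite big_ord0.
have bound x N : \sum_(n < N) mag (psi n x : k) ^+ 2 <= M * r x ^+ 2.
  apply: (@le_trans _ _ ((\sum_(n < N) b n ^+ 2) * r x ^+ 2)); last first.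
    by apply: ler_wpM2r => //; exact: sqr_ge0.
  rewrite mulr_suml; apply: ler_sum => n _; rewrite -exprMn.
  by rewrite ler_pXn2r ?nnegrE ?mag_ge0 // mulr_ge0 // rsn_ge0.
have ex x : exists v, inc v = (fun n => psi n x).
  have : range inc (fun n => psi n x); last by move=> [v _ vE]; exists v.
  by rewrite rg; exists (M * r x ^+ 2) => N; exact: bound.
have [J JE] := choice ex; exists J, (Num.sqrt M); split.
- move=> a x y; apply: inj; rewrite linearP !JE; apply/funext => n.
  exact: psil.
- by move=> x n; rewrite JE.
- exact: sqrtr_ge0.
- move=> x; rewrite -(@ler_pXn2r _ 2) ?nnegrE ?form_norm_ge0 ?mulr_ge0 ?sqrtr_ge0 ?rsn_ge0 //.
  by rewrite exprMn [Num.sqrt M ^+ 2]sqr_sqrtr //; apply: nub => N; rewrite JE; exact: bound.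
- move=> x; rewrite -(@ler_pXn2r _ 2) ?nnegrE ?form_norm_ge0 ?rsn_ge0 //.
  apply/ler_addgt0Pr => e e0; have [N NP] := qpsi x e e0; apply: le_trans NP _.
  by rewrite lerD2r; have := nle (J x) N; rewrite JE.
Qed.

Lemma hs_embedding E F (i : clin E F) : embedding i -> locally_seminormed F ->
  hs_condition F -> hs_condition E.
Proof.
move=> [_ iemb] lF hF p [ps p1]; have [B B0 BP] := iemb _ p1.
have [P Pc PB] := lF _ B0; have [q [phi [a [qc [phil a0 phia aM Pphi]]]]] := hF P Pc.
exists (fun x => q (i x)), (fun n x => phi n (i x)), a; split; first exact: csn_comp.
split=> //; first by move=> n b x y; rewrite (clin_linear i) phil.
have pP x : p x <= P (i x).
  apply: (rsn_le (proj1 (csn_comp i Pc)) ps) => z /PB/BP /=; exact: ltW.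
move=> x e e0; have [N NP] := Pphi (i x) e e0; exists N; apply: le_trans NP.
by rewrite ler_pXn2r ?nnegrE ?rsn_ge0 //; case: Pc.
Qed.

Lemma sum_interleave (u v : nat -> R) N :
  \sum_(i < N.*2) (if odd i then v i./2 else u i./2) = \sum_(i < N) u i + \sum_(i < N) v i.
Proof.
elim: N => [|N IH]; first by rewrite !big_ord0 addr0.
rewrite doubleS !big_ord_recr /= IH odd_double /= uphalf_double doubleK; lra.
Qed.

Lemma hs_product E F G (p1 : clin G E) (p2 : clin G F) : is_product p1 p2 ->
  locally_seminormed E -> locally_seminormed F ->
  hs_condition E -> hs_condition F -> hs_condition G.
Proof.
move=> [_ nb] lE lF hE hF p [ps pn]; have [B1 [B2 [B10 B20 BP]]] := nb _ pn.
have [P1 P1c P1B] := lE _ B10; have [P2 P2c P2B] := lF _ B20.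
have [q1 [phi [a [q1c [phil a0 phia [M aM] Pphi]]]]] := hE P1 P1c.
have [q2 [psi [b [q2c [psil b0 psib [M' bM'] Ppsi]]]]] := hF P2 P2c.
have s1 := proj1 P1c; have s2 := proj1 P2c; have r1 := proj1 q1c; have r2 := proj1 q2c.
have pP z : p z <= P1 (p1 z) + P2 (p2 z).
  apply: (rsn_le (proj1 (csn_add (csn_comp p1 P1c) (csn_comp p2 P2c))) ps) => w h.
  have h1 := rsn_ge0 (p1 w) s1; have h2 := rsn_ge0 (p2 w) s2.
  by apply/ltW/BP; [apply: P1B|apply: P2B] => /=; lra.
(* The two families are interleaved. The factor 2 pays for [(u + v) ^ 2 <= 2 u ^ 2 + 2 v ^ 2]; it
   becomes 4 in the squares, and with two families this explains the tolerance [e / 8] below. *)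
pose chi i z : k^o := emb 2 * (if odd i then psi i./2 (p2 z) else phi i./2 (p1 z) : k).
pose d i := 2 * (if odd i then b i./2 else a i./2).
exists (fun z => q1 (p1 z) + q2 (p2 z)), chi, d; split.
  by apply: csn_add; exact: csn_comp.
have magchi i z : mag (chi i z : k) = 2 * (if odd i then mag (psi i./2 (p2 z) : k) else mag (phi i./2 (p1 z) : k)).
  by rewrite /chi magM mag_emb ger0_norm //; case: ifP.
split.
- move=> i x z w; rewrite /chi; case: ifP => _.
    by rewrite (clin_linear p2) psil mulrDr; congr (_ + _); rewrite mulrCA.
  by rewrite (clin_linear p1) phil mulrDr; congr (_ + _); rewrite mulrCA.
- by move=> i; rewrite /d; case: ifP => _; rewrite mulr_ge0.
- move=> i z; rewrite magchi /d -mulrA ler_pM2l //.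
  have h1 := rsn_ge0 (p1 z) r1; have h2 := rsn_ge0 (p2 z) r2; case: ifP => _.
    by apply: le_trans (psib _ _) _; rewrite ler_wpM2l //; lra.
  by apply: le_trans (phia _ _) _; rewrite ler_wpM2l //; lra.
- exists (4 * M + 4 * M') => N; apply: (@le_trans _ _ (\sum_(i < N.*2) d i ^+ 2)).
    by apply: sum_sq_mono; rewrite -addnn leq_addr.
  have -> : \sum_(i < N.*2) d i ^+ 2 =
      \sum_(i < N.*2) (if odd i then 4 * b i./2 ^+ 2 else 4 * a i./2 ^+ 2).
    by apply: eq_bigr => i _; rewrite /d exprMn; case: ifP => _; rewrite -natrX.
  rewrite (sum_interleave (fun i => 4 * a i ^+ 2) (fun i => 4 * b i ^+ 2)) -!mulr_sumr.
  have := aM N; have := bM' N; lra.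
- move=> z e e0; have e8 : 0 < e / 8 by rewrite divr_gt0.
  have [N1 h1] := Pphi (p1 z) _ e8; have [N2 h2] := Ppsi (p2 z) _ e8.
  exists (maxn N1 N2).*2.
  have -> : \sum_(i < (maxn N1 N2).*2) mag (chi i z : k) ^+ 2 =
      \sum_(i < (maxn N1 N2).*2) (if odd i then 4 * mag (psi i./2 (p2 z) : k) ^+ 2
        else 4 * mag (phi i./2 (p1 z) : k) ^+ 2).
    by apply: eq_bigr => i _; rewrite magchi exprMn; case: ifP => _; rewrite -natrX.
  rewrite (sum_interleave (fun i => 4 * mag (phi i (p1 z) : k) ^+ 2)
    (fun i => 4 * mag (psi i (p2 z) : k) ^+ 2)) -!mulr_sumr.
  have h3 := sum_sq_mono (fun n => mag (phi n (p1 z) : k)) (leq_maxl N1 N2).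
  have h4 := sum_sq_mono (fun n => mag (psi n (p2 z) : k)) (leq_maxr N1 N2).
  have h5 : p z ^+ 2 <= (P1 (p1 z) + P2 (p2 z)) ^+ 2.
    by rewrite ler_pXn2r ?nnegrE ?addr_ge0 ?rsn_ge0.
  have h6 := sqr_ge0 (P1 (p1 z) - P2 (p2 z)).
  have h7 : (P1 (p1 z) + P2 (p2 z)) ^+ 2 <= 2 * P1 (p1 z) ^+ 2 + 2 * P2 (p2 z) ^+ 2.
    by rewrite -subr_ge0; apply: le_trans h6 _; rewrite le_eqVlt; apply/orP; left; apply/eqP; ring.
  have h8 := sqr_ge0 (P1 (p1 z)); have h9 := sqr_ge0 (P2 (p2 z)); lra.
Qed.

End HilbertSchmidt.

(** * The Hilbert-Schmidt condition on quotients *)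

Section HilbertSchmidtQuotient.
Variables (R : realType) (c : scalar_kind).
Local Notation k := (scalar_field R c).
Implicit Types E F G Q : topologicalLmodType k.

Lemma scalar_extension (V E : lmodType k) (N : V -> R) (s : E -> R) (J : E -> V)
    (pr : V -> nat -> E) (L : E -> k^o) C : approximation N s J pr -> linear L -> 0 <= C ->
  (forall x, mag (L x : k) <= C * s x) -> exists X : V -> k^o,
  [/\ linear X, forall v n, mag (L (pr v n) - X v : k) <= C * n.+1%:R^-1,
      forall x, X (J x) = L x & forall v, mag (X v : k) <= C * N v].
Proof.
move=> ap Ll C0 LC; apply: (extension ap (@mag_seminorm R c) _ _ Ll C0 LC).
  by move=> x; exact: mag_eq0.
exact: scalar_complete.
Qed.

Lemma hs_bound E (p q : E -> R) phi a : real_seminorm p -> real_seminorm q ->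
  hs_dominated p q phi a -> exists2 C, 0 <= C & forall x, p x <= C * q x.
Proof.
move=> ps qs [_ a0 phia [M aM] Pphi].
have M0 : 0 <= M by have := aM 0%N; rewrite big_ord0.
exists (Num.sqrt M); first exact: sqrtr_ge0.
move=> x; rewrite -(@ler_pXn2r _ 2) ?nnegrE ?mulr_ge0 ?sqrtr_ge0 ?rsn_ge0 //.
rewrite exprMn sqr_sqrtr //; apply/ler_addgt0Pr => e e0.
have [N NP] := Pphi x e e0; apply: le_trans NP _; rewrite lerD2r.
apply: (@le_trans _ _ ((\sum_(n < N) a n ^+ 2) * q x ^+ 2)); last first.
  by apply: ler_wpM2r => //; exact: sqr_ge0.
rewrite mulr_suml; apply: ler_sum => n _; rewrite -exprMn.
by rewrite ler_pXn2r ?nnegrE ?mag_ge0 // mulr_ge0 // rsn_ge0.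
Qed.

(* [x - pr v n] is almost the component of [x] orthogonal to [range J]. *)
Lemma hs_residual E (W V : lmodType k) (pr : V -> nat -> W) (iota : W -> E)
    (p q : E -> R) phi a (X : nat -> V -> k^o) x v D e :
  real_seminorm p -> hs_dominated p q phi a ->
  (forall n v m, mag (phi n (iota (pr v m)) - X n v : k) <= a n * m.+1%:R^-1) ->
  0 <= D -> (forall n, mag (phi n x - X n v : k) <= a n * D) -> 0 < e ->
  exists M0, forall m, (M0 <= m)%N -> exists K, forall n, (K <= n)%N ->
    p (x - iota (pr v m)) ^+ 2 <= \sum_(i < n) mag (phi i x - X i v : k) ^+ 2 + e.
Proof.
move=> ps [phil a0 phia [M aM] Pphi] Xpr D0 XD e0.
have M0 : 0 <= M by have := aM 0%N; rewrite big_ord0.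
have e2 : 0 < e / 2 by rewrite divr_gt0.
(* [(2 * D + 1) * M] is the constant of [sum_sq_perturb]; one is added to make it a divisor. *)
have C0 : 0 < (2 * D + 1) * M + 1 by rewrite ltr_wpDl // mulr_ge0 //; lra.
have [m0 m0P] := inv_small (divr_gt0 e2 C0); exists m0 => m /m0P mP.
have [K KP] := Pphi (x - iota (pr v m)) _ e2; exists K => n Kn.
apply: le_trans KP _.
have phiB i y z : phi i (y - z) = phi i y - phi i z.
  by rewrite -scaleN1r addrC phil scaleN1r addrC.
have t01 : 0 <= (m.+1%:R^-1 : R) <= 1.
  by apply/andP; split; [rewrite invr_ge0|rewrite invf_le1 ?ler1n].
have := sum_sq_mono (fun i => mag (phi i (x - iota (pr v m)) : k)) Kn.
have := @sum_sq_perturb R (fun i => mag (phi i (x - iota (pr v m)) : k))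
  (fun i => mag (phi i x - X i v : k)) a _ D M n _ _ a0 t01 D0 _ XD (aM n).
move=> /(_ (fun=> mag_ge0 _) (fun=> mag_ge0 _)) h1 h2.
have h3 : \sum_(n0 < n) mag (phi n0 (x - iota (pr v m)) : k) ^+ 2 <=
    \sum_(n0 < n) mag (phi n0 x - X n0 v : k) ^+ 2 + (2 * D + 1) * M * m.+1%:R^-1.
  apply: h1 => i; rewrite phiB.
  have -> : phi i x - phi i (iota (pr v m)) =
      (phi i x - X i v) - (phi i (iota (pr v m)) - X i v) by rewrite opprB addrA subrK.
  apply: le_trans (magD _ _) _; rewrite magN lerD2l; exact: Xpr.
move: mP; rewrite ltr_pdivlMr //; move: (proj1 (andP t01)) h3; move: (m.+1%:R^-1) => t t0 h3.
rewrite mulrDr mulr1 mulrC; lra.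
Qed.

(** [X n] extends [phi n], restricted to the kernel of [p], to l^2 through the projection onto the
    image of that kernel. Then [phi n - X n \o J] vanishes on the kernel and descends to [chi n].
    The domination survives because [P0] is constant on cosets and may be evaluated at [x] minus its
    approximate projection, where [hs_residual] applies. *)
Lemma hs_quotient E Q (p : clin E Q) : open_surjection p ->
  hs_condition E -> hs_condition Q.
Proof.
move=> po hE P Pc; pose P0 x := P (p x); have P0c : cont_seminorm P0 by exact: csn_comp.
have [q [phi [a [qc hphi]]]] := hE P0 P0c.
have [r [psi [b [rc hpsi]]]] := hE q qc.
have [phil a0 phia [M aM] Pphi] := hphi.
have [V [inc [f [ff inj rg nle nub]]]] := square_summable_space R c.
have [J [C [Jl JE C0 Jr qJ]]] := hs_to_l2 ff inj rg nle nub (proj1 qc) (proj1 rc) hpsi.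
have [W [iota [iinj iS]]] := sub_lmodule (ker_submod p).
have piota w : p (iota w) = 0 by have : range iota (iota w) by []; rewrite iS.
have Jil : linear (J \o iota) by move=> l x y /=; rewrite linearP Jl.
have [pr prP] := approx_projection ff Jil.
have ap := projection_approximation ff Jil prP.
have exX n : exists X : V -> k^o, [/\ linear X,
    forall v m, mag (phi n (iota (pr v m)) - X v : k) <= a n * m.+1%:R^-1,
    forall w, X (J (iota w)) = phi n (iota w) & forall v, mag (X v : k) <= a n * form_norm f v].
  apply: (scalar_extension (L := phi n \o iota) ap) => //.
    by move=> l x y /=; rewrite linearP phil.
  by move=> w /=; apply: le_trans (phia n _) _; apply: ler_wpM2l.
have [X XP] := choice exX.
pose D x := q x + form_norm f (J x).
have XD x n : mag (phi n x - X n (J x) : k) <= a n * D x.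
  apply: le_trans (magD _ _) _; rewrite magN mulrDr; apply: lerD; first exact: phia.
  by have [_ _ _] := XP n; apply.
have D0 x : 0 <= D x by rewrite addr_ge0 ?form_norm_ge0 // (rsn_ge0 _ (proj1 qc)).
have [sec secE] := choice (proj1 po).
pose chi n y : k^o := phi n (sec y) - X n (J (sec y)).
have chiE n x : chi n (p x) = phi n x - X n (J x).
  have : range iota (sec (p x) - x) by rewrite iS /= clin_B secE subrr.
  move=> [w _ wE]; have [Xl _ XJ _] := XP n; rewrite /chi.
  have -> : sec (p x) = 1 *: iota w + x by rewrite scale1r wE subrK.
  by rewrite phil Jl Xl !scale1r XJ opprD addrACA subrr add0r.
(* [D x = q x + form_norm f (J x)] is at most twice the second term, which is at most [C * r x]. *)
exists (quotient_seminorm p (fun x => 2 * C * r x)), chi, a; split.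
  by apply: csn_quotient => //; apply: csn_scale rc; rewrite mulr_ge0.
split=> //; last 2 first.
- by exists M.
- move=> y e e0; have [x xE] := proj1 po y; rewrite -xE.
  have Xpr n v m : mag (phi n (iota (pr v m)) - X n v : k) <= a n * m.+1%:R^-1.
    by have [_ h _ _] := XP n; exact: h.
  have [m mP] := hs_residual (proj1 P0c) hphi Xpr (D0 x) (XD x) e0.
  have [K KP] := mP m (leqnn m); exists K; have := KP K (leqnn K).
  rewrite /P0 clin_B piota subr0 => /le_trans; apply; rewrite lerD2r.
  by apply: ler_sum => i _; rewrite chiE.
- move=> n l y z; have [x <-] := proj1 po y; have [w <-] := proj1 po z.
  rewrite -clin_Z -clin_D !chiE; have [Xl _ _ _] := XP n.
  by rewrite phil Jl Xl scalerBr opprD addrACA.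
- move=> n y; have rs := proj1 rc.
  apply/ler_addgt0Pr => e e0.
  have e1 : 0 < e / (a n + 1) by rewrite divr_gt0 // ltr_wpDl.
  have [|x xE hx] := @qsn_lt R c E Q p (fun x => 2 * C * r x) (proj1 po) y
    (quotient_seminorm p (fun x => 2 * C * r x) y + e / (a n + 1)).
    by rewrite ltrDl.
  rewrite -{1}xE chiE; apply: le_trans (XD x n) _.
  have h1 : D x <= 2 * C * r x.
    by rewrite /D; have := qJ x; have := Jr x; lra.
  apply: le_trans (ler_wpM2l (a0 n) (le_trans h1 (ltW hx))) _.
  rewrite mulrDr lerD2l mulrA ler_pdivrMr ?ltr_wpDl // mulrDr mulr1 mulrC; lra.
Qed.

End HilbertSchmidtQuotient.

(** * Nuclear spaces *)

Section Completion.
Variables (R : realType) (c : scalar_kind).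
Local Notation k := (scalar_field R c).
Local Notation emb := (@emb R c).

Definition rnorm (N : normedModType k) (x : N) : R := mag `|x|.

Lemma rnormE (N : normedModType k) (x : N) : `|x| = emb (rnorm x).
Proof. by rewrite emb_mag. Qed.

Lemma rnorm_seminorm (N : normedModType k) : real_seminorm (@rnorm N).
Proof. exact: norm_seminorm. Qed.

Lemma rnorm_eq0 (N : normedModType k) (x : N) : rnorm x = 0 -> x = 0.
Proof. by move=> x0; apply/eqP; rewrite -normr_eq0 rnormE x0 emb0. Qed.

Lemma rnorm_cauchy (N : normedModType k) (u : nat -> N) :
  tvs_cauchy (u : nat -> (N : topologicalLmodType k)) <-> scauchy (@rnorm N) u.
Proof.
split=> [cu e e0|cu A /normed_nbhs0[e e0 eA]].
  by apply: (cu [set x | rnorm x < e]); apply/normed_nbhs0; exists e.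
by have [M MP] := cu e e0; exists M => m n hm hn; apply: eA; exact: MP.
Qed.

Lemma rnorm_lim (N : normedModType k) (u : nat -> N) l :
  tvs_lim u (l : (N : topologicalLmodType k)) <-> slim (@rnorm N) u l.
Proof.
split=> [cu e e0|cu A /normed_nbhs0[e e0 eA]].
  by apply: (cu [set x | rnorm x < e]); apply/normed_nbhs0; exists e.
by have [M MP] := cu e e0; exists M => m hm; apply: eA; exact: MP.
Qed.

Lemma slim_cvg (N : normedModType k) (u : nat -> N) l : slim (@rnorm N) u l -> u @ \oo --> l.
Proof.
move=> ul; apply/cvgrPdist_lt => e /emb_gt0[e0 eE]; have [M MP] := ul _ e0.
exists M => // n /MP h.
by rewrite rnormE -eE ltr_emb -(rsn_N _ (@rnorm_seminorm N)) opprB.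
Qed.

Lemma cvg_slim (N : normedModType k) (u : nat -> N) l : u @ \oo --> l -> slim (@rnorm N) u l.
Proof.
move=> /cvgrPdist_lt ul e e0; have [|M _ MP] := ul (emb e).
  by rewrite -(emb0 R c) ltr_emb.
exists M => n Mn; have := MP n Mn.
by rewrite /= rnormE ltr_emb -(rsn_N _ (@rnorm_seminorm N)) opprB.
Qed.

Lemma banach_complete (B : completeNormedModType k) (u : nat -> B) :
  scauchy (@rnorm B) u -> exists l, slim (@rnorm B) u l.
Proof.
move=> /rnorm_cauchy cu; have [l lP] := complete_seq (@complete_normed R c B) cu.
by exists l; apply/rnorm_lim.
Qed.

Lemma normed_countably_seminormed (N : normedModType k) :
  countably_seminormed (N : topologicalLmodType k).
Proof.
exists (fun n x => n.+1%:R * rnorm x); split=> [n|U /normed_nbhs0[e e0 eU]].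
  by apply: csn_scale => //; split; [exact: rnorm_seminorm|apply/normed_nbhs0; exists 1].
exists (Num.truncn e^-1) => x /= h1; apply: eU => /=.
have h3 : e^-1 < (Num.truncn e^-1).+1%:R by exact: truncnS_gt.
have h4 : 1 < (Num.truncn e^-1).+1%:R * e by rewrite -ltr_pdivrMr // mul1r.
by rewrite -(@ltr_pM2l _ (Num.truncn e^-1).+1%:R) //; exact: lt_trans h1 h4.
Qed.

Lemma complete_banach (N : normedModType k) :
  (forall u, scauchy (@rnorm N) u -> exists l, slim (@rnorm N) u l) ->
  complete_tvs (N : topologicalLmodType k).
Proof.
move=> h; apply: seq_complete; first exact: normed_countably_seminormed.
by move=> u /rnorm_cauchy/h[l lP]; exists l; apply/rnorm_lim.
Qed.

Lemma seminormed_quotient (V : lmodType k) (p : V -> R) : real_seminorm p ->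
  exists (N : normedModType k) (j : {linear V -> N}),
    (forall y, exists x, j x = y) /\ forall x, rnorm (j x) = p x.
Proof.
move=> ps; have kersub : is_submod [set x | p x = 0].
  split=> [|a x y /= px py]; first exact: rsn_0.
  apply/eqP; rewrite eq_le rsn_ge0 // andbT; apply: le_trans (rsn_D _ _ ps) _.
  by rewrite (rsn_Z _ _ ps) px py mulr0 addr0.
have [Q [j0 [surj ker]]] := quotient_lmodule kersub.
have [sec secE] := choice surj; pose n y := p (sec y).
have nE x : n (j0 x) = p x.
  have := secE (j0 x) => /eqP; rewrite -subr_eq0 -linearB => /eqP/ker /= h.
  apply/eqP; rewrite eq_le /n; have := rsn_dist x (sec (j0 x)) ps.
  have := rsn_dist (sec (j0 x)) x ps; rewrite (rsn_subC x _ ps) h !addr0.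
  by move=> -> ->.
have [|||N [j [[j' jK j'K] jn]]] := @exists_normed k Q (fun y => emb (n y)).
- move=> y z; rewrite -embD ler_emb; have [x <-] := surj y; have [w <-] := surj z.
  by rewrite -linearD !nE; exact: rsn_D.
- move=> a y; have [x <-] := surj y; rewrite -linearZ !nE (rsn_Z _ _ ps) embM.
  by rewrite normE.
- move=> y; have [x <-] := surj y; rewrite nE -(emb0 R c) => /emb_inj px.
  by apply/ker.
exists N, (j \o j0); split=> [y|x].
  by have [x xE] := surj (j' y); exists x; rewrite /= xE j'K.
by rewrite /rnorm /= jn nE mag_emb ger0_norm // rsn_ge0.
Qed.

Lemma complete_seminormed_quotient (V : lmodType k) (p : V -> R) : real_seminorm p ->
  (forall u, scauchy p u -> exists l, slim p u l) ->
  exists (B : completeNormedModType k) (j : {linear V -> B}),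
    (forall y, exists x, j x = y) /\ forall x, rnorm (j x) = p x.
Proof.
move=> ps cp; have [N [j [surj jn]]] := seminormed_quotient ps.
have cN : complete_tvs (N : topologicalLmodType k).
  apply: complete_banach => u cu; have [v vE] := choice (fun n => surj (u n)).
  have [|l lP] := cp v.
    by move=> e /cu[M MP]; exists M => m n hm hn; rewrite -jn linearB !vE; exact: MP.
  by exists (j l) => e /lP[M MP]; exists M => n hn; rewrite -vE -linearB jn; exact: MP.
have [B [i [[i' iK i'K] inorm]]] := exists_complete_normed cN.
exists B, (i \o j); split=> [y|x].
  by have [x xE] := surj (i' y); exists x; rewrite /= xE i'K.
by rewrite -jn /rnorm /= inorm.
Qed.

(** Cauchy sequences modulo null sequences: [P w] is the limit of [p (w n)], and dividing by its
    kernel is left to [complete_seminormed_quotient]. *)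
Lemma completion (E : lmodType k) (p : E -> R) : real_seminorm p ->
  exists (B : completeNormedModType k) (j : {linear E -> B}),
    (forall x, rnorm (j x) = p x) /\ forall b e, 0 < e -> exists x, rnorm (b - j x) < e.
Proof.
move=> ps; pose S := [set w : nat -> E | scauchy p w].
have Ssub : is_submod S.
  split=> [|a x y hx hy e e0].
    by move=> e e0; exists 0%N => m n _ _; rewrite subrr (rsn_0 ps).
  have m0 : 0 < mag a + 1 by have := mag_ge0 a; lra.
  have e2 : 0 < e / 2 by rewrite divr_gt0.
  have [M MP] := hx _ (divr_gt0 e2 m0); have [M' MP'] := hy _ e2; exists (maxn M M') => m n.
  rewrite !geq_max => /andP[m1 m2] /andP[n1 n2].
  change (p ((a *: x m + y m) - (a *: x n + y n)) < e).
  rewrite opprD addrACA -scalerBr; apply: le_lt_trans (rsn_D _ _ ps) _.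
  rewrite (rsn_Z _ _ ps); have := MP m n m1 n1; rewrite ltr_pdivlMr // => h1.
  have h2 := MP' m n m2 n2; have := rsn_ge0 (x m - x n) ps; lra.
have [V [inc [inj rg]]] := sub_lmodule Ssub.
have incS w : scauchy p (inc w) by have : range inc (inc w) by []; rewrite rg.
have toV w : scauchy p w -> exists v, inc v = w.
  by move=> h; have : range inc w; [rewrite rg|move=> [v _ vE]; exists v].
have limP (w : V) : exists l : R, slim Num.norm (fun n => p (inc w n)) l.
  apply: real_complete => e /(incS w)[M MP]; exists M => m n hm hn.
  have := rsn_dist (inc w m) (inc w n) ps; have := rsn_dist (inc w n) (inc w m) ps.
  rewrite (rsn_subC (inc w n) _ ps) => h1 h2; have := MP m n hm hn.
  by rewrite ltr_norml => h; apply/andP; split; lra.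
have [P PP] := choice limP.
have Ple w B : (forall e, 0 < e -> exists M, forall n, (M <= n)%N -> p (inc w n) <= B + e) -> P w <= B.
  move=> h; apply/ler_addgt0Pr => e e0; have e2 : 0 < e / 2 by rewrite divr_gt0.
  have [M MP] := h _ e2; have [M' MP'] := PP w _ e2.
  have := MP _ (leq_maxl M M'); have := MP' _ (leq_maxr M M').
  rewrite ltr_norml => /andP[h1 h2] h3; lra.
have leP w B : (exists M, forall n, (M <= n)%N -> B <= p (inc w n)) -> B <= P w.
  move=> [M MP]; apply/ler_addgt0Pr => e e0; have [M' MP'] := PP w _ e0.
  have := MP _ (leq_maxl M M'); have := MP' _ (leq_maxr M M').
  rewrite ltr_norml => /andP[h1 h2] h3; lra.
have Pnear w e : 0 < e -> exists M, forall n, (M <= n)%N -> p (inc w n) <= P w + e.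
  move=> e0; have [M MP] := PP w _ e0; exists M => n /MP.
  by rewrite ltr_norml => /andP[h1 h2]; lra.
have P_ge0 w : 0 <= P w by apply: leP; exists 0%N => n _; exact: rsn_ge0.
have Pc x v : inc v = (fun=> x) -> P v = p x.
  move=> vE; apply/eqP; rewrite eq_le; apply/andP; split.
    by apply: Ple => e e0; exists 0%N => n _; rewrite vE; lra.
  by apply: leP; exists 0%N => n _; rewrite vE.
have Ps : real_seminorm P.
  apply: rsn_intro => //.
  - move=> x y; apply: Ple => e e0; have e2 : 0 < e / 2 by rewrite divr_gt0.
    have [M MP] := Pnear x _ e2; have [M' MP'] := Pnear y _ e2; exists (maxn M M') => n.
    rewrite geq_max => /andP[/MP h1 /MP' h2]; rewrite linearD.
    change (p (inc x n + inc y n) <= P x + P y + e).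
    have := rsn_D (inc x n) (inc y n) ps; lra.
  - by rewrite (Pc 0) ?(rsn_0 ps) // linear0.
  - move=> a x _; apply: Ple => e e0; have m0 : 0 < mag a + 1 by have := mag_ge0 a; lra.
    have [M MP] := Pnear x _ (divr_gt0 e0 m0); exists M => n /MP h; rewrite linearZ.
    change (p (a *: inc x n) <= mag a * P x + e); rewrite (rsn_Z _ _ ps).
    apply: le_trans (ler_wpM2l (mag_ge0 a) h) _; rewrite mulrDr lerD2l.
    rewrite mulrA ler_pdivrMr // mulrDr mulr1 mulrC; lra.
have cst x : exists v, inc v = (fun=> x).
  by apply: toV => e e0; exists 0%N => m n _ _; rewrite subrr (rsn_0 ps).
have [kap kapE] := choice cst.
have near w e : 0 < e -> exists x, P (w - kap x) <= e.
  move=> e0; have [M MP] := incS w _ e0; exists (inc w M); apply: Ple => d d0; exists M => n hn.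
  rewrite linearB kapE; change (p (inc w n - inc w M) <= e + d).
  by have := MP n M hn (leqnn M); lra.
have pP x y : p (x - y) = P (kap x - kap y).
  by rewrite (Pc (x - y)) // linearB !kapE.
have [|B [j [surj jn]]] := @complete_seminormed_quotient V P Ps.
(* Diagonal argument: [w n] is replaced by a constant sequence [z n] within [1 / (n + 1)]; the
   sequence [z] is then itself Cauchy and represents the limit. *)
- move=> w cw; have [z zP] := choice (fun n => near (w n) n.+1%:R^-1 (ltac:(by rewrite invr_gt0))).
  have zc : scauchy p z.
    move=> e e0; have e3 : 0 < e / 3 by rewrite divr_gt0.
    have [M MP] := cw _ e3; have [M' MP'] := inv_small e3; exists (maxn M M') => m n.
    rewrite !geq_max => /andP[m1 m2] /andP[n1 n2]; rewrite pP.
    have := rsn_tri (w m) (kap (z m)) (kap (z n)) Ps.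
    have := rsn_tri (w n) (w m) (kap (z n)) Ps.
    rewrite (rsn_subC (kap (z m)) (w m) Ps).
    have := zP m; have := zP n; have := MP m n m1 n1; have := MP' m m2; have := MP' n n2.
    move: (m.+1%:R^-1) (n.+1%:R^-1) => t r; lra.
  have [l lE] := toV z zc; exists l => e e0; have e3 : 0 < e / 3 by rewrite divr_gt0.
  have [M MP] := zc _ e3; have [M' MP'] := inv_small e3; exists (maxn M M') => n.
  rewrite geq_max => /andP[n1 n2]; have h1 := zP n; have h2 := MP' n n2.
  have h3 : P (kap (z n) - l) <= e / 3.
    apply: Ple => d d0; exists M => i hi; rewrite linearB kapE lE.
    change (p (z n - z i) <= e / 3 + d); have := MP n i n1 hi; lra.
  have := rsn_tri (kap (z n)) (w n) l Ps; move: h1 h2; move: (n.+1%:R^-1) => t; lra.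
have jkl : linear (fun x => j (kap x)).
  move=> a x y; rewrite -linearP; congr (j _); apply: inj; rewrite linearP !kapE.
  by apply/funext.
pose m := GRing.isLinear.Build k E B *:%R _ jkl.
pose J : {linear E -> B} := HB.pack (fun x => j (kap x)) m.
exists B, J; split=> [x|b e e0].
  by change (rnorm (j (kap x)) = p x); rewrite jn; exact: Pc.
have [w <-] := surj b; have e2 : 0 < e / 2 by rewrite divr_gt0.
have [x xP] := near w _ e2; exists x; change (rnorm (j w - j (kap x)) < e).
rewrite -linearB jn; lra.
Qed.

Lemma dense_approximation (E : lmodType k) (B : normedModType k) (p : E -> R) (j : {linear E -> B}) :
  (forall x, rnorm (j x) = p x) -> (forall b e, 0 < e -> exists x, rnorm (b - j x) < e) ->
  exists pr : B -> nat -> E, approximation (@rnorm B) p j pr.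
Proof.
move=> jn dj; have ns := @rnorm_seminorm B.
have h (bn : B * nat) : exists x, rnorm (bn.1 - j x) < bn.2.+1%:R^-1.
  by apply: dj; rewrite invr_gt0.
have [pr0 pr0P] := choice h; pose pr b n := pr0 (b, n).
have prP b n : rnorm (b - j (pr b n)) <= n.+1%:R^-1 by exact/ltW/(pr0P (b, n)).
exists pr; split=> [v m n|a v w n|v n|x n].
- rewrite -jn linearB; have := rsn_tri v (j (pr v m)) (j (pr v n)) ns.
  rewrite (rsn_subC (j (pr v m)) v ns).
  by move=> /le_trans; apply; apply: lerD; exact: prP.
- rewrite -jn linearB linearP.
  have := rsn_tri (a *: v + w) (j (pr (a *: v + w) n)) (a *: j (pr v n) + j (pr w n)) ns.
  rewrite (rsn_subC (j _) (a *: v + w) ns).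
  have -> : a *: v + w - (a *: j (pr v n) + j (pr w n)) = a *: (v - j (pr v n)) + (w - j (pr w n)).
    by rewrite opprD addrACA -scalerBr.
  have := rsn_D (a *: (v - j (pr v n))) (w - j (pr w n)) ns; rewrite (rsn_Z _ _ ns).
  have := ler_wpM2l (mag_ge0 a) (prP v n); have := prP w n; have := prP (a *: v + w) n.
  rewrite mulrDl; move: (n.+1%:R^-1) => t; lra.
- rewrite -jn; have := rsn_dist (j (pr v n)) v ns; rewrite (rsn_subC _ v ns).
  have := prP v n; move: (n.+1%:R^-1) => t; lra.
- by rewrite -jn linearB (rsn_subC _ _ ns); exact: prP.
Qed.

End Completion.

(** * Nuclear operators and square-summable functionals *)

Section Nuclear.
Variables (R : realType) (c : scalar_kind).
Local Notation k := (scalar_field R c).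
Local Notation emb := (@emb R c).
Implicit Types E F G Q : topologicalLmodType k.

Lemma weighted_cauchy_schwarz (l t : nat -> R) N : (forall n, 0 <= l n) ->
  (\sum_(n < N) l n * t n) ^+ 2 <= (\sum_(n < N) l n) * \sum_(n < N) l n * t n ^+ 2.
Proof.
move=> l0; elim: N => [|N]; first by rewrite !big_ord0 mul0r expr0n.
rewrite !big_ord_recr /=.
have A0 : 0 <= \sum_(n < N) l n by rewrite sumr_ge0.
have Q0 : 0 <= \sum_(n < N) l n * t n ^+ 2.
  by rewrite sumr_ge0 // => n _; rewrite mulr_ge0 ?sqr_ge0.
move: (\sum_(n < N) l n * t n) (\sum_(n < N) l n) (\sum_(n < N) l n * t n ^+ 2) A0 Q0.
move=> B A Q A0 Q0 h; have x0 := l0 N; move: (l N) (t N) x0 => x y x0.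
(* The induction hypothesis [B ^+ 2 <= A * Q] is the discriminant condition for this quadratic in
   [y]; for [A = 0] it forces [B = 0]. *)
have key : 2 * B * y <= A * y ^+ 2 + Q.
  have [A00|An0] := eqVneq A 0.
    have B0 : B = 0.
      by apply/eqP; rewrite -sqrf_eq0 eq_le sqr_ge0 andbT; apply: le_trans h _; rewrite A00 mul0r.
    by rewrite B0 A00 mulr0 !mul0r add0r.
  have Ap : 0 < A by rewrite lt_neqAle eq_sym An0.
  rewrite -(ler_pM2l Ap); have := sqr_ge0 (A * y - B); nra.
have := ler_wpM2l x0 key; nra.
Qed.

Lemma bounded_of_cvg (u : nat -> R) (l : k) : (forall n, 0 <= u n) ->
  slim (@mag R c : k^o -> R) (fun N => emb (\sum_(n < N) u n)) l ->
  exists2 M, 0 <= M & forall N, \sum_(n < N) u n <= M.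
Proof.
move=> u0 /(_ 1 ltr01)[M MP]; exists (mag l + 1); first by have := mag_ge0 l; lra.
move=> N; have mono m n : (m <= n)%N -> \sum_(i < m) u i <= \sum_(i < n) u i.
  move=> /subnK <-; elim: (n - m)%N => [|d IH] //; apply: le_trans IH _.
  by rewrite addSn big_ord_recr /= lerDl.
apply: le_trans (mono _ _ (leq_maxl N M)) _.
have := MP _ (leq_maxr N M); have := magD (emb (\sum_(n < maxn N M) u n) - l) l.
rewrite subrK mag_emb ger0_norm ?sumr_ge0 //; lra.
Qed.

Lemma k_cvg_slim (u : nat -> k) (l : k) : u @ \oo --> l <-> slim (@mag R c : k^o -> R) u l.
Proof.
have e (z : k) : rnorm (z : k^o) = mag z by rewrite /rnorm [`|z|]normE mag_emb ger0_norm ?mag_ge0.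
have eq : (@rnorm R c k^o : k^o -> R) = @mag R c by apply/funext => z; exact: e.
split=> h; first by rewrite -eq; apply: (@cvg_slim R c k^o).
by rewrite -eq in h; exact: (@slim_cvg R c k^o _ _ h).
Qed.

(** From the nuclear expansion, [p x] is at most the sum of [|l n| |f n (jq x)|]. Cauchy-Schwarz
    with weights [|l n|] bounds its square by [Lam] times the sum of [|l n| |f n (jq x)| ^ 2], so
    the functionals are [f n \o jq] scaled by [sqrt (Lam |l n|)]. *)
Lemma nuclear_hs E : nuclear E -> hs_condition E.
Proof.
move=> [_ nucE] p pc; have [q [qc _]] := nucE _ (csn_seminorm pc).
move=> [Bq [Bp [jq [jp [T [[jqE _] [jpE _] _ TE]]]]]] [l [f [y [/cvg_ex[L Ll] fle yle Tsum]]]].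
have [qrc qE] := continuous_csn qc.
have jpn x : rnorm (jp x) = p x.
  by rewrite /rnorm jpE mag_emb ger0_norm // rsn_ge0; case: pc.
have fn n x : mag (f n (jq x) : k) <= mag (q x).
  by rewrite -(ler_emb c) -normE -qE -jqE; exact: fle.
have [Lam Lam0 lL] : exists2 M, 0 <= M & forall N, \sum_(n < N) mag (l n) <= M.
  apply: (@bounded_of_cvg (fun n => mag (l n)) L) => [n|]; first exact: mag_ge0.
  have := (k_cvg_slim _ _).1 Ll; congr (slim _ _ _); apply/funext => N.
   rewrite /series /= big_mkord emb_sum; apply: eq_bigr => i _.
  by rewrite normE.
exists (fun x => mag (q x)), (fun n x => (emb (Num.sqrt (Lam * mag (l n))) * f n (jq x) : k)),
  (fun n => Num.sqrt (Lam * mag (l n))); split=> //; split.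
- move=> n a x z; rewrite !linearP /= mulrDr; congr (_ + _).
  by change (emb (Num.sqrt (Lam * mag (l n))) * (a * f n (jq x)) =
    a * (emb (Num.sqrt (Lam * mag (l n))) * f n (jq x))); rewrite mulrCA.
- by move=> n; exact: sqrtr_ge0.
- move=> n x; rewrite magM mag_emb ger0_norm ?sqrtr_ge0 //.
  by apply: ler_wpM2l; rewrite ?sqrtr_ge0.
- exists (Lam * Lam) => N.
  rewrite (eq_bigr (fun n : 'I_N => Lam * mag (l n))); last first.
    by move=> n _; rewrite sqr_sqrtr // mulr_ge0 ?mag_ge0.
  by rewrite -mulr_sumr; apply: ler_wpM2l (lL N).
move=> x e e0; pose t n := mag (f n (jq x) : k).
have sumE N : \sum_(n < N) mag (emb (Num.sqrt (Lam * mag (l n))) * f n (jq x) : k) ^+ 2 =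
    Lam * \sum_(n < N) mag (l n) * t n ^+ 2.
  rewrite mulr_sumr; apply: eq_bigr => n _; rewrite magM exprMn mag_emb ger0_norm ?sqrtr_ge0 //.
  by rewrite sqr_sqrtr ?mulr_ge0 ?mag_ge0 // -mulrA.
pose B := Lam * mag (q x); have B0 : 0 <= B by rewrite mulr_ge0 ?mag_ge0.
(* Chosen so that [(A + d) ^+ 2 <= A ^+ 2 + e] for every [A] between 0 and [B]. *)
pose d := Num.min 1 (e / (2 * B + 1)).
have C0 : 0 < 2 * B + 1 by lra.
have d0 : 0 < d by rewrite lt_min ltr01 divr_gt0.
have d1 : d <= 1 by rewrite ge_min lexx.
have de : d * (2 * B + 1) <= e by rewrite -ler_pdivlMr // ge_min lexx orbT.
have [N NP] := cvg_slim (Tsum (jq x)) d0; exists N; rewrite sumE.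
set A := \sum_(n < N) mag (l n) * t n.
have AB : A <= B.
  apply: (@le_trans _ _ (\sum_(n < N) mag (l n) * mag (q x))).
    by apply: ler_sum => n _; rewrite ler_wpM2l ?mag_ge0 // fn.
  by rewrite -mulr_suml; apply: ler_wpM2r; rewrite ?mag_ge0.
have A0 : 0 <= A by rewrite sumr_ge0 // => n _; rewrite mulr_ge0 ?mag_ge0.
have pA : p x <= A + d.
  rewrite -jpn -TE; have ns := @rnorm_seminorm R c Bp.
  have := rsn_dist (T (jq x)) (series (fun n => l n *: (f n (jq x) *: y n)) N) ns.
  rewrite (rsn_subC (T _) _ ns); have := NP N (leqnn N) => h1 h2.
  suff : rnorm (series (fun n => l n *: (f n (jq x) *: y n)) N) <= A by lra.
  rewrite /series /= big_mkord /A; elim: (N) => [|n IH].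
    by rewrite !big_ord0 (rsn_0 ns).
  rewrite !big_ord_recr /=; apply: le_trans (rsn_D _ _ ns) _; apply: lerD => //.
  rewrite !(rsn_Z _ _ ns); apply: ler_wpM2l; first exact: mag_ge0.
  rewrite -[leRHS]mulr1; apply: ler_wpM2l; first exact: mag_ge0.
  by rewrite -(ler_emb c) -rnormE emb1.
have p0 : 0 <= p x by apply: rsn_ge0; case: pc.
have h1 : p x ^+ 2 <= (A + d) ^+ 2 by rewrite ler_pXn2r ?nnegrE //; lra.
have h2 : A ^+ 2 <= Lam * \sum_(n < N) mag (l n) * t n ^+ 2.
  apply: le_trans (@weighted_cauchy_schwarz (fun n => mag (l n)) t N (fun n => mag_ge0 _)) _.
  by apply: ler_wpM2r => //; rewrite sumr_ge0 // => n _; rewrite mulr_ge0 ?mag_ge0 ?sqr_ge0.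
have h3 : A * d <= B * d by rewrite ler_wpM2r // ltW.
have h4 : d * d <= 1 * d by rewrite ler_wpM2r // ltW.
have -> : Lam * (\sum_(n < N) mag (l n) * t n ^+ 2) + e =
  Lam * (\sum_(n < N) mag (l n) * t n ^+ 2) + e by [].
have h5 : (A + d) ^+ 2 = A ^+ 2 + 2 * (A * d) + d * d by ring.
have h6 : d * (2 * B + 1) = 2 * (B * d) + 1 * d by ring.
lra.
Qed.

Section NuclearSum.
Variables (X Y : completeNormedModType k) (l : nat -> R) (f : nat -> {linear X -> k^o}) (y : nat -> Y).
Hypotheses (l_ge0 : forall n, 0 <= l n) (f_le : forall n x, mag (f n x : k) <= rnorm x)
  (y_le : forall n, rnorm (y n) <= 1).
Variable (M : R).
Hypothesis l_sum : forall N, \sum_(n < N) l n <= M.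

Lemma nuclear_sum : exists T : {linear X -> Y},
  (forall x, slim (@rnorm R c Y) (fun N => \sum_(n < N) emb (l n) *: (f n x *: y n)) (T x)) /\
  continuous T.
Proof.
have ns := @rnorm_seminorm R c Y.
have M0 : 0 <= M by have := l_sum 0%N; rewrite big_ord0.
have term n x : rnorm (emb (l n) *: (f n x *: y n)) <= l n * rnorm x.
  rewrite !(rsn_Z _ _ ns) mag_emb ger0_norm //; apply: ler_wpM2l => //.
  rewrite -[leRHS]mulr1; apply: ler_pM => //; first exact: mag_ge0.
  exact: (rsn_ge0 _ ns).
have sums x N : \sum_(n < N) rnorm (emb (l n) *: (f n x *: y n)) <= M * rnorm x.
  apply: (@le_trans _ _ (\sum_(n < N) l n * rnorm x)); first by apply: ler_sum => n _.
  by rewrite -mulr_suml; apply: ler_wpM2r => //; exact: mag_ge0.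
have [T TP] := choice (fun x => banach_complete (@bounded_series_cauchy R c Y _ ns (fun n => emb (l n) *: (f n x *: y n)) _ (sums x))).
have Tl : linear T.
  move=> a x z; apply: (slim_unique ns (@rnorm_eq0 R c Y) (TP _)).
  have := slimD ns (slimZ ns a (TP x)) (TP z); congr (slim _ _ _); apply/funext => N.
  rewrite scaler_sumr -big_split; apply: eq_bigr => n _ /=.
  rewrite linearP scalerDl scalerDr; congr (_ + _).
  by rewrite !scalerA; congr (_ *: _); rewrite -[a *: f n x]/(a * (f n x : k)); ring.
have Tb x : rnorm (T x) <= M * rnorm x.
  apply: (slim_bounded ns (TP x)) => N; apply: le_trans (sums x N).
  elim: N => [|N IH]; first by rewrite !big_ord0 (rsn_0 ns).
  by rewrite !big_ord_recr /=; apply: le_trans (rsn_D _ _ ns) _; rewrite lerD2r.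
pose m := GRing.isLinear.Build k X Y *:%R _ Tl.
pose T' : {linear X -> Y} := HB.pack T m; exists T'; split=> //.
apply/(linear_continuousP Tl) => A /normed_nbhs0[e e0 eA]; apply/normed_nbhs0.
have M1 : 0 < M + 1 by lra.
exists (e / (M + 1)); first by rewrite divr_gt0.
move=> x /= h; apply: eA; apply: le_lt_trans (Tb x) _.
have h2 : rnorm x < e / (M + 1) by []. 
have h3 : 0 <= rnorm x by exact: mag_ge0.
by rewrite ltr_pdivlMr // in h2; lra.
Qed.

End NuclearSum.

End Nuclear.

Section SequenceVectors.
Variables (R : realType) (c : scalar_kind).
Local Notation k := (scalar_field R c).
Local Notation emb := (@emb R c).
Local Notation conj := (@scalar_conj R c).
Variables (V : lmodType k) (inc : {linear V -> (nat -> k^o)}) (f : V -> V -> k).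
Hypotheses (ff : psd_form f) (inj : injective inc) (rg : range inc = @square_summable R c)
  (nle : forall x N, sqsum (inc x) N <= form_norm f x ^+ 2)
  (nub : forall x B, (forall N, sqsum (inc x) N <= B) -> form_norm f x ^+ 2 <= B).

Definition unit_seq (m : nat) : nat -> k^o := fun i => (i == m)%:R.

Lemma unit_vectors : exists e : nat -> V, forall m, inc (e m) = unit_seq m.
Proof.
suff h m : exists v, inc v = unit_seq m by have [e eP] := choice h; exists e.
suff : range inc (unit_seq m) by move=> [v _ vE]; exists v.
rewrite rg; exists 1 => N; rewrite /sqsum; elim: N => [|N IH]; first by rewrite big_ord0.
rewrite big_ord_recr /= /unit_seq; have [->|_] := eqVneq N m; last first.
  by rewrite mag0 expr0n addr0.
rewrite big1 ?add0r ?mag1 ?expr1n // => i _.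
by rewrite ltn_eqF // mag0 expr0n.
Qed.

Variables (e : nat -> V) (eE : forall m, inc (e m) = unit_seq m).

Definition truncation (w : nat -> k^o) (M : nat) : V := \sum_(m < M) (w m : k) *: e m.

Lemma truncationE w M i : inc (truncation w M) i = if (i < M)%N then w i else 0.
Proof.
elim: M => [|M IH]; first by rewrite /truncation big_ord0 linear0.
rewrite /truncation big_ord_recr /= linearD linearZ eE.
change ((inc (truncation w M) i : k) + (w M : k) * (i == M)%:R =
  if (i < M.+1)%N then w i else 0).
rewrite IH ltnS (leq_eqVlt i M); have [->|iM] := eqVneq i M.
  by rewrite ltnn add0r mulr1.
by rewrite mulr0 addr0.
Qed.

Lemma truncation_norm w M :
  form_norm f (truncation w M) ^+ 2 <= \sum_(m < M) mag (w m : k) ^+ 2.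
Proof.
apply: nub => N; apply: le_trans (sqsum_mono _ (leq_addl M N)) _.
elim: N => [|N IH].
  rewrite addn0; apply: ler_sum => i _; by rewrite truncationE ltn_ord.
rewrite addnS /sqsum big_ord_recr /= truncationE.
by rewrite ltnNge leq_addr mag0 expr0n addr0.
Qed.

Lemma truncation_cvg v d : 0 < d -> exists M, forall n, (M <= n)%N ->
  form_norm f (v - truncation (inc v) n) < d.
Proof.
move=> d0; have [M MP] : exists M, form_norm f v ^+ 2 - d ^+ 2 < sqsum (inc v) M.
  apply: contrapT => no; have := nub (x := v) (B := form_norm f v ^+ 2 - d ^+ 2).
  have h : forall N, sqsum (inc v) N <= form_norm f v ^+ 2 - d ^+ 2.
    by move=> N; rewrite leNgt; apply/negP => h; apply: no; exists N.
  by move=> /(_ h); have := exprn_gt0 2 d0; lra.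
exists M => n Mn; rewrite -(@ltr_pXn2r _ 2) ?nnegrE ?form_norm_ge0 ?(ltW d0) //.
have key : form_norm f (v - truncation (inc v) n) ^+ 2 <= form_norm f v ^+ 2 - sqsum (inc v) n.
  apply: nub => N; apply: le_trans (sqsum_mono _ (leq_addl n N)) _.
  suff h : sqsum (inc (v - truncation (inc v) n)) (n + N) = sqsum (inc v) (n + N) - sqsum (inc v) n.
    by rewrite h lerD2r.
  have diff i : inc (v - truncation (inc v) n) i = if (i < n)%N then 0 else inc v i.
    rewrite linearB; change ((inc v i : k) - inc (truncation (inc v) n) i = if (i < n)%N then 0 else inc v i).
    by rewrite truncationE; case: ifP => _; rewrite ?subrr ?subr0.
  elim: N => [|N IH].
    rewrite addn0 subrr /sqsum big1 // => i _.
    by rewrite diff ltn_ord mag0 expr0n.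
  rewrite addnS /sqsum !big_ord_recr /= -!/(sqsum _ _) IH diff ltnNge leq_addr /=; lra.
have := sqsum_mono (inc v) Mn; lra.
Qed.

(** Evaluate [X] at the vector with coordinates conjugate to [X (e m)]: the value is [S] and the
    squared norm at most [S], whence [S ^+ 2 <= a ^+ 2 * S]. *)
Lemma functional_coordinates (X : V -> k^o) a : linear X -> 0 <= a ->
  (forall v, mag (X v : k) <= a * form_norm f v) ->
  forall M, \sum_(m < M) mag (X (e m) : k) ^+ 2 <= a ^+ 2.
Proof.
move=> Xl a0 Xa M; set S := \sum_(m < M) _.
have S0 : 0 <= S by rewrite sumr_ge0 // => m _; exact: sqr_ge0.
pose v := truncation (fun m => conj (X (e m))) M.
have Xv : X v = emb S.
  rewrite /S emb_sum /v /truncation; elim: (M) => [|n IH].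
    by rewrite !big_ord0; have := Xl (-1) 0 0; rewrite scaler0 addr0 scaleN1r addNr.
  rewrite !big_ord_recr /= addrC Xl IH addrC; congr (_ + _).
  by rewrite -mul_conj mulrC.
have Nv : form_norm f v ^+ 2 <= S.
  apply: le_trans (truncation_norm _ _) _.
  by rewrite /S; apply: ler_sum => m _; rewrite mag_conj.
have := Xa v; rewrite Xv mag_emb ger0_norm // => h.
have h2 : S ^+ 2 <= a ^+ 2 * S.
  apply: (@le_trans _ _ ((a * form_norm f v) ^+ 2)).
    by rewrite ler_pXn2r ?nnegrE ?mulr_ge0 ?form_norm_ge0.
  by rewrite exprMn; apply: ler_wpM2l => //; exact: sqr_ge0.
have [->|Sn0] := eqVneq S 0; first exact: sqr_ge0.
have Sp : 0 < S by rewrite lt_neqAle eq_sym Sn0.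
by rewrite -(ler_pM2r Sp) -expr2.
Qed.

End SequenceVectors.

Section NuclearPermanence.
Variables (R : realType) (c : scalar_kind).
Local Notation k := (scalar_field R c).
Local Notation emb := (@emb R c).
Implicit Types E F G Q : topologicalLmodType k.

Lemma scale_factors (F : fieldType) (x y z : F) : x != 0 -> y != 0 ->
  x * y * (x^-1 * z) / y = z.
Proof. by move=> x0 y0; field; rewrite x0 y0. Qed.

(** The map [jp] factors through l^2 as [X \o J], where [J] collects the functionals [psi].
    Expansion along unit vectors gives [jp x] as the sum of [psi m x *: X (e m)]. Both [b m] and the
    norms of [X (e m)] are square-summable, so their products are summable, and this is a nuclear
    expansion. *)
Lemma hs_nuclear E : separated E -> locally_seminormed E -> hs_condition E -> nuclear E.
Proof.
move=> sE lE hE; split; first by split; [exact/separatedP|exact/locally_convexP].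
move=> p0 /continuous_csn[pc p0E]; set p := fun x => mag (p0 x) in pc p0E.
have ps := proj1 pc.
have [q [phi [a [qc hphi]]]] := hE p pc; have [r [psi [b [rc hpsi]]]] := hE q qc.
have [phil a0 phia [A aA] Pphi] := hphi; have [psil b0 psib [B bB] _] := hpsi.
have [V [inc [f [ff inj rg nle nub]]]] := square_summable_space R c.
have [J [C [Jl JE C0 Jr qJ]]] := hs_to_l2 ff inj rg nle nub (proj1 qc) (proj1 rc) hpsi.
have [Cp Cp0 pq] := hs_bound ps (proj1 qc) hphi.
have pJ x : p x <= Cp * form_norm f (J x).
  by apply: le_trans (pq x) _; apply: ler_wpM2l.
have [pr prP] := approx_projection ff Jl.
have ap := projection_approximation ff Jl prP.
(* [r] controls the functionals [psi], and [p] is added because the dominating seminorm must lie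
   above [p] itself. *)
have qfc : cont_seminorm (fun x => p x + r x) by apply: csn_add.
have [Bp [jp [jpn jpd]]] := completion ps.
have [Bq [jq [jqn jqd]]] := completion (proj1 qfc).
have ns := @rnorm_seminorm R c Bp.
have [X [Xl Xpr XJ Xb]] := extension ap ns (@rnorm_eq0 R c Bp) (@banach_complete R c Bp)
  (linearP jp) Cp0 (fun x => eq_ind_r (fun t => t <= _) (pJ x) (jpn x)).
have exX n : exists Y : V -> k^o, [/\ linear Y,
    forall v m, mag (phi n (pr v m) - Y v : k) <= a n * m.+1%:R^-1,
    forall x, Y (J x) = phi n x & forall v, mag (Y v : k) <= a n * form_norm f v].
  apply: (scalar_extension (L := phi n) ap) => // x.
  by apply: le_trans (phia n _) _; apply: ler_wpM2l.
have [Y YP] := choice exX.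
have phi00 n : phi n 0 = 0.
  by have := phil n (-1) 0 0; rewrite scaler0 addr0 scaleN1r addNr.
(* The domination of [p] by the [phi i] carries over to l^2, with [X] and [Y i] in place of [jp] and
   [phi i]: [hs_residual] is applied at [x = 0], where the residual is [- pr v m] and its seminorm
   tends to the norm of [X v]. *)
have claim1 v d : 0 < d -> exists K, forall n, (K <= n)%N ->
    rnorm (X v) ^+ 2 <= \sum_(i < n) mag (Y i v : k) ^+ 2 + d.
  move=> d0; have d2 : 0 < d / 2 by rewrite divr_gt0.
  have Ypr n w m : mag (phi n (id (pr w m)) - Y n w : k) <= a n * m.+1%:R^-1.
    by have [_ h _ _] := YP n; exact: h.
  have YD n : mag (phi n 0 - Y n v : k) <= a n * form_norm f v.
    by rewrite phi00 sub0r magN; have [_ _ _] := YP n; apply.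
  have [M0 MP] := @hs_residual R c E E V pr id p q phi a Y 0 v _ _ ps hphi Ypr (form_norm_ge0 f v) YD d2.
  (* [S] bounds [p (pr v m)], so replacing [jp (pr v m)] by [X v] costs at most
     [(2 * S * Cp + Cp ^+ 2) * t] in the squares, with [t = 1 / (m + 1)]. *)
  pose S := Cp * (form_norm f v + 1).
  have S0 : 0 <= S by rewrite mulr_ge0 // addr_ge0 ?form_norm_ge0.
  have D0 : 0 < 2 * S * Cp + Cp ^+ 2 + 1.
    by have := mulr_ge0 S0 Cp0; have := sqr_ge0 Cp; lra.
  have [M1 M1P] := inv_small (divr_gt0 d2 D0); pose m := maxn M0 M1.
  have [K KP] := MP m (leq_maxl _ _); exists K => n Kn; have := KP n Kn.
  rewrite sub0r (rsn_N _ ps) => h1.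
  have h2 : \sum_(i < n) mag (phi i 0 - Y i v : k) ^+ 2 = \sum_(i < n) mag (Y i v : k) ^+ 2.
    by apply: eq_bigr => i _; rewrite phi00 sub0r magN.
  rewrite h2 in h1; have h3 := M1P m (leq_maxr _ _).
  have t0 : 0 <= m.+1%:R^-1 :> R by rewrite invr_ge0.
  have t1 : m.+1%:R^-1 <= 1 :> R by rewrite invf_le1 ?ler1n.
  have h4 := rsn_dist (X v) (jp (pr v m)) ns; rewrite (rsn_subC (X v) _ ns) jpn in h4.
  have h5 := Xpr v m.
  have h6 : p (pr v m) <= S.
    apply: le_trans (pJ _) _; apply: ler_wpM2l => //.
    by apply: le_trans (approx_bounded ap v m) _; rewrite lerD2l.
  move: t0 t1 h3 h5; move: (m.+1%:R^-1) => t t0 t1 h3 h5.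
  have h7 : rnorm (X v) ^+ 2 <= (p (pr v m) + Cp * t) ^+ 2.
    rewrite ler_pXn2r ?nnegrE ?addr_ge0 ?mulr_ge0 ?(rsn_ge0 _ ns) ?(rsn_ge0 _ ps) //; lra.
  rewrite ltr_pdivlMr // in h3.
  have h8 : p (pr v m) * (Cp * t) <= S * (Cp * t) by rewrite ler_wpM2r // mulr_ge0.
  have h9 : Cp ^+ 2 * t * t <= Cp ^+ 2 * t * 1 by rewrite ler_wpM2l // mulr_ge0 ?sqr_ge0.
  have h10 : (p (pr v m) + Cp * t) ^+ 2 =
    p (pr v m) ^+ 2 + 2 * (p (pr v m) * (Cp * t)) + Cp ^+ 2 * t * t by ring.
  have h11 : t * (2 * S * Cp + Cp ^+ 2 + 1) = 2 * (S * (Cp * t)) + Cp ^+ 2 * t * 1 + t by ring.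
  lra.
(* [X] is Hilbert-Schmidt: by [claim1] the sum of the squared norms of the [X (e m)] is nearly a
   double sum of [|Y i (e m)| ^ 2]. Summed over [m] first, it is at most the sum of the
   [a i ^+ 2]. *)
have [e eE] := unit_vectors rg; pose y m := X (e m).
have claim3 M : \sum_(m < M) rnorm (y m) ^+ 2 <= A.
  apply/ler_addgt0Pr => d d0; have d1 : 0 < d / M.+1%:R by rewrite divr_gt0.
  have [K KP] := choice (fun m => claim1 (e m) _ d1); pose n := (\sum_(m < M) K m)%N.
  apply: (@le_trans _ _ (\sum_(m < M) (\sum_(i < n) mag (Y i (e m) : k) ^+ 2 + d / M.+1%:R))).
    by apply: ler_sum => m _; apply: KP; rewrite /n (bigD1 m) //= leq_addr.
  rewrite big_split /= exchange_big /=; apply: lerD.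
    apply: le_trans (aA n); apply: ler_sum => i _; have [Yl _ _ Yb] := YP i.
    exact: (functional_coordinates nub eE Yl (a0 i) Yb).
  rewrite sumr_const card_ord -[_ *+ M]mulr_natr -mulrA [_^-1 * _]mulrC.
  rewrite -[leRHS]mulr1; apply: ler_wpM2l; first exact: ltW.
  by rewrite ler_pdivrMr // mul1r ler_nat.
(* The inverse of zero is zero here and in the functionals [g n]; the terms concerned vanish, since
   [y m = 0] in one case and [b n = 0] forces [psi n = 0] in the other. *)
pose l m := b m * rnorm (y m); pose y' m := emb (rnorm (y m))^-1 *: y m.
have l0 m : 0 <= l m by rewrite mulr_ge0 ?(rsn_ge0 _ ns).
have lsum N : \sum_(n < N) l n <= B + A.
  apply: le_trans (lerD (bB N) (claim3 N)); rewrite -big_split /=; apply: ler_sum => i _.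
  rewrite /l; have := sqr_ge0 (b i - rnorm (y i)); have := b0 i; have := rsn_ge0 (y i) ns; nra.
have y'1 m : rnorm (y' m) <= 1.
  rewrite /y' (rsn_Z _ _ ns) mag_emb ger0_norm ?invr_ge0 ?(rsn_ge0 _ ns) //.
  have [->|n0] := eqVneq (rnorm (y m)) 0; first by rewrite mulr0.
  by rewrite mulVf.
have [prq apq] := dense_approximation jqn jqd.
have exf n : exists g : {linear Bq -> k^o}, (forall x, mag (g x : k) <= rnorm x) /\
    forall x, g (jq x) = emb (b n)^-1 * (psi n x : k) :> k.
  pose L x : k^o := emb (b n)^-1 * (psi n x : k).
  have Ll : linear L.
    by move=> t x z; rewrite /L psil mulrDr; congr (_ + _); rewrite mulrCA.
  have LC x : mag (L x : k) <= 1 * (p x + r x).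
    rewrite /L magM mag_emb ger0_norm ?invr_ge0 // mul1r.
    have h := psib n x; have h1 := rsn_ge0 x ps; have h2 := rsn_ge0 x (proj1 rc).
    have [bn0|bn0] := eqVneq (b n) 0; first by rewrite bn0 invr0 mul0r; lra.
    have bp : 0 < b n by rewrite lt_neqAle eq_sym bn0 b0.
    rewrite ler_pdivrMl //; apply: le_trans h _; apply: ler_wpM2l => //; lra.
  have [g [gl _ gj gb]] := scalar_extension apq Ll ler01 LC.
  pose m := GRing.isLinear.Build k Bq k^o *:%R _ gl.
  pose g' : {linear Bq -> k^o} := HB.pack g m; exists g'; split=> [x|x]; last exact: gj.
  by rewrite -[leRHS]mul1r; exact: gb.
have [g gP] := choice exf.
have [T [TP Tc]] := nuclear_sum l0 (fun n => proj1 (gP n)) y'1 lsum.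
exists (fun x => emb (p x + r x)); split.
- exact: csn_seminorm.
- by move=> x; rewrite p0E ler_emb lerDl (rsn_ge0 _ (proj1 rc)).
have dense_of (Z : completeNormedModType k) (j : {linear E -> Z}) :
    (forall w d, 0 < d -> exists x, rnorm (w - j x) < d) -> dense (range j).
  move=> jd W0 [w Ww] Wo; have /nbhs_translate/normed_nbhs0[d d0 dW] : nbhs w W0.
    by apply: open_nbhs_nbhs.
  have [x xw] := jd w d d0; exists (j x); split; last by exists x.
  rewrite -[j x](subrK w) addrC; apply: dW => /=.
  by rewrite -/(rnorm _) (rsn_subC _ _ (@rnorm_seminorm R c Z)).
exists Bq, Bp, jq, jp, T; split=> //.
- by split; [move=> x; rewrite rnormE jqn|exact: dense_of].
- by split; [move=> x; rewrite rnormE jpn -p0E|exact: dense_of].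
- move=> x; apply: (slim_unique ns (@rnorm_eq0 R c Bp) (TP _)) => d d0.
  have C1 : 0 < Cp + 1 by lra.
  have [M MP] := truncation_cvg nle nub eE (J x) (divr_gt0 d0 C1); exists M => n /MP h.
  have -> : \sum_(i < n) emb (l i) *: (g i (jq x) *: y' i) = X (truncation e (inc (J x)) n).
    rewrite /truncation; elim: (n) => [|i IH].
      by rewrite !big_ord0; have := Xl (-1) 0 0; rewrite scaler0 addr0 scaleN1r addNr.
    rewrite !big_ord_recr /= IH [RHS](_ : _ = X (inc (J x) i *: e i + \sum_(m < i) inc (J x) m *: e m)).
      rewrite Xl addrC; congr (_ + _); rewrite (proj2 (gP i)) JE /l /y' !scalerA -/(y i).
      have [y0|yn0] := eqVneq (rnorm (y i)) 0.
        by rewrite (rnorm_eq0 y0) !scaler0.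
      have [bi0|bin0] := eqVneq (b i) 0.
        have -> : psi i x = 0.
          by apply: mag_eq0; apply/eqP; rewrite eq_le mag_ge0 andbT; apply: le_trans (psib i x) _; rewrite bi0 mul0r.
        by rewrite mulr0 mulr0 mul0r.
      congr (_ *: _); rewrite embM !embV.
      have hb : emb (b i) != 0 by apply: contra bin0 => /eqP; rewrite -(emb0 R c) => /emb_inj ->.
      have hy : emb (rnorm (y i)) != 0.
        by apply: contra yn0 => /eqP; rewrite -(emb0 R c) => /emb_inj ->.
      exact: (scale_factors _ hb hy).
    by rewrite addrC.
  have XB v w : X (v - w) = X v - X w.
    by rewrite -[v - w]addrC -scaleN1r Xl scaleN1r addrC.
  rewrite -XJ -XB; apply: le_lt_trans (Xb _) _.
  rewrite (rsn_subC _ _ (form_norm_seminorm ff)).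
  rewrite ltr_pdivlMr // in h; have := form_norm_ge0 f (J x - truncation e (inc (J x)) n); lra.
- exists (fun n => emb (l n)), g, y'; split=> [|n x|n|x].
  + have [|L0 L0P] := @scalar_complete R c (fun N => \sum_(n < N) emb (l n)).
      apply: (@bounded_series_cauchy R c k^o _ (@mag_seminorm R c) (fun n => emb (l n)) (B + A)) => N.
      rewrite (eq_bigr (fun n : 'I_N => l n)) => [|n _]; first exact: lsum.
      by rewrite mag_emb ger0_norm.
    apply/cvg_ex; exists L0; apply/k_cvg_slim; move: L0P; congr (slim _ _ _).
    apply/funext => N; rewrite /series /= big_mkord; apply: eq_bigr => n _.
    by have := normE (emb (l n)); rewrite mag_emb (ger0_norm (l0 n)) => h; exact: (esym h).
  + have h : `|g n x| = emb (mag (g n x : k)) by exact: normE (g n x : k).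
    by rewrite h rnormE ler_emb; exact: (proj1 (gP n)).
  + by rewrite rnormE -(emb1 R c) ler_emb.
  + rewrite (_ : series _ = fun N => \sum_(n < N) emb (l n) *: (g n x *: y' n)).
      exact: slim_cvg (TP x).
    by apply/funext => N; rewrite /series /= big_mkord.
Qed.

Lemma nuclearP E : nuclear E <-> (separated E /\ locally_seminormed E) /\ hs_condition E.
Proof.
split=> [nE|[[sE lE] hE]]; last exact: hs_nuclear.
have [[/separatedP sE /locally_convexP lE] _] := nE.
by split=> //; exact: nuclear_hs.
Qed.

Lemma permanent_nuclear : permanent (@nuclear R c).
Proof.
apply: (@permanent_eq R c (fun E => (separated E /\ locally_seminormed E) /\ hs_condition E)).
  by move=> E; apply: iff_sym; exact: nuclearP.
split.
- by move=> E [[]].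
- move=> E F G p1 p2 h sG [[_ lE] hE] [[_ lF] hF]; split.
    by split=> //; exact: ls_product h lE lF.
  exact: hs_product h lE lF hE hF.
- move=> E F i h _ [[sF lF] hF]; split; last exact: hs_embedding h lF hF.
  by split; [exact: separated_embedding h sF|exact: ls_embedding h lF].
- move=> E Q p h sQ [[_ lE] hE]; split; last exact: hs_quotient h hE.
  by split=> //; exact: ls_quotient h lE.
Qed.

Lemma permanent_nuclear_frechet : permanent (@nuclear_frechet R c).
Proof.
have [s1 p1 e1 q1] := @permanent_frechet R c; have [s2 p2 e2 q2] := permanent_nuclear; split.
- by move=> E [/s1].
- by move=> E F G f g h sG [h1 h2] [h3 h4]; split; [exact: p1 h sG h1 h3|exact: p2 h sG h2 h4].
- by move=> E F i h cl [h1 h2]; split; [exact: e1 h cl h1|exact: e2 h cl h2].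
- by move=> E Q f h sQ [h1 h2]; split; [exact: q1 h sQ h1|exact: q2 h sQ h2].
Qed.

End NuclearPermanence.

(** * Hilbertian topologies *)

Section FrechetHilbert.
Variables (R : realType) (c : scalar_kind).
Local Notation k := (scalar_field R c).
Local Notation emb := (@emb R c).
Local Notation conj := (@scalar_conj R c).
Implicit Types E F G Q : topologicalLmodType k.

Definition hilbertian (V : lmodType k) (p : V -> R) := exists2 f, psd_form f &
  forall x, p x = form_norm f x.

Definition hilbertian_generated E := forall U, nbhs (0 : E) U ->
  exists p : E -> R, [/\ cont_seminorm p, hilbertian p & [set x | p x < 1] `<=` U].

Lemma psd_form_hermitian (V : lmodType k) (f : V -> V -> k) : psd_form f ->
  exists g : {hermitian_sym V for conj}, forall x y, g x y = f x y.
Proof.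
move=> ff.
have h1 u' : zmod_morphism (f^~ u') by move=> x y; exact: psdBl.
have h2 u : zmod_morphism (f u) by move=> x y; exact: psdBr.
have h3 u' : scalable_for *%R (f^~ u') by move=> a x; exact: psdZl.
have h4 u : scalable_for (conj \; *%R) (f u) by move=> a x; exact: psdZr.
have h5 x y : f x y = (-1) ^+ false * conj (f y x) by rewrite expr0 mul1r; exact: psd_sym.
pose m := isBilinear.Build k V V k *%R (conj \; *%R) f h1 h2 h3 h4.
pose m' := isHermitianSesquilinear.Build k V false conj f h5.
pose g : {hermitian_sym V for conj} := HB.pack f m m'.
by exists g.
Qed.

Lemma hermitian_psd_form (V : lmodType k) (f : {hermitian_sym V for conj}) :
  (forall x, 0 <= f x x) -> psd_form (fun x y => f x y).
Proof.
move=> f0; split=> // [a x y z|x y]; first by rewrite linearPl.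
by have := @hermitian_subproof k V false conj f x y; rewrite expr0 mul1r.
Qed.

Lemma psd_form_add (V : lmodType k) (f g : V -> V -> k) : psd_form f -> psd_form g ->
  psd_form (fun x y => f x y + g x y).
Proof.
move=> ff gg; split=> [a x y z|x y|x].
- by rewrite (psd_linear ff) (psd_linear gg) mulrDr addrACA.
- by rewrite (psd_sym ff) (psd_sym gg) conjD.
- by rewrite addr_ge0 ?(psd_ge0 ff) ?(psd_ge0 gg).
Qed.

Lemma form_norm_add (V : lmodType k) (f g : V -> V -> k) x : psd_form f -> psd_form g ->
  form_norm (fun x y => f x y + g x y) x ^+ 2 = form_norm f x ^+ 2 + form_norm g x ^+ 2.
Proof.
move=> ff gg; apply: (@emb_inj R c); rewrite -(form_normE (psd_form_add ff gg)).
by rewrite embD -(form_normE ff) -(form_normE gg).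
Qed.

Lemma psd_form_comp (V W : lmodType k) (f : W -> W -> k) (h : V -> W) : psd_form f ->
  linear h -> psd_form (fun x y => f (h x) (h y)).
Proof.
move=> ff hl; split=> [a x y z|x y|x]; last exact: psd_ge0.
  by rewrite hl (psd_linear ff).
exact: psd_sym.
Qed.

Lemma psd_form_scale (V : lmodType k) (f : V -> V -> k) t : psd_form f -> 0 <= t ->
  psd_form (fun x y => emb (t ^+ 2) * f x y) /\
  forall x, form_norm (fun x y => emb (t ^+ 2) * f x y) x = t * form_norm f x.
Proof.
move=> ff t0; split; last first.
  by move=> x; rewrite /form_norm magM mag_emb ger0_norm ?sqr_ge0 // sqrtrM ?sqr_ge0 // sqrtr_sqr ger0_norm.
split=> [a x y z|x y|x]; last by rewrite mulr_ge0 ?(psd_ge0 ff) // -(emb0 R c) ler_emb sqr_ge0.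
  by rewrite (psd_linear ff) mulrDr mulrCA.
by rewrite conjM conj_emb (psd_sym ff).
Qed.

Lemma csn_form_add E (f g : E -> E -> k) : psd_form f -> psd_form g ->
  cont_seminorm (form_norm f) -> cont_seminorm (form_norm g) ->
  cont_seminorm (form_norm (fun x y => f x y + g x y)) /\
  forall x, form_norm f x <= form_norm (fun x y => f x y + g x y) x /\
    form_norm g x <= form_norm (fun x y => f x y + g x y) x.
Proof.
move=> ff gg fc gc; have fg := psd_form_add ff gg; split.
  apply: (csn_le (C := 1) _ (csn_add fc gc)) => //; first exact: form_norm_seminorm.
  move=> x; rewrite mul1r -(@ler_pXn2r _ 2) ?nnegrE ?addr_ge0 ?form_norm_ge0 //.
  rewrite form_norm_add // sqrrD; have := mulr_ge0 (form_norm_ge0 f x) (form_norm_ge0 g x).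
  by move=> h; rewrite [leRHS]addrAC lerDl mulrn_wge0.
move=> x; split; rewrite -(@ler_pXn2r _ 2) ?nnegrE ?form_norm_ge0 // form_norm_add //.
  by rewrite lerDl sqr_ge0.
by rewrite lerDr sqr_ge0.
Qed.

Lemma hg_embedding E F (i : clin E F) : embedding i ->
  hilbertian_generated F -> hilbertian_generated E.
Proof.
move=> [_ iemb] hF U /iemb[B /hF[p [pc [f ff pf] pB]] BU]; exists (fun x => p (i x)); split.
- exact: csn_comp.
- by exists (fun x y => f (i x) (i y)) => [|x]; [exact: psd_form_comp ff (clin_linear i)|rewrite pf].
- by move=> x /pB/BU.
Qed.

(** A sum of Hilbertian seminorms is in general not Hilbertian, so the forms are added rather than
    the seminorms. *)
Lemma hg_product E F G (p1 : clin G E) (p2 : clin G F) : is_product p1 p2 ->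
  hilbertian_generated E -> hilbertian_generated F -> hilbertian_generated G.
Proof.
move=> [_ nb] hE hF U /nb[B1 [B2 [/hE[p [pc [f ff pf] pB]] /hF[q [qc [g gg qg] qB]] BU]]].
pose f' (x y : G) := f (p1 x) (p1 y); pose g' (x y : G) := g (p2 x) (p2 y).
have ff' : psd_form f' by exact: psd_form_comp ff (clin_linear p1).
have gg' : psd_form g' by exact: psd_form_comp gg (clin_linear p2).
have fc : cont_seminorm (form_norm f').
  have := csn_comp p1 pc; congr cont_seminorm; apply/funext => x; exact: pf.
have gc : cont_seminorm (form_norm g').
  have := csn_comp p2 qc; congr cont_seminorm; apply/funext => x; exact: qg.
have [h1 h2] := csn_form_add ff' gg' fc gc.
exists (form_norm (fun x y => f' x y + g' x y)); split=> //.
  by exists (fun x y => f' x y + g' x y) => //; exact: psd_form_add.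
move=> x /= hx; have [h3 h4] := h2 x.
by apply: BU; [apply: pB|apply: qB]; rewrite /= ?pf ?qg; apply: le_lt_trans hx.
Qed.

Section QuotientForm.
Variables (E Q : lmodType k) (p : {linear E -> Q}) (f : E -> E -> k) (ff : psd_form f).
Hypothesis psurj : forall y, exists x, p x = y.
Local Notation h := (form_norm f).

(** The quotient seminorm measures the component orthogonal to the kernel. [B x y] is [f x y] minus
    the limit [X y x] of [f (iota (pr x n)) y], that is, the form of the orthogonal components; it
    depends on [p x] and [p y] only. *)
Lemma quotient_form : exists2 g : Q -> Q -> k, psd_form g &
  forall y, quotient_seminorm p h y = form_norm g y.
Proof.
have hs := form_norm_seminorm ff.
have kersub : is_submod [set x | p x = 0].
  by split=> [|a x y /= px py] /=; rewrite ?linear0 // linearP px py scaler0 addr0.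
have [W [iota [iinj iS]]] := sub_lmodule kersub.
have piota w : p (iota w) = 0 by have : range iota (iota w) by []; rewrite iS.
have iotaP x : p x = 0 -> exists w, iota w = x.
  by move=> px; have : range iota x; [rewrite iS|move=> [w _ wE]; exists w].
have [pr prP] := approx_projection ff (linearP iota).
have ap := projection_approximation ff (linearP iota) prP.
have exX y : exists X : E -> k^o, [/\ linear X,
    forall v n, mag (f (iota (pr v n)) y - X v : k) <= h y * n.+1%:R^-1,
    forall w, X (iota w) = f (iota w) y & forall v, mag (X v : k) <= h y * h v].
  apply: (scalar_extension (L := fun w => f (iota w) y : k^o) ap).
  - by move=> a w z; rewrite linearP (psd_linear ff).
  - exact: form_norm_ge0.
  - by move=> w; rewrite mulrC; exact: form_cauchy_schwarz.
have [X XP] := choice exX; pose B x y : k := f x y - X y x.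
pose D x n := x - iota (pr x n).
have pD x n : p (D x n) = p x by rewrite linearB piota subr0.
(* One error is the convergence to [X y x], with constant [h y]; the other is near-orthogonality of
   [D x n] to the kernel, with constant [h y + 1]. Symmetry and positivity of [B] follow in the
   limit. *)
have Blim x y n : mag (B x y - f (D x n) (D y n)) <= (2 * h y + 1) * n.+1%:R^-1.
  have [_ h1 _ _] := XP y; have h2 := prP x n (pr y n).
  have -> : B x y - f (D x n) (D y n) =
      (f (iota (pr x n)) y - X y x) + f (D x n) (iota (pr y n)).
    rewrite [in f (D x n) (D y n)]/D (psdBr ff) opprB /B addrCA [RHS]addrC; congr (_ + _).
    by rewrite /D (psdBl ff) opprB addrCA; congr (_ + _); rewrite addrAC subrr sub0r.
  apply: le_trans (magD _ _) _; have h3 := h1 x n; have h4 := approx_bounded ap y n.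
  have t0 : 0 <= n.+1%:R^-1 :> R by rewrite invr_ge0.
  have t1 : n.+1%:R^-1 <= 1 :> R by rewrite invf_le1 ?ler1n.
  move: t0 t1 h3 h4 h2; rewrite -/(D x n); move: (n.+1%:R^-1) => t t0 t1 h3 h4 h2.
  have h5 : t * h (iota (pr y n)) <= t * (h y + 1) by rewrite ler_wpM2l //; lra.
  rewrite mulrDl mul1r; lra.
have small (C : R) : 0 <= C -> forall e, 0 < e -> exists n, C * n.+1%:R^-1 < e.
  move=> C0 e e0; have C1 : 0 < C + 1 by lra.
  have [M MP] := inv_small (divr_gt0 e0 C1); exists M; have := MP M (leqnn M).
  have : 0 <= M.+1%:R^-1 :> R by rewrite invr_ge0.
  rewrite ltr_pdivlMr //; move: (M.+1%:R^-1) => t; lra.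
have hge0 x : 0 <= h x by exact: form_norm_ge0.
have Bsym x y : B x y = conj (B y x).
  apply/eqP; rewrite -subr_eq0; apply/eqP/mag_eq0/eqP; rewrite eq_le mag_ge0 andbT.
  apply/ler_addgt0Pr => e e0; rewrite add0r.
  have [|n nP] := @small (2 * h x + 2 * h y + 2) _ e e0.
    by have := hge0 x; have := hge0 y; lra.
  have -> : B x y - conj (B y x) = (B x y - f (D x n) (D y n)) - conj (B y x - f (D y n) (D x n)).
    by rewrite conjB -(psd_sym ff) opprB addrA subrK.
  apply: le_trans (magD _ _) _; rewrite magN mag_conj.
  have := Blim x y n; have := Blim y x n; move: nP; move: (n.+1%:R^-1) => t; lra.
have Blin a x y z : B (a *: x + y) z = a * B x z + B y z.
  have [Xl _ _ _] := XP z; rewrite /B (psd_linear ff) Xl mulrBr opprD addrACA.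
  by congr (_ + (_ + _)).
(* Over the complex numbers nonnegativity includes being real, so [B x x] is exhibited as the limit
   of the real numbers [h (D x n) ^+ 2]. *)
have Bnorm x : exists2 r, B x x = emb r & 0 <= r.
  have cau : scauchy Num.norm (fun n => h (D x n) ^+ 2).
    move=> e e0; have e2 : 0 < e / 2 by rewrite divr_gt0.
    have C0 : 0 < 2 * h x + 1 + 1 by have := hge0 x; lra.
    have [M MP] := inv_small (divr_gt0 e2 C0); exists M => m n hm hn.
    rewrite -(mag_emb c) embB -!(form_normE ff).
    have -> : f (D x m) (D x m) - f (D x n) (D x n) =
      (B x x - f (D x n) (D x n)) - (B x x - f (D x m) (D x m)) by rewrite opprB [RHS]addrC addrA subrK.
    apply: le_lt_trans (magD _ _) _; rewrite magN.
    have := Blim x x m; have := Blim x x n; have := MP m hm; have := MP n hn.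
    rewrite !ltr_pdivlMr //.
    have : 0 <= m.+1%:R^-1 :> R by rewrite invr_ge0.
    have : 0 <= n.+1%:R^-1 :> R by rewrite invr_ge0.
    move: (m.+1%:R^-1) (n.+1%:R^-1) => t s; lra.
  have [r rP] := real_complete cau; exists r.
    apply/eqP; rewrite -subr_eq0; apply/eqP/mag_eq0/eqP; rewrite eq_le mag_ge0 andbT.
    apply/ler_addgt0Pr => e e0; rewrite add0r; have e2 : 0 < e / 2 by rewrite divr_gt0.
    have [M MP] := rP _ e2; have C0 : 0 < 2 * h x + 1 + 1 by have := hge0 x; lra.
    have [M' MP'] := inv_small (divr_gt0 e2 C0); pose n := maxn M M'.
    have h1 := MP n (leq_maxl _ _); have h2 := MP' n (leq_maxr _ _).
    have -> : B x x - emb r = (B x x - f (D x n) (D x n)) + (f (D x n) (D x n) - emb r).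
      by rewrite addrA subrK.
    apply: le_trans (magD _ _) _; rewrite (form_normE ff) -embB mag_emb.
    have := Blim x x n; rewrite (form_normE ff).
    have : 0 <= n.+1%:R^-1 :> R by rewrite invr_ge0.
    rewrite ltr_pdivlMr // in h2; move: h2; move: (n.+1%:R^-1) => t; lra.
  rewrite leNgt; apply/negP => r0; have [|M MP] := rP (- r); first by lra.
  have := MP M (leqnn M); have := sqr_ge0 (h (D x M)) => h1.
  by rewrite ltr_norml => /andP[]; lra.
have BB : psd_form B.
  split=> // x; have [r -> r0] := Bnorm x.
  by rewrite -(emb0 R c) ler_emb.
have Bw w y : B (iota w) y = 0.
  by have [_ _ XJ _] := XP y; rewrite /B XJ subrr.
have Beq x x' y y' : p x = p x' -> p y = p y' -> B x y = B x' y'.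
  have one x1 x2 z : p x1 = p x2 -> B x1 z = B x2 z.
    move=> e; have [|w wE] := iotaP (x1 - x2); first by rewrite linearB e subrr.
    by rewrite -[x1](subrK x2) -wE (psdDl BB) Bw add0r.
  by move=> e1 e2; rewrite (one _ _ _ e1) Bsym (one _ _ _ e2) -Bsym.
have [sec secE] := choice psurj; pose g y z := B (sec y) (sec z).
have gE x y : g (p x) (p y) = B x y by apply: Beq; rewrite secE.
have gg : psd_form g.
  split=> [a x y z|x y|x]; [|exact: Bsym|exact: (psd_ge0 BB)].
  have [x' <-] := psurj x; have [y' <-] := psurj y; have [z' <-] := psurj z.
  by rewrite -linearP !gE (psd_linear BB).
have near x n : mag (emb (form_norm B x ^+ 2) - emb (h (D x n) ^+ 2)) <= (2 * h x + 1) * n.+1%:R^-1.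
  by rewrite -(form_normE BB) -(form_normE ff); exact: Blim.
(* Up to a small error [f (D x n) (D x n)] equals [f (D x n) x], so Cauchy-Schwarz bounds the norm
   of the residual by that of [x]. *)
have Ble x : form_norm B x <= h x.
  rewrite -(@ler_pXn2r _ 2) ?nnegrE ?form_norm_ge0 //; apply/ler_addgt0Pr => e e0.
  have [|n nP] := @small (2 * h x + 1 + 2 * (h x + 1)) _ e e0; first by have := hge0 x; lra.
  have := near x n; rewrite -embB mag_emb => /ler_normlP[_ h1].
  have h2 := prP x n (pr x n); have h3 := approx_bounded ap x n.
  have t0 : 0 <= n.+1%:R^-1 :> R by rewrite invr_ge0.
  have t1 : n.+1%:R^-1 <= 1 :> R by rewrite invf_le1 ?ler1n.
  have h4 : h (D x n) ^+ 2 <= h (D x n) * h x + n.+1%:R^-1 * h (iota (pr x n)).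
    rewrite -[leLHS]ger0_norm ?sqr_ge0 // -(mag_emb c) -(form_normE ff).
    rewrite {2}/D (psdBr ff); apply: le_trans (magD _ _) _; rewrite magN.
    by apply: lerD => //; exact: form_cauchy_schwarz.
  move: t0 t1 h1 h2 h3 h4 nP; move: (n.+1%:R^-1) => t t0 t1 h1 h2 h3 h4 nP.
  have h5 : t * h (iota (pr x n)) <= t * (h x + 1) by rewrite ler_wpM2l //; lra.
  have h6 := sqr_ge0 (h (D x n) - h x).
  have h7 : (h (D x n) - h x) ^+ 2 = h (D x n) ^+ 2 - 2 * (h (D x n) * h x) + h x ^+ 2 by ring.
  lra.
exists g => // y; have [x <-] := psurj y.
have gN : form_norm g (p x) = form_norm B x by rewrite /form_norm gE.
(* [Ble] at every representative bounds the quotient seminorm from below; the representatives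
   [D x n] have norms tending to that of [B] and bound it from above. *)
rewrite gN; apply/eqP; rewrite eq_le; apply/andP; split; last first.
  apply: (qsn_ge psurj) => z pz; apply: le_trans (Ble z); rewrite /form_norm.
  by rewrite (Beq z x z x pz pz).
rewrite -(@ler_pXn2r _ 2) ?nnegrE ?form_norm_ge0 //; last first.
  by apply: (qsn_ge psurj) => z _.
apply/ler_addgt0Pr => e e0; have [|n nP] := @small (2 * h x + 1) _ e e0.
  by have := hge0 x; lra.
have := near x n; rewrite -embB mag_emb => /ler_normlP[h1 _].
have h2 : quotient_seminorm p h (p x) ^+ 2 <= h (D x n) ^+ 2.
  rewrite ler_pXn2r ?nnegrE //; first by rewrite -(pD x n); exact: qsn_le.
  by apply: (qsn_ge psurj) => z _.
move: nP h1; move: (n.+1%:R^-1) => t; lra.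
Qed.

End QuotientForm.

Lemma hg_quotient E Q (p : clin E Q) : open_surjection p ->
  hilbertian_generated E -> hilbertian_generated Q.
Proof.
move=> po hE U /(clin_nbhs0 p)/hE[q [qc [f ff qf] qU]].
pose m := GRing.isLinear.Build k E Q *:%R _ (clin_linear p).
pose P : {linear E -> Q} := HB.pack (p : E -> Q) m.
have [g gg gE] := @quotient_form E Q P f ff (proj1 po).
exists (quotient_seminorm p q); split; first exact: csn_quotient.
  by exists g => // y; rewrite -gE; congr quotient_seminorm; apply/funext.
by move=> y /= /(qsn_lt (proj1 po))[x <-]; exact: qU.
Qed.

Lemma hilbertian_generatedP E :
  (exists2 P : set (E -> k), (forall p, P p -> @hilbert_seminorm R c E p)
     & topology_generated_by P) <-> hilbertian_generated E.
Proof.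
split=> [[P Phil Pgen] U|hE].
  have each p : P p -> exists f, [/\ psd_form f, cont_seminorm (form_norm f)
      & forall x, p x = emb (form_norm f x)].
    move=> Pp; have [f [f0 fp]] := Phil p Pp.
    have ff := hermitian_psd_form f0; exists (fun x y => f x y).
    have pE x : p x = emb (form_norm (fun x y => f x y) x).
      have [p0 p2] := fp x; rewrite -(emb_mag p0); congr emb; apply/eqP.
      rewrite -(@eqrXn2 _ 2) ?mag_ge0 ?form_norm_ge0 //; apply/eqP/(@emb_inj R c).
      by rewrite -(form_normE ff) embX emb_mag.
    split=> //; split; first exact: form_norm_seminorm.
    apply/Pgen; exists [set p], 1; split; [by move=> _ ->|exact: finite_set1|exact: ltr01|].
    by move=> x /(_ p erefl); rewrite pE -(emb1 R c) ltr_emb.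
  move=> /Pgen[Qs [e [QP /finite_seqP[s sE] /emb_gt0[e0 eE] eU]]].
  (* Finitely many Hilbertian seminorms lie below a single one, given by the sum of their forms. *)
  have [f [ff fc fle]] : exists f, [/\ psd_form f, cont_seminorm (form_norm f)
      & forall p, p \in s -> forall x, p x <= emb (form_norm f x)].
    have sP p : p \in s -> P p by move=> ps; apply: QP; rewrite sE.
    elim: s sP {sE} => [|p s IH] sP.
      have ff : psd_form (fun _ _ : E => 0 : k).
        by split=> [a x y z|x y|x] //; rewrite ?mulr0 ?addr0 // conj0.
      exists (fun _ _ => 0); split=> //; split; first exact: form_norm_seminorm.
      apply: filterE => x /=; rewrite /form_norm mag0 sqrtr0; exact: ltr01.
    have [|g [gg gc gle]] := IH; first by move=> q qs; apply: sP; rewrite inE qs orbT.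
    have [|f [ff fc pf]] := each p; first by apply: sP; rewrite inE eqxx.
    have [h1 h2] := csn_form_add ff gg fc gc.
    exists (fun x y => f x y + g x y); split=> //; first exact: psd_form_add.
    move=> q; rewrite inE => /orP[/eqP ->|qs] x; have [h3 h4] := h2 x.
      by rewrite pf ler_emb.
    by apply: le_trans (gle q qs x) _; rewrite ler_emb.
  have t0 : 0 <= (mag e)^-1 by rewrite invr_ge0 ltW.
  have [gg gN] := psd_form_scale ff t0.
  exists (fun x => (mag e)^-1 * form_norm f x); split; first exact: csn_scale.
    by exists (fun x y => emb ((mag e)^-1 ^+ 2) * f x y) => // x; rewrite gN.
  move=> x /= hx; apply: eU => p; rewrite sE => ps; apply: le_lt_trans (fle p ps x) _.
  by rewrite -eE ltr_emb -[ltRHS]mulr1 -ltr_pdivrMl // eE.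
exists [set p | exists h : E -> R, [/\ cont_seminorm h, hilbertian h & p = fun x => emb (h x)]].
  move=> _ [h [[hs _] [f ff hf] ->]]; have [g gE] := psd_form_hermitian ff.
  exists g; split=> [x|x]; first by rewrite gE; exact: psd_ge0.
  split; first by rewrite -(emb0 R c) ler_emb rsn_ge0.
  by rewrite gE (form_normE ff) -embX hf.
move=> U; split=> [/hE[h [hc hh hU]]|[Qs [e [QP /finite_seqP[s sE] /emb_gt0[e0 eE] eU]]]].
  exists [set (fun x => emb (h x))], 1; split; [|exact: finite_set1|exact: ltr01|].
    by move=> _ ->; exists h.
  move=> x /(_ _ erefl); rewrite -(emb1 R c) ltr_emb; exact: hU.
apply: filterS eU _; rewrite {}sE in QP *.
elim: s QP => [|p s IH] QP; first by apply: filterE => x p.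
have h1 : nbhs (0 : E) [set x | p x < e].
  have [|h [hc _ ->]] := QP p; first by rewrite /= inE eqxx.
  by apply: filterS (csn_nbhs hc e0) => x /=; rewrite -eE ltr_emb mag_emb ger0_norm ?mag_ge0.
have h2 : nbhs (0 : E) [set x | forall q, [set` s] q -> q x < e].
  by apply: IH => q /= qs; apply: QP; rewrite /= inE qs orbT.
apply: filterS (filterI h1 h2) => x [/= px sx] q /=; rewrite inE => /orP[/eqP -> //|qs].
exact: sx.
Qed.

Lemma permanent_frechet_hilbert : permanent (@frechet_hilbert R c).
Proof.
apply: (@permanent_eq R c (fun E => frechet E /\ hilbertian_generated E)).
  by move=> E; split=> -[h1 /hilbertian_generatedP h2].
apply: permanent_and => [|E F G p1 p2 h _ h1 h2|E F i h _ h1|E Q p h _ _ h1].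
- exact: permanent_frechet.
- exact: hg_product h h1 h2.
- exact: hg_embedding h h1.
- exact: hg_quotient h h1.
Qed.

End FrechetHilbert.

(** * Weighted sequence spaces *)

Section WeightedSequences.
Variables (R : realType) (c : scalar_kind).
Local Notation k := (scalar_field R c).
Local Notation emb := (@emb R c).
Local Notation conj := (@scalar_conj R c).
Variable a : nat -> nat -> R.
Hypothesis a1 : forall j n, 1 <= a j n.

Lemma weight_ge0 j n : 0 <= a j n. Proof. exact: le_trans ler01 (a1 j n). Qed.

Definition wsum j (x : nat -> k^o) (N : nat) : R := \sum_(n < N) (a j n * mag (x n : k)) ^+ 2.

Definition wnorm j (x : nat -> k^o) (N : nat) : R := Num.sqrt (wsum j x N).

Lemma wsum_ge0 j x N : 0 <= wsum j x N.
Proof. by rewrite sumr_ge0 // => i _; exact: sqr_ge0. Qed.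

Lemma wnorm_ge0 j x N : 0 <= wnorm j x N. Proof. exact: sqrtr_ge0. Qed.

Lemma wnorm_sqr j x N : wnorm j x N ^+ 2 = wsum j x N.
Proof. by rewrite sqr_sqrtr ?wsum_ge0. Qed.

Lemma wnorm_le j x N B : 0 <= B -> wsum j x N <= B ^+ 2 -> wnorm j x N <= B.
Proof. by move=> B0 h; rewrite -(@ler_pXn2r _ 2) ?nnegrE ?wnorm_ge0 // wnorm_sqr. Qed.

Lemma wsum_mono j x m n : (m <= n)%N -> wsum j x m <= wsum j x n.
Proof. exact: (@sum_sq_mono R (fun n => a j n * mag (x n : k))). Qed.

Lemma wnorm_compare i j x y N : (forall n, (n < N)%N -> a i n * mag (x n : k) <= a j n * mag (y n : k)) ->
  wnorm i x N <= wnorm j y N.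
Proof.
move=> h; apply: wnorm_le; first exact: wnorm_ge0.
rewrite wnorm_sqr; apply: ler_sum => n _; rewrite ler_pXn2r ?nnegrE ?mulr_ge0 ?mag_ge0 ?weight_ge0 //.
exact: h.
Qed.

Lemma wnorm_shift j x N : (forall n, a j n <= a j n.+1) ->
  wnorm j (fun n => x n.+1) N <= wnorm j x N.+1.
Proof.
move=> an; apply: wnorm_le; first exact: wnorm_ge0.
rewrite wnorm_sqr [leRHS]/wsum big_ord_recl /=; apply: ler_wpDl; first exact: sqr_ge0.
apply: ler_sum => n _; rewrite ler_pXn2r ?nnegrE ?mulr_ge0 ?mag_ge0 ?weight_ge0 //.
by apply: ler_wpM2r => //; exact: mag_ge0.
Qed.

Lemma wnorm_term j x n : a j n * mag (x n : k) <= wnorm j x n.+1.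
Proof.
rewrite -(@ler_pXn2r _ 2) ?nnegrE ?wnorm_ge0 ?mulr_ge0 ?mag_ge0 ?weight_ge0 // wnorm_sqr.
by rewrite /wsum big_ord_recr /= lerDr wsum_ge0.
Qed.

Lemma wnorm_coord j x n : mag (x n : k) <= wnorm j x n.+1.
Proof.
apply: le_trans (wnorm_term j x n); rewrite -[leLHS]mul1r.
by apply: ler_wpM2r; rewrite ?mag_ge0.
Qed.

(** The triangle inequality comes from Cauchy-Schwarz for the truncated weighted inner product. *)
Lemma wnorm_seminorm j N : real_seminorm (fun x => wnorm j x N).
Proof.
pose f (x y : nat -> k^o) : k := \sum_(n < N) emb (a j n ^+ 2) * ((x n : k) * conj (y n)).
have fE x : f x x = emb (wsum j x N).
  by rewrite emb_sum; apply: eq_bigr => n _; rewrite mul_conj -embM exprMn.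
have ff : psd_form f.
  split=> [t x y z|x y|x]; last by rewrite fE -(emb0 R c) ler_emb wsum_ge0.
    rewrite /f mulr_sumr -big_split; apply: eq_bigr => n _ /=.
    change (emb (a j n ^+ 2) * ((t * (x n : k) + (y n : k)) * conj (z n)) =
      t * (emb (a j n ^+ 2) * ((x n : k) * conj (z n))) + emb (a j n ^+ 2) * ((y n : k) * conj (z n))).
    by rewrite mulrDl mulrDr -mulrA [in RHS]mulrCA.
  rewrite /f; elim: (N) => [|m IH]; first by rewrite !big_ord0 conj0.
  by rewrite !big_ord_recr /= conjD IH !conjM conj_emb conj_involutive; congr (_ + _ * _); rewrite mulrC.
have := form_norm_seminorm ff; congr real_seminorm; apply/funext => x.
by rewrite /form_norm fE mag_emb ger0_norm ?wsum_ge0.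
Qed.

Lemma wnorm_bound j x N : wnorm j x N <= \sum_(n < N) a j n * mag (x n : k).
Proof.
elim: N => [|N IH]; first by rewrite /wnorm /wsum !big_ord0 sqrtr0.
rewrite big_ord_recr /=; apply: wnorm_le.
  by rewrite addr_ge0 ?mulr_ge0 ?mag_ge0 ?weight_ge0 // (le_trans _ IH) ?wnorm_ge0.
rewrite /wsum big_ord_recr /= -/(wsum j x N) -wnorm_sqr.
have := wnorm_ge0 j x N; have : 0 <= a j N * mag (x N : k) by rewrite mulr_ge0 ?mag_ge0 ?weight_ge0.
move: IH; move: (wnorm _ _ _) (a j N * _) (\sum_(_ < _) _) => u v w; nra.
Qed.

Lemma wnorm_finite j x M N : (forall n, (M <= n)%N -> x n = 0) -> wnorm j x N <= wnorm j x M.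
Proof.
move=> x0; apply: wnorm_le; first exact: wnorm_ge0.
rewrite wnorm_sqr; apply: le_trans (wsum_mono j x (leq_addl M N)) _.
elim: N => [|N IH]; first by rewrite addn0.
rewrite addnS /wsum big_ord_recr /= x0 ?leq_addr // mag0 mulr0 expr0n addr0.
exact: IH.
Qed.

(** A specification of the intersection over [j] of the weighted l^2 spaces, by coordinates and
    norms. Being independent of the carrier, it can be transported to a topological vector space or
    to a Banach space. *)
Record weighted (V : lmodType k) (X : V -> nat -> k^o) (p : nat -> V -> R) : Prop := Weighted {
  wt_linear : linear X;
  wt_inj : injective X;
  wt_onto : forall x, (forall j, exists B, forall N, wnorm j x N <= B) -> exists v, X v = x;
  wt_hilbertian : forall j, hilbertian (p j);
  wt_le : forall v j N, wnorm j (X v) N <= p j v;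
  wt_lub : forall v j B, (forall N, wnorm j (X v) N <= B) -> p j v <= B }.

Lemma exists_weighted : exists (V : lmodType k) (X : V -> nat -> k^o) (p : nat -> V -> R),
  weighted X p.
Proof.
pose mul j (x : nat -> k^o) : nat -> k^o := fun n => emb (a j n) * (x n : k).
have sqE j x N : sqsum (mul j x) N = wsum j x N.
  by apply: eq_bigr => n _; rewrite /mul magM mag_emb ger0_norm ?weight_ge0.
have mull j t x y : mul j (t *: x + y) = t *: mul j x + mul j y.
  apply/funext => n; change (emb (a j n) * (t * (x n : k) + (y n : k)) =
    t * (emb (a j n) * (x n : k)) + emb (a j n) * (y n : k)).
  by rewrite mulrDr mulrCA.
pose S := [set x | forall j, @square_summable R c (mul j x)].
have sub : is_submod S.
  have [s0 sl] := @square_summable_submod R c; split=> [j|t x y xS yS j].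
    suff -> : mul j 0 = 0 by exact: s0.
    by apply/funext => n; rewrite /mul /= mulr0.
  by rewrite mull; apply: sl.
have [V [X [Xinj Xrg]]] := sub_lmodule sub.
have [W [inc [f [ff inj rg nle nub]]]] := square_summable_space R c.
have exD (jv : nat * V) : exists w, inc w = mul jv.1 (X jv.2).
  have : S (X jv.2) by rewrite -Xrg; exists jv.2.
  by move=> /(_ jv.1); rewrite -rg => -[w _ wE]; exists w.
have [D0 D0E] := choice exD; pose D j v := D0 (j, v).
have DE j v : inc (D j v) = mul j (X v) by exact: D0E (j, v).
have Dl j : linear (D j).
  by move=> t x y; apply: inj; rewrite linearP !DE linearP mull.
exists V, X, (fun j v => form_norm f (D j v)); split.
- exact: linearP.
- exact: Xinj.
- move=> x xB; have : S x.
    move=> j; have [B BP] := xB j; exists (B ^+ 2) => N; rewrite sqE -wnorm_sqr.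
    by rewrite ler_pXn2r ?nnegrE ?wnorm_ge0 // (le_trans _ (BP 0%N)) ?wnorm_ge0.
  by rewrite -Xrg => -[v _ vE]; exists v.
- by move=> j; exists (fun x y => f (D j x) (D j y)) => //; exact: psd_form_comp ff (Dl j).
- move=> v j N; apply: wnorm_le; first exact: form_norm_ge0.
  by rewrite -sqE -DE.
- move=> v j B vB; have B0 : 0 <= B by apply: le_trans (vB 0%N); exact: wnorm_ge0.
  rewrite -(@ler_pXn2r _ 2) ?nnegrE ?form_norm_ge0 //; apply: nub => N.
  by rewrite DE sqE -wnorm_sqr ler_pXn2r ?nnegrE ?wnorm_ge0.
Qed.

Lemma weighted_transport (V W : lmodType k) X p (g : W -> V) : linear g -> bijective g ->
  weighted X p -> weighted (fun w => X (g w)) (fun j w => p j (g w)).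
Proof.
move=> gl gb [Xl Xi Xo Xh Xle Xlub]; split=> //.
- by move=> t x y; rewrite gl Xl.
- by apply: inj_comp => //; exact: bij_inj.
- move=> x /Xo[v vE]; have [h gK hK] := gb; exists (h v); by rewrite hK.
- move=> j; have [f ff fE] := Xh j; exists (fun x y => f (g x) (g y)) => //.
  exact: psd_form_comp ff gl.
- by move=> v j B /Xlub.
Qed.

Section Space.
Variables (V : lmodType k) (X : V -> nat -> k^o) (p : nat -> V -> R).
Hypothesis W : weighted X p.

Lemma wt_seminorm j : real_seminorm (p j).
Proof.
have [f ff fE] := wt_hilbertian W j.
by have := form_norm_seminorm ff; congr real_seminorm; apply/funext => x; rewrite fE.
Qed.

Lemma wt_B v w : X (v - w) = X v - X w.
Proof. by rewrite addrC -scaleN1r (wt_linear W) scaleN1r addrC. Qed.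

Lemma wt_coord v j n : mag (X v n : k) <= p j v.
Proof. by apply: le_trans (wnorm_coord j (X v) n) _; exact: wt_le. Qed.

Lemma wt_0 : X 0 = 0.
Proof. by rewrite -(subrr (0 : V)) wt_B subrr. Qed.

Lemma wt_mono v i j : (forall i n, a i n <= a i.+1 n) -> (i <= j)%N -> p i v <= p j v.
Proof.
move=> aj ij; apply: (wt_lub W) => N; apply: le_trans (wt_le W v j N).
apply: wnorm_compare => n _; apply: ler_wpM2r; first exact: mag_ge0.
by move: ij => /subnK <-; elim: (j - i)%N => [//|d IH]; apply: le_trans IH _; rewrite addSn.
Qed.

(** The limit [l] is taken coordinatewise, and the Cauchy estimates pass to it on each
    truncation. *)
Lemma wt_complete u : (forall j, scauchy (p j) u) -> exists l, forall j, slim (p j) u l.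
Proof.
move=> uc.
have [l lP] : exists l : nat -> k^o, forall n, slim (@mag R c : k^o -> R) (fun m => X (u m) n) (l n).
  suff h n : exists l : k^o, slim (@mag R c : k^o -> R) (fun m => X (u m) n) l.
    by have [l lP] := choice h; exists l.
  apply: scalar_complete => e e0; have [M MP] := uc 0%N e e0; exists M => i j iM jM.
  apply: le_lt_trans (MP i j iM jM).
  by have := wt_coord (u i - u j) 0 n; rewrite wt_B.
have lim j N : slim (fun x => wnorm j x N) (fun m => X (u m)) l.
  move=> e e0; have e1 : 0 < e / N.+1%:R by rewrite divr_gt0.
  have [M MP] : exists M, forall m, (M <= m)%N -> forall n, (n < N)%N ->
      a j n * mag ((X (u m) - l) n : k) <= e / N.+1%:R.
    move: e1; move: (e / _) => d d0; elim: (N) => [|i [M MP]]; first by exists 0%N.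
    have ai : 0 < a j i by apply: lt_le_trans (a1 j i).
    have [M' MP'] := lP i _ (divr_gt0 d0 ai); exists (maxn M M') => m.
    rewrite geq_max => /andP[m1 m2] n; rewrite ltnS leq_eqVlt => /orP[/eqP ->|]; last exact: MP.
    by have := MP' m m2; rewrite ltr_pdivlMr // mulrC => /ltW.
  exists M => m /MP h; apply: le_lt_trans (wnorm_bound _ _ _) _.
  apply: (@le_lt_trans _ _ (\sum_(n < N) e / N.+1%:R)); first by apply: ler_sum => n _; exact: h.
  rewrite sumr_const card_ord -[_ *+ N]mulr_natr -mulrA -[ltRHS]mulr1 ltr_pM2l //.
  by rewrite mulrC ltr_pdivrMr // mul1r ltr_nat.
(* [M] is independent of [N]: only the auxiliary index [m'] depends on the truncation. This
   uniformity puts [l] in the space and gives convergence for [p j]. *)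
have bnd j e : 0 < e -> exists M, forall m, (M <= m)%N -> forall N, wnorm j (X (u m) - l) N <= e.
  move=> e0; have [M MP] := uc j _ e0; exists M => m mM N; apply/ler_addgt0Pr => d d0.
  have [M' MP'] := lim j N _ d0; pose m' := maxn M M'.
  have h1 := MP m m' mM (leq_maxl _ _); have h2 := MP' m' (leq_maxr _ _).
  have h3 := rsn_tri (X (u m')) (X (u m)) l (wnorm_seminorm j N).
  have h4 := wt_le W (u m - u m') j N; rewrite wt_B in h4; lra.
have [v vE] : exists v, X v = l.
  apply: (wt_onto W) => j; have [M MP] := bnd j 1 ltr01.
  exists (p j (u M) + 1) => N; have h := rsn_dist l (X (u M)) (wnorm_seminorm j N).
  rewrite (rsn_subC _ _ (wnorm_seminorm j N)) in h.
  have := MP M (leqnn M) N; have := wt_le W (u M) j N; lra.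
exists v => j e e0; have e2 : 0 < e / 2 by rewrite divr_gt0.
have [M MP] := bnd j _ e2; exists M => m /MP h; apply: (@le_lt_trans _ _ (e / 2)); last lra.
by apply: (wt_lub W) => N; rewrite wt_B vE.
Qed.

Lemma wt_truncation v j e : 0 < e -> exists M, forall w,
  (forall n, X w n = if (n < M)%N then X v n else 0) -> p j (v - w) <= e.
Proof.
move=> e0; have [M MP] : exists M, forall N, wsum j (X v) N <= wsum j (X v) M + e ^+ 2.
  pose S := [set wsum j (X v) N | N in [set: nat]].
  have hs : has_sup S.
    split; first by exists (wsum j (X v) 0), 0%N.
    exists (p j v ^+ 2) => _ [N _ <-]; rewrite -wnorm_sqr ler_pXn2r ?nnegrE ?wnorm_ge0 ?(wt_le W) //.
    exact: rsn_ge0 (wt_seminorm j).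
  have [_ [M _ <-] hM] := sup_adherent (exprn_gt0 2 e0) hs; exists M => N.
  have : wsum j (X v) N <= sup S by apply: (sup_upper_bound hs); exists N.
  lra.
exists M => w wE; apply: (wt_lub W) => N; apply: wnorm_le; first exact: ltW.
apply: le_trans (wsum_mono j _ (leq_addl M N)) _.
suff h : wsum j (X (v - w)) (M + N) = wsum j (X v) (M + N) - wsum j (X v) M.
  by rewrite h; have := MP (M + N)%N; lra.
have diff n : X (v - w) n = if (n < M)%N then 0 else X v n.
  rewrite wt_B; change ((X v n : k) - X w n = if (n < M)%N then 0 else X v n).
  by rewrite wE; case: ifP => _; rewrite ?subrr ?subr0.
elim: N => [|N IH].
  rewrite addn0 subrr /wsum big1 // => n _.
  by rewrite diff ltn_ord mag0 mulr0 expr0n.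
rewrite addnS /wsum !big_ord_recr /= -!/(wsum _ _ _) IH diff ltnNge leq_addr /=; lra.
Qed.

Lemma wt_finite (x : nat -> k^o) M : (forall n, (M <= n)%N -> x n = 0) -> exists v, X v = x.
Proof.
by move=> x0; apply: (wt_onto W) => j; exists (wnorm j x M) => N; exact: wnorm_finite.
Qed.

End Space.

End WeightedSequences.

(** On the unit ball of [q] the first [M] functionals are bounded, so the vectors fall into finitely
    many classes according to the cells of their values; the remaining functionals have a small
    square sum. One representative is taken for each class. *)
Lemma hs_schwartz (R : realType) (c : scalar_kind) (E : topologicalLmodType (scalar_field R c)) :
  locally_seminormed E -> hs_condition E ->
  forall U : set E, nbhs (0 : E) U -> exists2 V : set E, nbhs (0 : E) V &
  forall e : scalar_field R c, 0 < e -> exists s : seq E,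
    forall v, V v -> exists2 x, x \in s & exists2 u, U u & v = x + e *: u.
Proof.
set k := scalar_field R c.
move=> lE hE U /lE[p pc pU]; have [q [phi [a [qc [phil a0 phia [A aA] Pphi]]]]] := hE p pc.
have qs := proj1 qc; have ps := proj1 pc.
exists [set x | q x < 1]; first exact: (proj2 qc).
move=> e' /emb_gt0[e0]; set e := mag e' in e0 *; move=> eE.
(* The low part costs [d], the tail [4 * d] because [q (v - z) <= 2], and the domination [d]: six in
   all, and a seventh for strictness. *)
pose d := e ^+ 2 / 7; have d0 : 0 < d by rewrite divr_gt0 ?exprn_gt0.
have aM n : a n <= A + 1.
  have := aA n.+1; rewrite big_ord_recr /= => h.
  have : 0 <= \sum_(i < n) a i ^+ 2 by rewrite sumr_ge0 // => i _; exact: sqr_ge0.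
  have := sqr_ge0 (a n - 1); nra.
have [M MP] : exists M, forall N, \sum_(n < N) a n ^+ 2 <= \sum_(n < M) a n ^+ 2 + d.
  pose S := [set \sum_(n < N) a n ^+ 2 | N in [set: nat]].
  have hs : has_sup S.
    by split; [exists (\sum_(n < 0) a n ^+ 2), 0%N|exists A => _ [N _ <-]].
  have [_ [M _ <-] hM] := sup_adherent d0 hs; exists M => N.
  have : \sum_(n < N) a n ^+ 2 <= sup S by apply: (sup_upper_bound hs); exists N.
  lra.
pose h := Num.sqrt (d / M.+1%:R); have h0 : 0 < h by rewrite sqrtr_gt0 divr_gt0.
have [I [cell cellP]] := scalar_totally_bounded c (A + 1) h0.
pose code v : {ffun 'I_M -> I} := [ffun n : 'I_M => cell (phi n v)].
have ex_rep t : exists z, (exists2 v, q v < 1 & code v = t) -> q z < 1 /\ code z = t.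
  have [[v v1 vt]|no] := pselect (exists2 v, q v < 1 & code v = t); last by exists 0.
  by exists v.
have [rep repP] := choice ex_rep.
exists [seq rep t | t <- enum {ffun 'I_M -> I}] => v /= v1.
have [z1 zv] := repP (code v) (ex_intro2 _ _ v v1 erefl); set z := rep (code v) in z1 zv.
exists z; first by apply: map_f; rewrite mem_enum.
have en0 : e' != 0 by rewrite -eE; apply/eqP; rewrite -(emb0 R c) => /emb_inj e1; rewrite e1 ltxx in e0.
exists (e'^-1 *: (v - z)); last by rewrite scalerA mulfV // scale1r addrC subrK.
apply: pU => /=; rewrite (rsn_Z _ _ ps) magV ltr_pdivrMl ?mulr1 //.
rewrite -(@ltr_pXn2r _ 2) ?nnegrE ?(rsn_ge0 _ ps) ?(ltW e0) //.
have phiB n : phi n (v - z) = (phi n v : k) - phi n z.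
  by rewrite addrC -scaleN1r phil scaleN1r addrC.
have q2 : q (v - z) <= 2 by have := rsn_B v z qs; lra.
have [N NP] := Pphi (v - z) d d0; apply: le_lt_trans NP _.
have low : \sum_(n < M) mag (phi n (v - z) : k) ^+ 2 <= d.
  apply: (@le_trans _ _ (\sum_(n < M) d / M.+1%:R)).
    apply: ler_sum => n _; have -> : d / M.+1%:R = h ^+ 2.
      by rewrite sqr_sqrtr // divr_ge0 ?(ltW d0).
    rewrite ler_pXn2r ?nnegrE ?mag_ge0 ?(ltW h0) // phiB; apply: cellP.
    - apply: le_trans (phia _ _) _; apply: le_trans (aM n).
      by rewrite -[leRHS]mulr1 ler_wpM2l // ltW.
    - apply: le_trans (phia _ _) _; apply: le_trans (aM n).
      by rewrite -[leRHS]mulr1 ler_wpM2l // ltW.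
    - by have := congr1 (fun g : {ffun 'I_M -> I} => g n) zv; rewrite !ffunE.
  rewrite sumr_const card_ord -[_ *+ M]mulr_natr -mulrA -[leRHS]mulr1 ler_pM2l //.
  by rewrite mulrC ler_pdivrMr // mul1r ler_nat.
have tail : \sum_(n < N) mag (phi n (v - z) : k) ^+ 2 <=
    \sum_(n < M) mag (phi n (v - z) : k) ^+ 2 + 4 * d.
  apply: le_trans (sum_sq_mono (fun n => mag (phi n (v - z) : k)) (leq_addl M N)) _.
  have : \sum_(n < M + N) mag (phi n (v - z) : k) ^+ 2 - \sum_(n < M) mag (phi n (v - z) : k) ^+ 2
      <= 4 * (\sum_(n < M + N) a n ^+ 2 - \sum_(n < M) a n ^+ 2).
    elim: (N) => [|i IH]; first by rewrite addn0 !subrr mulr0.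
    rewrite addnS !big_ord_recr /=.
    have h1 : mag (phi (M + i)%N (v - z) : k) <= 2 * a (M + i)%N.
      by apply: le_trans (phia _ _) _; rewrite mulrC ler_wpM2r.
    have h2 : mag (phi (M + i)%N (v - z) : k) ^+ 2 <= (2 * a (M + i)%N) ^+ 2.
      by rewrite ler_pXn2r ?nnegrE ?mag_ge0 ?mulr_ge0.
    rewrite exprMn in h2; lra.
  have := MP (M + N)%N; lra.
have dE : e ^+ 2 = 7 * d by rewrite /d mulrC divfK.
rewrite dE; apply: (@le_lt_trans _ _ (d + 4 * d + d)); last by clear - d0; lra.
by rewrite lerD2r; apply: le_trans tail _; rewrite lerD2r.
Qed.

Lemma hilbertian_generated_seminormed (R : realType) (c : scalar_kind)
  (E : topologicalLmodType (scalar_field R c)) : hilbertian_generated E -> locally_seminormed E.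
Proof. by move=> hE U /hE[p [pc _ pU]]; exists p. Qed.

(** * Topological properties of weighted sequence spaces *)

Section WeightedTVS.
Variables (R : realType) (c : scalar_kind).
Local Notation k := (scalar_field R c).
Local Notation emb := (@emb R c).
Variable a : nat -> nat -> R.
Hypotheses (a1 : forall j n, 1 <= a j n) (aj : forall j n, a j n <= a j.+1 n)
  (an : forall j n, a j n <= a j n.+1).
Variables (E : topologicalLmodType k) (X : E -> nat -> k^o) (p : nat -> E -> R).
Hypotheses (W : weighted a X p)
  (nb : forall A, nbhs (0 : E) A <-> exists j e, 0 < e /\ [set x | p j x < e] `<=` A).

Let ps j : real_seminorm (p j) := wt_seminorm W j.

Lemma wt_csn j : cont_seminorm (p j).
Proof.
split; first exact: ps.
by apply/nb; exists j, 1; split=> //; exact: ltr01.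
Qed.

Lemma wt_countably_seminormed : countably_seminormed E.
Proof.
exists (fun n x => n.+1%:R * p n x); split=> [n|U /nb[j [e [e0 eU]]]].
  by apply: csn_scale (wt_csn n); rewrite ler0n.
have [M MP] := inv_small e0; exists (maxn j M) => x /= hx; apply: eU => /=.
apply: le_lt_trans (wt_mono a1 W x aj (leq_maxl j M)) _.
apply: lt_trans _ (MP (maxn j M) (leq_maxr _ _)).
by rewrite -[ltRHS]mulr1 ltr_pdivlMl ?ltr0Sn.
Qed.

Lemma wt_separated : separated E.
Proof.
move=> x hx; apply: (wt_inj W); rewrite (wt_0 W); apply/funext => n.
apply: mag_eq0; apply/eqP; rewrite eq_le mag_ge0 andbT; apply/ler_addgt0Pr => e e0.
rewrite add0r; apply: ltW; apply: le_lt_trans (wt_coord a1 W x 0 n) _.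
by apply: (hx [set x | p 0%N x < e]); apply/nb; exists 0%N, e; split.
Qed.

Lemma wt_complete_tvs : complete_tvs E.
Proof.
apply: (seq_complete wt_countably_seminormed) => u uc.
have [|l lP] := wt_complete a1 W (u := u).
  by move=> j e e0; apply: (uc [set x | p j x < e]); exact: csn_nbhs (wt_csn j) e0.
exists l => U /nb[j [e [e0 eU]]]; have [M MP] := lP j e e0.
by exists M => n /MP h; apply: eU.
Qed.

Lemma wt_frechet : frechet E.
Proof.
by apply/frechetP; split; [split|]; [exact: wt_separated|exact: wt_countably_seminormed|exact: wt_complete_tvs].
Qed.

Lemma wt_hilbertian_generated : hilbertian_generated E.
Proof.
move=> U /nb[j [e [e0 eU]]]; have [f ff fE] := wt_hilbertian W j.
have t0 : 0 <= e^-1 by rewrite invr_ge0 ltW.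
have [gg gN] := psd_form_scale ff t0.
exists (fun x => e^-1 * p j x); split; first by apply: csn_scale (wt_csn j).
  by exists (fun x y => emb (e^-1 ^+ 2) * f x y) => // x; rewrite gN fE.
by move=> x /= hx; apply: eU => /=; rewrite -[ltRHS]mulr1 -ltr_pdivrMl.
Qed.

Lemma geometric_squares N : \sum_(n < N) ((2 ^+ n)^-1 : R) ^+ 2 <= 2.
Proof.
have h : \sum_(n < N) ((2 ^+ n)^-1 : R) ^+ 2 <= 2 - (2 ^+ N)^-1 * 2.
  elim: N => [|N IH]; first by rewrite big_ord0 expr0 invr1; lra.
  rewrite big_ord_recr /= [2 ^+ N.+1]exprS invfM; move: IH.
  have : (2 ^+ N)^-1 <= 1 :> R by rewrite invf_le1 ?exprn_gt0 // exprn_ege1 // ler1n.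
  have : 0 <= (2 ^+ N)^-1 :> R by rewrite invr_ge0 exprn_ge0.
  move: ((2 ^+ N)^-1) => t t0 t1 IH; have : t ^+ 2 <= t * 1 by rewrite expr2 ler_wpM2l.
  by rewrite mulrAC mulVf // mul1r; lra.
have : 0 <= (2 ^+ N)^-1 :> R by rewrite invr_ge0 exprn_ge0.
move: h; move: ((2 ^+ N)^-1) => t; lra.
Qed.

(** From level [j.+1] to level [j] the identity is diagonal with entries [2^-n], hence
    Hilbert-Schmidt; the functionals are the weighted coordinates. *)
Lemma wt_hs_condition : (forall j n, a j.+1 n = 2 ^+ n * a j n) -> hs_condition E.
Proof.
move=> a2 P Pc; have Ps := proj1 Pc.
have /nb[j [e [e0 eP]]] := proj2 Pc; pose C := e^-1.
have C0 : 0 < C by rewrite invr_gt0.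
have PC x : P x <= C * p j x.
  have := @rsn_le _ _ _ (fun x => C * p j x) P; apply=> //.
    by apply: rsn_scale (ps j); exact: ltW.
  by move=> y; rewrite ltr_pdivrMl // mulr1 => /eP/ltW.
exists (p j.+1), (fun n x => emb (C * a j n) * (X x n : k)), (fun n => C * (2 ^+ n)^-1).
split; first exact: wt_csn.
have magE n x : mag (emb (C * a j n) * (X x n : k)) = C * (a j n * mag (X x n : k)).
  by rewrite magM mag_emb ger0_norm ?mulrA // mulr_ge0 ?(ltW C0) ?(weight_ge0 a1).
split.
- move=> n t x y; rewrite (wt_linear W).
  change (emb (C * a j n) * (t * (X x n : k) + (X y n : k)) =
    t * (emb (C * a j n) * (X x n : k)) + emb (C * a j n) * (X y n : k)).
  by rewrite mulrDr mulrCA.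
- by move=> n; rewrite mulr_ge0 ?(ltW C0) // invr_ge0 exprn_ge0.
- move=> n x; rewrite magE -mulrA ler_pM2l // ler_pdivlMl ?exprn_gt0 // mulrA -a2.
  by apply: le_trans (wnorm_term a1 j.+1 (X x) n) _; exact: wt_le.
- exists (C ^+ 2 * 2) => N; rewrite (eq_bigr (fun n : 'I_N => C ^+ 2 * ((2 ^+ n)^-1) ^+ 2)).
    by rewrite -mulr_sumr ler_wpM2l ?sqr_ge0 // geometric_squares.
  by move=> n _; rewrite exprMn.
- move=> x d d0; apply: contrapT => no.
  have low N : C ^+ 2 * wsum a j (X x) N < P x ^+ 2 - d.
    rewrite ltNge; apply/negP => h; apply: no; exists N; rewrite -lerBlDr; apply: le_trans h _.
    rewrite /wsum mulr_sumr le_eqVlt; apply/orP; left; apply/eqP.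
    by apply: eq_bigr => n _; rewrite magE [RHS]exprMn.
  have D0 : 0 <= P x ^+ 2 - d.
    by apply: ltW; apply: le_lt_trans _ (low 0%N); apply: mulr_ge0; [exact: sqr_ge0|exact: wsum_ge0].
  have hp : p j x <= C^-1 * Num.sqrt (P x ^+ 2 - d).
    apply: (wt_lub W) => N; apply: wnorm_le; first by apply: mulr_ge0; [rewrite invr_ge0; exact: ltW|exact: sqrtr_ge0].
    by rewrite exprMn sqr_sqrtr // exprVn ler_pdivlMl ?exprn_gt0 //; exact: ltW.
  have hP : P x <= Num.sqrt (P x ^+ 2 - d).
    by apply: le_trans (PC x) _; rewrite -ler_pdivlMl.
  have : P x ^+ 2 <= Num.sqrt (P x ^+ 2 - d) ^+ 2.
    by rewrite ler_pXn2r ?nnegrE ?sqrtr_ge0 // rsn_ge0.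
  by rewrite sqr_sqrtr //; lra.
Qed.

End WeightedTVS.

(** * The weighted difference operator *)

Section WeightedDifference.
Variables (R : realType) (c : scalar_kind).
Local Notation k := (scalar_field R c).
Local Notation emb := (@emb R c).
Variable a : nat -> nat -> R.
Hypotheses (a1 : forall j n, 1 <= a j n) (aj : forall j n, a j n <= a j.+1 n)
  (an : forall j n, a j n <= a j n.+1).

(** A diagonal choice, [w n = 1 / (a n n * 2^n)]: it beats level [j] from [n = j] on, where
    [a j n <= a n n], and the finitely many earlier terms are absorbed in [K]. *)
Lemma rapid_decay : exists w : nat -> R, (forall n, 0 < w n <= 1) /\
  forall j, exists2 K, 0 <= K & forall n, a j n * w n <= K * (2 ^+ n)^-1.
Proof.
have two n : 0 < 2 ^+ n :> R by rewrite exprn_gt0.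
have ap j n : 0 < a j n by apply: lt_le_trans (a1 j n).
pose w n := (a n n)^-1 * (2 ^+ n)^-1.
have w0 n : 0 < w n by rewrite mulr_gt0 ?invr_gt0.
exists w; split=> [n|j].
  rewrite w0 /=; apply: mulr_ile1; rewrite ?invr_ge0 ?(ltW (ap _ _)) ?(ltW (two _)) //.
    by rewrite invf_le1.
  by rewrite invf_le1 // exprn_ege1 // ler1n.
have term0 i : 0 <= a j i * w i * 2 ^+ i 
  by apply: ltW; apply: mulr_gt0 => //; apply: mulr_gt0.
have sum0 (P : pred 'I_j) : 0 <= \sum_(i < j | P i) a j i * w i * 2 ^+ i by apply: sumr_ge0.
exists (1 + \sum_(i < j) a j i * w i * 2 ^+ i) => [|n]; first by rewrite addr_ge0 // sum0.
rewrite ler_pdivlMr //; have [nj|jn] := ltnP n j.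
  rewrite (bigD1 (Ordinal nj)) //= addrCA lerDl addr_ge0 // sum0.
apply: (@le_trans _ _ 1); last by rewrite lerDl sum0.
rewrite /w mulrA mulfVK ?gt_eqF // ler_pdivrMr // mul1r.
have mono d : a j n <= a (d + j)%N n.
  by elim: d => [//|d IH]; apply: le_trans IH _; rewrite addSn.
by have := mono (n - j)%N; rewrite subnK.
Qed.

Variables (E : topologicalLmodType k) (X : E -> nat -> k^o) (p : nat -> E -> R).
Hypotheses (W : weighted a X p)
  (nb : forall A, nbhs (0 : E) A <-> exists j e, 0 < e /\ [set x | p j x < e] `<=` A).
Variable w : nat -> R.
Hypotheses (w01 : forall n, 0 < w n <= 1)
  (wd : forall j, exists2 K, 0 <= K & forall n, a j n * w n <= K * (2 ^+ n)^-1).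

Let w0 n : 0 < w n. Proof. by have /andP[] := w01 n. Qed.

Lemma difference_operator : exists A : clin E E,
  forall x n, X (A x) n = emb (w n) * ((X x n : k) - X x n.+1) :> k.
Proof.
pose D (y : nat -> k^o) : nat -> k^o := fun n => emb (w n) * ((y n : k) - y n.+1).
have Dle j x N : wnorm a j (D (X x)) N <= 2 * p j x.
  apply: (@le_trans _ _ (wnorm a j (X x - (fun n => X x n.+1)) N)).
    apply: wnorm_compare => // n _; apply: ler_wpM2l; first exact: weight_ge0.
    rewrite magM mag_emb ger0_norm ?(ltW (w0 n)) // -[leRHS]mul1r.
    by apply: ler_wpM2r; [exact: mag_ge0|have /andP[] := w01 n].
  have h := rsn_B (X x) (fun n => X x n.+1) (wnorm_seminorm c a j N); apply: le_trans h _.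
  have := wnorm_shift a1 (X x) N (an j); have := wt_le W x j N; have := wt_le W x j N.+1; lra.
have exA x : exists y, X y = D (X x).
  by apply: (wt_onto W) => j; exists (2 * p j x) => N; exact: Dle.
have [A AE] := choice exA.
have Al : linear A.
  move=> t x y; apply: (wt_inj W); rewrite (wt_linear W) !AE (wt_linear W).
  apply/funext => n; rewrite /D.
  change (emb (w n) * ((t * (X x n : k) + (X y n : k)) - (t * (X x n.+1 : k) + (X y n.+1 : k))) =
    t * (emb (w n) * ((X x n : k) - X x n.+1)) + emb (w n) * ((X y n : k) - X y n.+1)).
  by rewrite opprD addrACA -mulrBr mulrDr mulrCA.
have [B BE] : exists B : clin E E, forall x, B x = A x.
  apply: clin_intro => // S /nb[j [e [e0 eS]]]; apply/nb; exists j, (e / 2).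
  split=> [|x /= xe]; first by rewrite divr_gt0.
  apply: eS; apply: le_lt_trans (_ : p j (A x) <= 2 * p j x) _.
    by apply: (wt_lub W) => N; rewrite AE; exact: Dle.
  by move: xe; rewrite ltr_pdivlMr // mulrC.
by exists B => x n; rewrite BE AE.
Qed.

Lemma first_coordinate : exists f : clin E k^o, forall x, f x = X x 0%N.
Proof.
apply: clin_intro => [t x y|S /normed_nbhs0[e e0 eS]]; first by rewrite (wt_linear W).
apply/nb; exists 0%N, e; split=> // x /= xe; apply: eS.
change (mag `|X x 0%N : k| < e); rewrite normE mag_emb ger0_norm ?mag_ge0 //.
by apply: le_lt_trans xe; exact: (wt_coord a1 W x 0 0).
Qed.

Variable A : clin E E.
Hypothesis AE : forall x n, X (A x) n = emb (w n) * ((X x n : k) - X x n.+1) :> k.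

Let emb_w n : emb (w n) != 0.
Proof. by apply/eqP; rewrite -(emb0 R c) => /emb_inj h; have := w0 n; rewrite h ltxx. Qed.

(** The kernel consists of constant sequences, and as all weights are at least 1 a nonzero constant
    is not square-summable. *)
Lemma difference_inj x : A x = 0 -> x = 0.
Proof.
move=> Ax; have step n : X x n.+1 = X x n.
  have := AE x n; rewrite Ax (wt_0 W) => h; apply/eqP; rewrite eq_sym -subr_eq0.
  have : emb (w n) * ((X x n : k) - X x n.+1) == 0 by rewrite -h.
  by rewrite mulf_eq0 (negbTE (emb_w n)).
have cst n : X x n = X x 0%N by elim: n => [//|n IH]; rewrite step.
apply: (wt_inj W); rewrite (wt_0 W); apply/funext => n; rewrite cst.
apply: mag_eq0; apply/eqP; rewrite -sqrf_eq0 eq_le sqr_ge0 andbT leNgt; apply/negP => h.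
set s := mag _ ^+ 2 in h.
have bound N : N%:R * s <= p 0%N x ^+ 2.
  apply: (@le_trans _ _ (wsum a 0 (X x) N)); last first.
    rewrite -wnorm_sqr ler_pXn2r ?nnegrE ?wnorm_ge0 ?(wt_le W) //.
    exact: rsn_ge0 (wt_seminorm W 0).
  rewrite mulr_natl -[N in leLHS]card_ord -sumr_const; apply: ler_sum => i _.
  rewrite cst /s ler_pXn2r ?nnegrE ?mulr_ge0 ?mag_ge0 ?(weight_ge0 a1) //.
  by rewrite -[leLHS]mul1r ler_wpM2r ?mag_ge0.
have := bound (Num.truncn (p 0%N x ^+ 2 / s)).+1; rewrite leNgt => /negP; apply.
by rewrite -ltr_pdivrMr // truncnS_gt.
Qed.

(** Finitely supported sequences are dense, and for them the recursion can be solved backwards from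
    the end of the support: [z n] is the sum of [X x i / w i] over [n <= i < M]. *)
Lemma difference_dense x : adherent (range A) x.
Proof.
move=> S /nb[j [e [e0 eS]]]; have e2 : 0 < e / 2 by rewrite divr_gt0.
have [M MP] := wt_truncation W x j e2.
pose z n : k^o := \sum_(n <= i < M) (emb (w i))^-1 * (X x i : k).
have [|v vE] := wt_finite W (x := z) (M := M); first by move=> n nM; rewrite /z big_geq.
exists (A v); first by exists v.
apply: eS => /=; apply: (@le_lt_trans _ _ (e / 2)); last lra.
apply: MP => n; apply: etrans (AE v n) _; rewrite vE /z; case: ltnP => nM.
  by rewrite [in X in X - _]big_ltn // addrK mulrA mulfV // mul1r.
by rewrite !big_geq ?subrr ?mulr0 // ltnW.
Qed.

Lemma weight_sequence : exists v, forall n, X v n = emb (w n).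
Proof.
have [|v vE] := wt_onto W (x := fun n => emb (w n)); last by exists v => n; rewrite vE.
move=> j; have [K K0 KP] := wd j; exists (K * 2) => N; apply: wnorm_le.
  by rewrite mulr_ge0.
apply: (@le_trans _ _ (K ^+ 2 * \sum_(n < N) ((2 ^+ n)^-1) ^+ 2)).
  rewrite mulr_sumr; apply: ler_sum => n _; rewrite -exprMn.
  rewrite ler_pXn2r ?nnegrE ?mulr_ge0 ?mag_ge0 ?(weight_ge0 a1) ?invr_ge0 ?exprn_ge0 //.
  by rewrite mag_emb ger0_norm ?(ltW (w0 n)).
apply: (@le_trans _ _ (K ^+ 2 * 2)); last by have := sqr_ge0 K; lra.
by apply: ler_wpM2l; [exact: sqr_ge0|exact: geometric_squares].
Qed.

(** A preimage would decrease by 1 at each step, whereas coordinates are bounded by [p 0]. *)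
Lemma difference_not_onto v : (forall n, X v n = emb (w n)) -> forall x, A x <> v.
Proof.
move=> vE x Ax; have step n : (X x n.+1 : k) = (X x n : k) - 1.
  have := AE x n; rewrite Ax vE -[LHS]mulr1 => /(mulfI (emb_w n)) ->.
  by rewrite opprB addrC subrK.
have lin n : (X x n : k) = (X x 0%N : k) - emb n%:R.
  elim: n => [|n IH]; first by rewrite (emb0 R c) subr0.
  by rewrite step IH -natr1 embD emb1 opprD addrA.
pose B := mag (X x 0%N : k) + p 0%N x.
have bound n : n%:R <= B.
  have := magD (X x 0%N : k) (- X x n); rewrite magN (lin n) opprB addrCA subrr addr0 mag_emb ger0_norm //.
  move=> h; apply: le_trans h _; rewrite lerD2l -lin; exact: (wt_coord a1 W x 0 n).
have := bound (Num.truncn B).+1; rewrite leNgt => /negP; apply; exact: truncnS_gt.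
Qed.

(** Take ones at the indices [0] to [M]: the image has the single entry [w M] at place [M], of
    [j]-th norm [a j M * w M], which tends to zero with [M]. *)
Lemma difference_unbounded_below S : nbhs (0 : E) S -> exists2 x, S (A x) & X x 0%N = 1.
Proof.
move=> /nb[j [e [e0 eS]]]; have [K K0 KP] := wd j.
have K1 : 0 < K + 1 by lra.
have [M MP] := inv_small (divr_gt0 e0 K1); have /MP small := leqnn M.
pose z n : k^o := if (n <= M)%N then 1 else 0.
have [|x xE] := wt_finite W (x := z) (M := M.+1).
  by move=> n; rewrite /z ltnNge => /negbTE ->.
exists x; last by rewrite xE /z.
apply: eS => /=; apply: (@le_lt_trans _ _ (a j M * w M)); last first.
  apply: le_lt_trans (KP M) _; rewrite ltr_pdivlMr // in small.
  apply: le_lt_trans small; rewrite [leRHS]mulrC; apply: ler_pM => //.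
  - lra.
  - by rewrite lef_pV2 ?posrE ?exprn_gt0 // -natrX ler_nat ltn_expl.
have coord n : (X (A x) n : k) = if n == M then emb (w M) else 0.
  apply: etrans (AE x n) _; rewrite xE /z; case: (ltngtP n M) => [nM|nM|->].
  - by rewrite subrr mulr0.
  - by rewrite subrr mulr0.
  - by rewrite subr0 mulr1.
have aw : 0 <= a j M * w M by rewrite mulr_ge0 ?(weight_ge0 a1) // ltW.
apply: (wt_lub W) => N; apply: wnorm_le => //; have [NM|MN] := leqP N M.
  rewrite /wsum big1 ?sqr_ge0 // => n _.
  by rewrite coord ltn_eqF ?(leq_trans (ltn_ord n)) // mag0 mulr0 expr0n.
rewrite /wsum (bigD1 (Ordinal MN)) //= big1 ?addr0.
  by rewrite coord eqxx mag_emb ger0_norm // ltW.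
by move=> n nM; rewrite coord ifN ?mag0 ?mulr0 ?expr0n.
Qed.

End WeightedDifference.

Lemma weighted_not_integral (R : realType) (c : scalar_kind) (a : nat -> nat -> R) (T : Type)
  (U : T -> topologicalLmodType (scalar_field R c)) (t : T) X p : stable_class U ->
  (forall j n, 1 <= a j n) -> (forall j n, a j n <= a j.+1 n) -> (forall j n, a j n <= a j n.+1) ->
  weighted a X p ->
  (forall A, nbhs (0 : U t) A <-> exists j e, 0 < e /\ [set x | p j x < e] `<=` A) ->
  quasi_abelian_not_integral (tvs_category U).
Proof.
move=> st a1 aj an W nb; have [w [w01 wd]] := rapid_decay a1 aj.
have [A AE] := difference_operator a1 an W nb w01.
have [f fE] := first_coordinate a1 W nb.
have [v vE] := weight_sequence a1 W w01 wd.
have [||||l r] := @sc_not_integral _ _ U st t A f v.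
- by move=> x; exact: (difference_inj a1 W w01 AE).
- by move=> x; exact: (difference_dense W nb w01 AE).
- exact: (difference_not_onto a1 W w01 AE vE).
- move=> S /(difference_unbounded_below a1 W nb w01 wd AE)[x Sx x1]; exists x => //.
  by rewrite fE.
- by split=> //; exact: sc_quasi_abelian.
Qed.

(** * The two sequence spaces and the conclusion *)

Section SequenceSpaces.
Variables (R : realType) (c : scalar_kind).
Local Notation k := (scalar_field R c).
Local Notation emb := (@emb R c).

Lemma emb_pos (e : R) : 0 < e -> (0 : k) < emb e.
Proof. by move=> e0; rewrite -(emb0 R c) ltr_emb. Qed.

Lemma ltr_mag (t : k) (e : R) : (`|t| < emb e) = (mag t < e).
Proof. by rewrite normE ltr_emb. Qed.

Lemma seminorms_zero_nbhs (V : lmodType k) (p : nat -> V -> R) :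
  (forall j, real_seminorm (p j)) -> (forall i j v, (i <= j)%N -> p i v <= p j v) ->
  zero_nbhs_axioms [set A : set V | exists j e, 0 < e /\ [set x | p j x < e] `<=` A].
Proof.
move=> ps pm; split.
- split.
  + by exists 0%N, 1; split=> //; exact: ltr01.
  + move=> A B [i [d [d0 dA]]] [j [e [e0 eB]]]; exists (maxn i j), (Num.min d e).
    split=> [|x /=]; first by rewrite lt_min d0.
    rewrite lt_min => /andP[xd xe]; split.
      by apply: dA; apply: le_lt_trans xd; exact: (pm _ _ _ (leq_maxl _ _)).
    by apply: eB; apply: le_lt_trans xe; exact: (pm _ _ _ (leq_maxr _ _)).
  + by move=> A B AB [j [e [e0 eA]]]; exists j, e; split=> // x /eA/AB.
- by move=> A [j [e [e0 eA]]]; apply: eA; rewrite /= (rsn_0 (ps j)).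
- move=> A [j [e [e0 eA]]]; exists [set x | p j x < e / 2].
    by exists j, (e / 2); split=> //; rewrite divr_gt0.
  move=> x y /= xe ye; apply: eA => /=; have := rsn_D x y (ps j); lra.
- move=> A [j [e [e0 eA]]]; exists [set x | p j x < e]; first by exists j, e; split.
  exists 1 => // t x /=; rewrite -(emb1 R c) ltr_mag => /ltW t1 xe; apply: eA => /=.
  rewrite (rsn_Z _ _ (ps j)); apply: le_lt_trans xe.
  by rewrite -[leRHS]mul1r ler_wpM2r ?(rsn_ge0 _ (ps j)).
- move=> A x [j [e [e0 eA]]]; have p1 : 0 < p j x + 1 by have := rsn_ge0 x (ps j); lra.
  exists (emb (e / (p j x + 1))); first by apply: emb_pos; rewrite divr_gt0.
  move=> t; rewrite ltr_mag ltr_pdivlMr // => te; apply: eA => /=.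
  by rewrite (rsn_Z _ _ (ps j)); have := mag_ge0 t; lra.
- move=> A t [j [e [e0 eA]]]; have t1 : 0 < mag t + 1 by have := mag_ge0 t; lra.
  exists j, (e / (mag t + 1)); split=> [|x /=]; first by rewrite divr_gt0.
  rewrite ltr_pdivlMr // => xe; apply: eA => /=.
  by rewrite (rsn_Z _ _ (ps j)); have := rsn_ge0 x (ps j); lra.
Qed.

(** These weights describe the Taylor coefficients of entire functions. The ratio [2^n] of
    consecutive levels is the hypothesis of [wt_hs_condition]. *)
Definition space_weight (j n : nat) : R := (2 ^+ n) ^+ j.

Lemma space_weight_ge1 j n : 1 <= space_weight j n.
Proof. by rewrite !exprn_ege1 // ler1n. Qed.

Lemma space_weightS j n : space_weight j.+1 n = 2 ^+ n * space_weight j n.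
Proof. exact: exprS. Qed.

Lemma space_weight_order j n : space_weight j n <= space_weight j.+1 n.
Proof.
rewrite space_weightS -[leLHS]mul1r; apply: ler_wpM2r; first exact: le_trans ler01 (space_weight_ge1 j n).
by rewrite exprn_ege1 // ler1n.
Qed.

Lemma space_weight_index j n : space_weight j n <= space_weight j n.+1.
Proof.
rewrite /space_weight; apply: lerXn2r; rewrite ?nnegrE ?exprn_ge0 //.
by rewrite exprS -[leLHS]mul1r; apply: ler_wpM2r; rewrite ?exprn_ge0 // ler1n.
Qed.

Lemma rapidly_decreasing_space : exists (E : topologicalLmodType k) X p,
  weighted space_weight X p /\
  forall A, nbhs (0 : E) A <-> exists j e, 0 < e /\ [set x | p j x < e] `<=` A.
Proof.
have [V [X [p W]]] := exists_weighted c space_weight_ge1.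
have [|E [i [ibij nb]]] := exists_tvs (seminorms_zero_nbhs (wt_seminorm W) _).
  by move=> j j' v jj'; exact: (wt_mono space_weight_ge1 W v space_weight_order jj').
have [g ig gi] := ibij.
have gl : linear g by move=> t x y; apply: (can_inj ig); rewrite linearP !gi.
have gbij : bijective g by exists i.
exists E, (fun x => X (g x)), (fun j x => p j (g x)).
split=> [|A]; first exact: weighted_transport gl gbij W.
split=> [/nb[j [e [e0 eA]]]|[j [e [e0 eA]]]].
  by exists j, e; split=> // x /= /eA /=; rewrite gi.
by apply/nb; exists j, e; split=> // x /= xe; apply: eA => /=; rewrite ig.
Qed.

Lemma square_summable_banach : exists (B : completeNormedModType k) X p,
  weighted (fun _ _ => 1 : R) X p /\
  forall A, nbhs (0 : B) A <-> exists j e, 0 < e /\ [set x | p j x < e] `<=` A.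
Proof.
have one j n : 1 <= (fun _ _ : nat => 1 : R) j n by [].
have [V [X [p W]]] := exists_weighted c one.
have pE j v : p j v = p 0%N v.
  by apply/eqP; rewrite eq_le; apply/andP; split; (apply: (wt_lub W) => N); [exact: (wt_le W v 0 N)|exact: (wt_le W v j N)].
have [u uc|B [i [surj iE]]] := complete_seminormed_quotient (wt_seminorm W 0).
  have [|l lP] := wt_complete one W (u := u); last by exists l; exact: lP.
  by move=> j e /uc[M MP]; exists M => m n mM nM; rewrite pE; exact: MP.
have i0 v : i v = 0 -> v = 0.
  move=> iv; apply: (wt_inj W); rewrite (wt_0 W); apply/funext => n.
  apply: mag_eq0; apply/eqP; rewrite eq_le mag_ge0 andbT.
  by apply: le_trans (wt_coord one W v 0 n) _; rewrite -iE iv (rsn_0 (@rnorm_seminorm R c B)).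
have iinj : injective i.
  by move=> x y xy; apply/eqP; rewrite -subr_eq0; apply/eqP/i0; rewrite linearB xy subrr.
have [g ig] := choice surj; have gi : cancel i g by move=> x; apply: iinj; rewrite ig.
have gl : linear g by move=> t x y; apply: iinj; rewrite linearP !ig.
have gbij : bijective g by exists i.
exists B, (fun x => X (g x)), (fun j x => p j (g x)).
split=> [|A]; first exact: weighted_transport gl gbij W.
have rE x : p 0%N (g x) = rnorm x by rewrite -iE ig.
split=> [/normed_nbhs0[e e0 eA]|[j [e [e0 eA]]]].
  by exists 0%N, e; split=> // x /=; rewrite rE => /eA.
apply/normed_nbhs0; exists e => // x xe; apply: eA => /=; by rewrite pE rE.
Qed.

End SequenceSpaces.

Theorem theorem3p2 (R : realType) (c : scalar_kind) :
  quasi_abelian_not_integral (BAN R c) /\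
  quasi_abelian_not_integral (NOR R c) /\
  quasi_abelian_not_integral (FRE R c) /\
  quasi_abelian_not_integral (HD_LCS R c) /\
  quasi_abelian_not_integral (HD_TVS R c) /\
  quasi_abelian_not_integral (NUC R c) /\
  quasi_abelian_not_integral (FN R c) /\
  quasi_abelian_not_integral (FS R c) /\
  quasi_abelian_not_integral (FH R c).
Proof.
have [B [X [p [W nb]]]] := square_summable_banach R c.
have one j n : 1 <= (fun _ _ : nat => 1 : R) j n by [].
have le1 j n : (fun _ _ : nat => 1 : R) j n <= (fun _ _ : nat => 1 : R) j.+1 n by [].
have le2 j n : (fun _ _ : nat => 1 : R) j n <= (fun _ _ : nat => 1 : R) j n.+1 by [].
have [E [Y [q [WE nbE]]]] := rapidly_decreasing_space R c.
have w1 := @space_weight_ge1 R; have w2 := @space_weight_order R; have w3 := @space_weight_index R.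
(* The one space [E] belongs to all seven classes given by a predicate, so its difference operator
   serves in each of these full subcategories. *)
have full (P : topologicalLmodType (scalar_field R c) -> Prop) : permanent P -> P E ->
    quasi_abelian_not_integral (full_tvs_subcategory P).
  move=> Pp PE; apply: (@weighted_not_integral R c _ _ _ (exist P E PE) Y q) => //.
  by apply: permanent_full => //; exists E.
have sE : separated E := wt_separated w1 WE nbE.
have fE : frechet E := wt_frechet w1 w2 WE nbE.
have hgE : hilbertian_generated E := wt_hilbertian_generated WE nbE.
have lE : locally_seminormed E := hilbertian_generated_seminormed hgE.
have hsE : hs_condition E := wt_hs_condition w1 WE nbE (@space_weightS R).
have nE : nuclear E by exact: hs_nuclear.
split.
  exact: (@weighted_not_integral R c _ _ _ B X p (stable_BAN B) one le1 le2 W nb).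
split.
  exact: (@weighted_not_integral R c _ _ _ (B : normedModType _) X p (@stable_NOR R c) one le1 le2 W nb).
split; first exact: full (@permanent_frechet R c) fE.
split.
  apply: full (@permanent_hausdorff_lcs R c) _.
  by split; [exact/separatedP|exact/locally_convexP].
split; first by apply: full (@permanent_hausdorff R c) _; exact/separatedP.
split; first exact: full (@permanent_nuclear R c) nE.
split; first by apply: full (@permanent_nuclear_frechet R c) _.
split.
  apply: full (@permanent_frechet_schwartz R c) _.
  by split=> //; exact: hs_schwartz.
apply: full (@permanent_frechet_hilbert R c) _.
by split=> //; exact/hilbertian_generatedP.
Qed.
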